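(* Let $(X_t)_{t\in\mathbb{Z}}$ be a regularly varying, strictly stationary time series with tail process $(Y_t)_{t\in\mathbb{Z}}$ whose finite-dimensional distributions are denoted by $(\mu_I)_{I\subset\mathbb{Z}}$. Let $t,N\in\mathbb{N}_0$ and let $A_0,\ldots,A_N\subset[0,\infty)\times(1,\infty)\times[0,\infty)^t$ be continuity sets with respect to $\mu_{\{-1,\ldots,t\}}$. Assume that Condition (M) (see context) holds with threshold sequence $(u_n)_{n\in\mathbb{N}}$, that the $\alpha$-mixing coefficients satisfy $\alpha_n\in\mathcal{O}(n^{-\delta})$ for some $\delta\ge2$, and that $$\lim_{n\to\infty}n^{\delta/(4+\delta)}\,\mathbb{P}(X_0>u_n)=\infty\quad\text{if }\delta>2,$$ or $$\lim_{n\to\infty}n^{1/2}\,\frac{\mathbb{P}(X_0>u_n)^{3/2}}{|\log(\mathbb{P}(X_0>u_n))|}=\infty\quad\text{if }\delta=2.$$ Then, as $n\to\infty$, $$\sqrt{n\,\mathbb{P}(X_0>u_n)}\left(\frac{\widehat{P}_{n,u_n}(A_j)}{\mathbb{P}(X_0>u_n)}-\mathbb{P}\big((X_i)_{i=-1}^t\in u_nA_j\mid X_0>u_n\big)\right)_{j=0,\ldots,N}\longrightarrow_d\mathcal{N}(\mathbf{0},\Sigma),$$ where $\Sigma=(\sigma_{jl})_{0\le j,l\le N}$ with $$\sigma_{jl}=\mu_{\{-1,\ldots,t\}}(A_j\cap A_l)+\sum_{h=1}^\infty\mathbb{P}\big((Y_i)_{i=-1}^t\in A_j,\,(Y_i)_{i=h-1}^{h+t}\in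 A_l\big)+\sum_{h=1}^\infty\mathbb{P}\big((Y_i)_{i=-1}^t\in A_l,\,(Y_i)_{i=h-1}^{h+t}\in A_j\big).$$
   Context: Standing assumptions: the time series $(X_t)_{t\in\mathbb{Z}}$ is strictly stationary, its marginal distribution function has a finite lower endpoint and lies in the max-domain of attraction of the $\alpha$-Fréchet distribution $\Phi_\alpha(x)=\exp(-x^{-\alpha})$, $x>0$, for some $\alpha>0$. A random vector $\mathbf{X}$ in $\mathbb{R}^d$ is multivariate regularly varying with index $\alpha>0$ if for some norm $\|\cdot\|$ there is a probability measure $\sigma$ on $\{\mathbf{x}\in[0,\infty)^d:\|\mathbf{x}\|=1\}$ such that, for $r>0$, $\mathbb{P}(\|\mathbf{X}\|>rx,\ \mathbf{X}/\|\mathbf{X}\|\in\cdot)/\mathbb{P}(\|\mathbf{X}\|>x)$ converges weakly to $r^{-\alpha}\sigma(\cdot)$ as $x\to\infty$. The time series is regularly varying if all its finite-dimensional margins are multivariate regularly varying; equivalently, there is a process $Y=(Y_t)_{t\in\mathbb{Z}}$, called the tail process, with $\mathbb{P}(Y_0>y)=y^{-\alpha}$ for $y\ge1$ such that for all integers $s<t$ the conditional law of $(X_s/x,\ldots,X_t/x)$ given $X_0>x$ converges weakly to the law of $(Y_s,\ldots,Y_t)$ as $x\to\infty$. For $I\subset\mathbb{Z}$, $\mu_I$ is the law of $(Y_i)_{i\in I}$. A Borel set $A$ is a continuity set with respect to $\mu_{\{-1,\ldots,t\}}$ if $\mu_{\{-1,\ldots,t\}}(\partial A)=0$, with $\partial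 A$ the topological boundary in $\mathbb{R}^{t+2}$. The $\alpha$-mixing coefficients are $$\alpha_h=\sup_{A,B\in\mathcal{B}(\mathbb{R}^{\mathbb{N}})}\big|\mathbb{P}((X_s)_{s\le0}\in A,\,(X_s)_{s\ge h}\in B)-\mathbb{P}((X_s)_{s\le0}\in A)\,\mathbb{P}((X_s)_{s\ge h}\in B)\big|,\quad h\ge0.$$ Condition (M): there exist a sequence $(u_n)_{n\in\mathbb{N}}\subset\mathbb{R}$ of thresholds and an intermediate sequence $(r_n)_{n\in\mathbb{N}}\subset\mathbb{N}$ with $u_n\to\infty$, $r_n\to\infty$, $n\mathbb{P}(X_0>u_n)\to\infty$ and $r_n\mathbb{P}(X_0>u_n)\to0$ as $n\to\infty$, such that $$\lim_{n\to\infty}\frac1{\mathbb{P}(X_0>u_n)}\sum_{h=r_n}^\infty\alpha_h=0\quad\text{and}\quad\lim_{k\to\infty}\limsup_{n\to\infty}\sum_{h=k}^{r_n}\mathbb{P}(X_h>u_n\mid X_0>u_n)=0.$$ Based on observations $X_{-1},\ldots,X_n$ and a threshold $u$, $$\widehat{P}_{n,u}(A)=\frac1n\sum_{k=1}^{n-t}\mathbf{1}_{\{(X_i)_{i=k-1}^{k+t}\in uA\}},\qquad uA=\{ua:a\in A\}.$$ *)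

(* Defs.v *)
From HB Require Import structures.
From mathcomp Require Import all_boot all_order all_algebra.
From mathcomp Require Import all_classical all_reals all_analysis.

Set Implicit Arguments.
Unset Strict Implicit.
Unset Printing Implicit Defensive.

Import Order.TTheory GRing.Theory Num.Theory.
Import numFieldNormedType.Exports.

Local Open Scope classical_set_scope.
Local Open Scope ring_scope.

Definition borelRn (R : realType) (n : nat) :=
  g_sigma_algebraType (@open 'rV[R]_n).

Definition borel_set (R : realType) (n : nat) (A : set 'rV[R]_n) : Prop :=
  <<s @open 'rV[R]_n >> A.

Definition boundary (T : topologicalType) (A : set T) : set T :=
  closure A `\` interior A.

(* Weak convergence along the filter F.  Finite measures on R^n are represented
   by their integration functionals g |-> \int g on bounded continuous
   functions, so that laws, conditional laws and unnormalised laws of random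
   vectors can be treated alike without being bundled as measures on R^n. *)
Definition weak_cvg (R : realType) (n : nat) (I : Type) (F : set_system I)
    (L : I -> ('rV[R]_n -> R) -> R) (l : ('rV[R]_n -> R) -> R) : Prop :=
  forall g : 'rV[R]_n -> R, continuous g -> bounded_fun g ->
    L i g @[i --> F] --> l g.

(* Univariate N(m, v) with variance v >= 0.  The library's [normal_prob m s] is
   the normal law only for s != 0; the degenerate law has to be added. *)
Definition normal_law (R : realType) (m v : R) (B : set R) : \bar R :=
  if v == 0 then \d_m B else normal_prob m (Num.sqrt v) B.

(* N(m, S) on R^n, S possibly singular: every linear combination of the
   coordinates is univariate normal, with mean and variance given by m and S. *)
Definition multinormal (R : realType) (n : nat)
    (nu : probability (borelRn R n) R) (m : 'rV[R]_n) (S : 'M[R]_n) : Prop :=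
  S^T = S /\
  forall c : 'rV[R]_n,
    let mc := (c *m m^T) ord0 ord0 in
    let vc := (c *m S *m c^T) ord0 ord0 in
    0 <= vc /\
    forall B : set R, measurable B ->
      nu [set x : 'rV[R]_n | B ((c *m x^T) ord0 ord0)] = normal_law mc vc B.

Definition is_norm (R : realType) (n : nat) (N : 'rV[R]_n -> R) : Prop :=
  [/\ forall x y, N (x + y) <= N x + N y,
      forall (a : R) x, N (a *: x) = `|a| * N x
    & forall x, N x = 0 -> x = 0].

Definition frechet (R : realType) (alpha x : R) : R :=
  if 0 < x then expR (- (x `^ (- alpha))) else 0.

(* The sigma-algebra B(R^N): R^N is a countable product of copies of R, so its
   Borel sigma-algebra is generated by the coordinate maps. *)
Definition borel_RN (R : realType) : set (set (nat -> R)) :=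
  <<s \bigcup_i preimage_set_system setT (fun x : nat -> R => x i)
                                     (@measurable _ R) >>.

Section probability_prelim.
Context {d : measure_display} {T : measurableType d} {R : realType}.
Variable P : probability T R.

Definition Pr (A : set T) : R := fine (P A).

Definition cond_Pr (A B : set T) : R := Pr (A `&` B) / Pr B.

(* E[g(V) | B] for an event B and a T-indexed vector V. *)
Definition cond_mean (n : nat) (V : T -> 'rV[R]_n) (B : set T)
    (g : 'rV[R]_n -> R) : R :=
  (\int[P]_(w in B) g (V w)) / Pr B.

(* Multivariate regular variation with index alpha.  For r, x > 0 the measure
   P(N V > r x, V / N V \in .) / P(N V > x) converges weakly to
   r^(-alpha) sigma as x -> oo; sigma lives on the part of the unit sphere of N
   in the nonnegative orthant. *)
Definition mult_regvar (n : nat) (V : T -> 'rV[R]_n) (alpha : R) : Prop :=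
  exists N : 'rV[R]_n -> R, is_norm N /\
  exists sigma : probability (borelRn R n) R,
    sigma [set x : 'rV[R]_n | (forall i, 0 <= x ord0 i) /\ N x = 1] = 1%E /\
    forall r : R, 0 < r ->
      weak_cvg (pinfty_nbhs R)
        (fun x g => (\int[P]_(w in [set w | r * x < N (V w)])
                       g ((N (V w))^-1 *: V w)) / Pr [set w | x < N (V w)])
        (fun g => r `^ (- alpha) * \int[sigma]_y g y).

End probability_prelim.

Section time_series.
Context {d : measure_display} {T : measurableType d} {R : realType}.
Variables (P : probability T R) (X : int -> {RV P >-> R}).

Definition margin (n : nat) (s : 'I_n -> int) (w : T) : 'rV[R]_n :=
  \row_i X (s i) w.

(* (X_s, ..., X_(s+n-1)) *)
Definition window (s : int) (n : nat) : T -> 'rV[R]_n :=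
  margin (fun i : 'I_n => s + (i : nat)%:Z).

Definition window_law (s : int) (n : nat) : set 'rV[R]_n -> \bar R :=
  pushforward P (window s n : T -> borelRn R n).

Definition exceeds (u : R) : set T := [set w | u < X 0 w].

Definition tailp (u : R) : R := Pr P (exceeds u).

Definition strictly_stationary : Prop :=
  forall (n : nat) (s : 'I_n -> int) (h : int) (B : set 'rV[R]_n),
    borel_set B ->
    P (margin (fun i => s i + h) @^-1` B) = P (margin s @^-1` B).

Definition finite_lower_endpoint : Prop :=
  has_lbound [set x : R | (0 < cdf (X 0) x)%E].

Definition in_frechet_domain (alpha : R) : Prop :=
  exists a b : nat -> R, (forall n, 0 < a n) /\
    forall x : R,
      (fine (cdf (X 0) (a n * x + b n))) ^+ n @[n --> \oo] --> frechet alpha x.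

Definition regularly_varying (alpha : R) : Prop :=
  forall (n : nat) (s : 'I_n.+1 -> int), injective s ->
    mult_regvar P (margin s) alpha.

(* alpha-mixing coefficients, with X_0, X_(-1), ... and X_h, X_(h+1), ... read
   as sequences indexed by nat. *)
Definition mixing (h : nat) : R :=
  sup [set x : R | exists A B : set (nat -> R),
    [/\ borel_RN A, borel_RN B &
      let E := [set w | A (fun k => X (- k%:Z) w)] in
      let F := [set w | B (fun k => X (h%:Z + k%:Z) w)] in
      x = `| Pr P (E `&` F) - Pr P E * Pr P F | ] ].

Definition condition_M (u : nat -> R) : Prop :=
  exists r : nat -> nat,
  [/\ u n @[n --> \oo] --> +oo,
      (r n)%:R @[n --> \oo] --> (+oo : set_system R),
      n%:R * tailp (u n) @[n --> \oo] --> +oo &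
      (r n)%:R * tailp (u n) @[n --> \oo] --> (0 : R)] /\
  ((tailp (u n))^-1%:E * \sum_(r n <= h <oo) (mixing h)%:E)%E @[n --> \oo]
    --> 0%E /\
  limn_esup (fun n => (\sum_(k <= h < (r n).+1)
      cond_Pr P [set w | u n < X h%:Z w] (exceeds (u n)))%:E) @[k --> \oo]
    --> 0%E.

Definition scaled_set (n : nat) (u : R) (A : set 'rV[R]_n) : set 'rV[R]_n :=
  (fun a => u *: a) @` A.

Definition emp_measure (t n : nat) (u : R) (A : set 'rV[R]_(t.+2)) (w : T) : R :=
  n%:R^-1 * \sum_(1 <= k < (n - t).+1)
     \1_(scaled_set u A) (window (k%:Z - 1) t.+2 w).

(* The normalised deviation in coordinate j of the empirical measure from its
   pre-asymptotic target. *)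
Definition emp_process (t N : nat) (A : 'I_N.+1 -> set 'rV[R]_(t.+2))
    (u : nat -> R) (n : nat) (w : T) : 'rV[R]_(N.+1) :=
  \row_j (Num.sqrt (n%:R * tailp (u n)) *
    (emp_measure n (u n) (A j) w / tailp (u n)
     - cond_Pr P (window (-1) t.+2 @^-1` scaled_set (u n) (A j))
                 (exceeds (u n)))).

End time_series.

(* Y, possibly on another probability space, is the tail process of X. *)
Definition is_tail_process (R : realType)
    (d : measure_display) (T : measurableType d) (P : probability T R)
    (d' : measure_display) (T' : measurableType d') (Q : probability T' R)
    (X : int -> {RV P >-> R}) (Y : int -> {RV Q >-> R}) (alpha : R) : Prop :=
  (forall y : R, 1 <= y -> tailp Y y = y `^ (- alpha)) /\
  forall s t : int, s < t ->
    let n := `|t - s|%N.+1 in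
    weak_cvg (pinfty_nbhs R)
      (fun x => cond_mean P (fun w => x^-1 *: window X s n w) (exceeds X x))
      (fun g => \int[Q]_w g (window Y s n w)).

(* [0, oo) x (1, oo) x [0, oo)^t *)
Definition evt_domain (R : realType) (t : nat) : set 'rV[R]_(t.+2) :=
  [set x | forall i : 'I_t.+2,
     if i == 1%N :> nat then 1 < x ord0 i else 0 <= x ord0 i].

Section limit_covariance.
Context {d : measure_display} {T : measurableType d} {R : realType}.
Variables (Q : probability T R) (Y : int -> {RV Q >-> R}).

(* sigma_{jl} for (A_j, A_l) = (A, B), as an extended real. *)
Definition limit_cov (t : nat) (A B : set 'rV[R]_(t.+2)) : \bar R :=
  let W (h : nat) := window Y (h%:Z - 1) t.+2 in
  (window_law Y (-1) (A `&` B)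
   + \sum_(1 <= h <oo) Q (W 0%N @^-1` A `&` W h @^-1` B)
   + \sum_(1 <= h <oo) Q (W 0%N @^-1` B `&` W h @^-1` A))%E.

End limit_covariance.

(* Main.v *)
Require Import Defs.
From HB Require Import structures.
From mathcomp Require Import all_boot all_order all_algebra.
From mathcomp Require Import all_classical all_reals all_analysis.
From mathcomp Require Import measurable_realfun.
From mathcomp Require Import ring lra zify.
Set Implicit Arguments.
Unset Strict Implicit.
Unset Printing Implicit Defensive.

Import Order.TTheory GRing.Theory Num.Theory.
Import numFieldNormedType.Exports.

Local Open Scope classical_set_scope.
Local Open Scope ring_scope.


(** The components of the empirical process are, up to a vanishing bias, sums of
   centred indicators that the window around time [k] lies in [u n A j].  By
   stationarity and the Cramer-Wold device it is enough to treat, for each vector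
   [c] of coefficients, one stationary sequence of bounded centred variables
   [xi k] ([score], [xi]), normalised by [x n], the square root of
   [n * tailp X (u n)].  Three ingredients make its sums asymptotically normal.

   Covariances.  Convergence to the tail process, extended from continuous
   functions to continuity sets ([joint_limit]), gives the limit of every single
   covariance divided by the tail probability.  The subtle point is that the
   boundary of the second set must be a null set for a late window of the tail
   process, which is not stationary; a change of threshold in the stationary
   series reduces this to the window around time zero ([null_shift]).  The
   anticlustering half of condition (M) controls lags up to [r n] and the mixing
   half the larger ones ([hit_cov_tail]), so sum and limit may be exchanged
   ([tannery]) and the variance of a block of growing length [b], divided by [b] and
   by the tail probability, tends to the quadratic form of the limiting matrix
   ([block_variance_cvg]).  In particular the series in that matrix converge and
   the matrix is positive semidefinite.

   Blocks.  The sum is cut into big blocks of length [e * x n] separated by gaps of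
   length [e ^ 2 * x n].  A covariance inequality for alpha-mixing ([cov_le]) makes
   the blocks independent up to an error that vanishes by the rate conditions
   ([rate_core]), a Taylor expansion makes each block of variance [v] contribute
   [1 - v / 2] to the characteristic function ([block_sum_char]), and what lies outside the blocks has
   small variance ([full_sum_char]).  Letting [n] tend to infinity and then [e] to zero
   yields the characteristic function of the normal limit ([scalar_clt]).

   Passage to laws.  Levy's continuity theorem ([levy_continuity]) is proved by
   approximating continuous functions on cubes by trigonometric polynomials with
   the same bound, built from Bernstein operators in the sines of the coordinates
   ([trig_poly_dense]).  The normal law with a given, possibly singular, covariance
   matrix is built by adding one-dimensional normal multiples of vectors
   ([gaussian_sum_rank1], [multinormal_exists]); its characteristic function comes
   from Stein's identity and a differential equation ([normal_cos_phase]). *)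


(** * Expectations of bounded random variables *)

Definition bounded_by (T : Type) (R : realType) (M : R) (f : T -> R) :=
  forall x, `|f x| <= M.

Section bounded_expectation.
Context d (T : measurableType d) (R : realType) (P : probability T R).
Implicit Types (f g : T -> R).

Definition bounded_mfun f :=
  measurable_fun [set: T] f /\ exists M : R, bounded_by M f.

Lemma bounded_mfun_integrable f : bounded_mfun f -> P.-integrable setT (EFin \o f).
Proof.
move=> [mf [M fM]]; apply: measurable_bounded_integrable => //.
- by rewrite -ge0_fin_numE// fin_num_measure.
- exists M; split; first exact: num_real.
  by move=> x Mx y _ /=; apply: le_trans (fM y) (ltW Mx).
Qed.

Lemma bounded_mfun_cst (c : R) : bounded_mfun (fun=> c).
Proof. by split; [exact: measurable_cst | exists `|c| => x]. Qed.

Lemma bounded_mfunD f g :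
  bounded_mfun f -> bounded_mfun g -> bounded_mfun (fun x => f x + g x).
Proof.
move=> [mf [M fM]] [mg [N gN]]; split; first exact: measurable_funD.
by exists (M + N) => x; rewrite (le_trans (ler_normD _ _))// lerD.
Qed.

Lemma bounded_mfunM f g :
  bounded_mfun f -> bounded_mfun g -> bounded_mfun (fun x => f x * g x).
Proof.
move=> [mf [M fM]] [mg [N gN]]; split; first exact: measurable_funM.
by exists (M * N) => x; rewrite normrM ler_pM.
Qed.

Lemma bounded_mfunZ (c : R) f : bounded_mfun f -> bounded_mfun (fun x => c * f x).
Proof. by move=> ?; apply: bounded_mfunM => //; exact: bounded_mfun_cst. Qed.

Lemma bounded_mfunN f : bounded_mfun f -> bounded_mfun (fun x => - f x).
Proof.
move=> [mf [M fM]]; split; first exact: measurableT_comp.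
by exists M => x; rewrite normrN.
Qed.

Lemma bounded_mfunB f g :
  bounded_mfun f -> bounded_mfun g -> bounded_mfun (fun x => f x - g x).
Proof. by move=> bf bg; apply: bounded_mfunD => //; exact: bounded_mfunN. Qed.

Lemma bounded_mfun_norm f : bounded_mfun f -> bounded_mfun (fun x => `|f x|).
Proof.
move=> [mf [M fM]]; split; first exact: measurableT_comp.
by exists M => x; rewrite normr_id.
Qed.

Lemma bounded_mfunX n f : bounded_mfun f -> bounded_mfun (fun x => f x ^+ n).
Proof.
move=> bf; elim: n => [|n ih]; first exact: bounded_mfun_cst.
rewrite (_ : (fun x => f x ^+ n.+1) = (fun x => f x * f x ^+ n)); first exact: bounded_mfunM.
by apply/funext => x; rewrite exprS.
Qed.

Lemma bounded_mfun_sum (I : Type) (r : seq I) (p : pred I) (F : I -> T -> R) :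
  (forall i, p i -> bounded_mfun (F i)) ->
  bounded_mfun (fun x => \sum_(i <- r | p i) F i x).
Proof.
move=> bF; elim: r => [|i r ih].
  suff -> : (fun x => \sum_(i <- [::] | p i) F i x) = fun=> 0 by exact: bounded_mfun_cst.
  by apply/funext => x; rewrite big_nil.
suff -> : (fun x => \sum_(j <- i :: r | p j) F j x) = fun x => (if p i then F i x else 0) + \sum_(i <- r | p i) F i x.
  apply: bounded_mfunD => //.
  by case pi : (p i); [exact: bF|exact: bounded_mfun_cst].
by apply/funext => x; rewrite big_cons; case: ifPn => //; rewrite add0r.
Qed.

Lemma bounded_mfun_indic (A : set T) : measurable A -> bounded_mfun (\1_A : T -> R).
Proof.
move=> mA; split; first exact: measurable_indic.
by exists 1 => x; rewrite indicE; case: (_ \in _); rewrite ?normr1 ?normr0.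
Qed.

Lemma bounded_mfun_cos f : measurable_fun setT f -> bounded_mfun (fun x => cos (f x)).
Proof.
move=> mf; split.
  apply: measurableT_comp mf.
  by apply: continuous_measurable_fun; exact: continuous_cos.
by exists 1 => x; rewrite ler_norml cos_geN1 cos_le1.
Qed.

Lemma bounded_mfun_sin f : measurable_fun setT f -> bounded_mfun (fun x => sin (f x)).
Proof.
move=> mf; split.
  apply: measurableT_comp mf.
  by apply: continuous_measurable_fun; exact: continuous_sin.
by exists 1 => x; rewrite ler_norml sin_geN1 sin_le1.
Qed.

Definition Ex f : R := \int[P]_w f w.

Lemma ExD f g : bounded_mfun f -> bounded_mfun g ->
  Ex (fun x => f x + g x) = Ex f + Ex g.
Proof. by move=> bf bg; rewrite /Ex RintegralD//; exact: bounded_mfun_integrable. Qed.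

Lemma ExB f g : bounded_mfun f -> bounded_mfun g ->
  Ex (fun x => f x - g x) = Ex f - Ex g.
Proof. by move=> bf bg; rewrite /Ex RintegralB//; exact: bounded_mfun_integrable. Qed.

Lemma ExZ c f : bounded_mfun f -> Ex (fun x => c * f x) = c * Ex f.
Proof. by move=> bf; rewrite /Ex RintegralZl//; exact: bounded_mfun_integrable. Qed.

Lemma Ex_cst c : Ex (fun=> c) = c.
Proof.
rewrite /Ex Rintegral_cst// -[RHS]mulr1; congr (_ * _).
by rewrite -[RHS]/(fine 1%E); congr fine; exact: probability_setT.
Qed.

Lemma Ex_ge0 f : (forall x, 0 <= f x) -> 0 <= Ex f.
Proof. by move=> f0; apply: Rintegral_ge0. Qed.

Lemma le_Ex f g : bounded_mfun f -> bounded_mfun g -> (forall x, f x <= g x) ->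
  Ex f <= Ex g.
Proof.
by move=> bf bg fg; apply: le_Rintegral => //; exact: bounded_mfun_integrable.
Qed.

Lemma Ex_sum (I : Type) (r : seq I) (p : pred I) (F : I -> T -> R) :
  (forall i, p i -> bounded_mfun (F i)) ->
  Ex (fun x => \sum_(i <- r | p i) F i x) = \sum_(i <- r | p i) Ex (F i).
Proof.
move=> bF; elim: r => [|i r ih].
  rewrite big_nil; suff -> : (fun x => \sum_(i <- [::] | p i) F i x) = fun=> 0 by rewrite Ex_cst.
  by apply/funext => x; rewrite big_nil.
rewrite big_cons; case: ifPn => pi.
  rewrite -ih -ExD; [|exact: bF | exact: bounded_mfun_sum].
  by congr Ex; apply/funext => x; rewrite big_cons pi.
by rewrite -ih; congr Ex; apply/funext => x; rewrite big_cons (negbTE pi).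
Qed.

Lemma le_norm_Ex f : bounded_mfun f -> `|Ex f| <= Ex (fun x => `|f x|).
Proof. by move=> bf; apply: le_normr_Rintegral => //; exact: bounded_mfun_integrable. Qed.

Lemma Ex_bound M f : bounded_mfun f -> bounded_by M f -> `|Ex f| <= M.
Proof.
move=> bf fM; apply: le_trans (le_norm_Ex bf) _.
rewrite -[leRHS]Ex_cst; apply: le_Ex => //; last exact: bounded_mfun_cst.
exact: bounded_mfun_norm.
Qed.

Lemma Ex_indic (A : set T) : measurable A -> Ex \1_A = Pr P A.
Proof. by move=> mA; rewrite /Ex /Rintegral integral_indic// setIT. Qed.

Lemma Pr_ge0 (A : set T) : 0 <= Pr P A.
Proof. by rewrite /Pr fine_ge0. Qed.

Lemma Pr_fin (A : set T) : measurable A -> P A = (Pr P A)%:E.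
Proof. by move=> mA; rewrite /Pr fineK// fin_num_measure. Qed.

Lemma le_Pr (A B : set T) : measurable A -> measurable B -> A `<=` B ->
  Pr P A <= Pr P B.
Proof.
by move=> mA mB AB; rewrite /Pr fine_le ?fin_num_measure// le_measure// inE.
Qed.

Lemma Pr_le1 (A : set T) : measurable A -> Pr P A <= 1.
Proof.
by move=> mA; rewrite -[leRHS](_ : Pr P setT = _) ?le_Pr// /Pr probability_setT.
Qed.

Lemma Ex_sqr_bound f : bounded_mfun f -> (Ex (fun x => `|f x|)) ^+ 2 <= Ex (fun x => f x ^+ 2).
Proof.
move=> bf; set a := Ex _; set b := Ex _.
have : 0 <= Ex (fun x => (`|f x| - a) ^+ 2) by apply: Ex_ge0 => x; exact: sqr_ge0.
have bn := bounded_mfun_norm bf.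
have -> : (fun x => (`|f x| - a) ^+ 2) = (fun x => f x ^+ 2 + ((- (2 * a)) * `|f x| + a ^+ 2)).
  by apply/funext => x; rewrite -(real_normK (num_real (f x))) sqrrB; ring.
rewrite ExD; [|exact: bounded_mfunX|apply: bounded_mfunD; [exact: bounded_mfunZ|exact: bounded_mfun_cst]].
rewrite ExD; [|exact: bounded_mfunZ|exact: bounded_mfun_cst].
rewrite ExZ// Ex_cst -/a -/b.
by move=> h; nra.
Qed.

End bounded_expectation.
Arguments bounded_mfun {d T R}.
Arguments bounded_mfun_cst {d T R}.

Lemma Ex_cvg d (T : measurableType d) (R : realType) (P : probability T R)
    (f_ : nat -> T -> R) (f : T -> R) (M : R) :
  (forall n, measurable_fun setT (f_ n)) -> (forall n, bounded_by M (f_ n)) ->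
  (forall x, f_ n x @[n --> \oo] --> f x) ->
  Ex P (f_ n) @[n --> \oo] --> Ex P f.
Proof.
move=> mf fM cf.
have mf' : measurable_fun setT f.
  by apply: (measurable_fun_cvg mf) => x _; exact: cf.
apply: fine_cvg.
have fb : bounded_by M f.
  move=> x; apply: (ler_cvg_to (cvg_norm (cf x)) (cvg_cst M)).
  by apply: nearW => n; exact: fM.
rewrite fineK; last first.
  by apply: integrable_fin_num => //; apply: bounded_mfun_integrable; split => //; exists M.
apply: (@dominated_cvg _ _ _ P _ measurableT _ _ (cst M%:E)).
- by move=> n; apply/measurable_EFinP.
- by move=> x _; apply: cvg_EFin; [exact: nearW | exact: cf].
- by [].
- exact: (bounded_mfun_integrable P (bounded_mfun_cst M)).
- by move=> n x _; rewrite /= lee_fin; exact: fM.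
Qed.

(** * The Borel sigma-algebra of R^n is generated by the coordinates *)

Section borel_rV.
Context (R : realType).

Definition rat_box n (c : 'rV[rat]_n) (k : nat) : set 'rV[R]_n :=
  [set x | forall i, `|x ord0 i - ratr (c ord0 i)| < k.+1%:R^-1].

(** Rational boxes are countably many and each is cut out by finitely many
   coordinates: this reduces Borel measurability to that of the coordinates. *)
Lemma open_rat_box n (U : set 'rV[R]_n) : open U ->
  U = \bigcup_(ck : 'rV[rat]_n * nat)
        [set x | rat_box ck.1 ck.2 x /\ rat_box ck.1 ck.2 `<=` U].
Proof.
move=> oU; apply/seteqP; split => [x Ux|x [ck _ [bx]]]; last exact.
have [e /= e0 eU] : exists2 e : R, 0 < e & ball x e `<=` U.
  by apply/nbhs_ballP; exact: open_nbhs_nbhs.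
have [k ke] : exists k, 2 * k.+1%:R^-1 < e.
  exists (Num.truncn (2 / e)); rewrite -ltr_pdivlMl// -ltf_pV2 ?posrE ?mulr_gt0 ?invr_gt0//.
  by rewrite invrK invfM invrK mulrC; exact: truncnS_gt.
have k0 : 0 < k.+1%:R^-1 :> R by rewrite invr_gt0.
have /choice[c cP] (i : 'I_n) : exists q : rat, `|x ord0 i - ratr q| < k.+1%:R^-1.
  have : x ord0 i - k.+1%:R^-1 < x ord0 i + k.+1%:R^-1 by rewrite ltrD2l gtrN.
  move=> /rat_in_itvoo[q]; rewrite in_itv/= => /andP[h1 h2]; exists q.
  by rewrite ltr_distlC h1 h2.
exists (\row_i c i, k) => //; split; first by move=> i; rewrite mxE.
move=> y yb; apply: eU; split => // a j; rewrite (ord1 a).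
have := yb j; have := cP j; rewrite mxE /ball /= => h1 h2.
rewrite (le_lt_trans (ler_distD (ratr (c j)) _ _))// (lt_le_trans _ (ltW ke))//.
by rewrite mulr_natl mulr2n ltrD// distrC.
Qed.

Lemma measurable_fun_rV d (T : measurableType d) n (h : T -> 'rV[R]_n) :
  (forall i, measurable_fun setT (fun w => h w ord0 i)) ->
  measurable_fun setT (h : T -> borelRn R n).
Proof.
move=> mh; apply: (@measurability _ _ T (borelRn R n) setT h (@open 'rV[R]_n)) => //.
move=> _ [U oU <-]; rewrite setTI (open_rat_box oU) preimage_bigcup.
apply: countable_bigcupT_measurable => // -[c k] /=.
have [bU|nbU] := pselect (rat_box c k `<=` U); last first.
  rewrite (_ : _ @^-1` _ = set0)//; apply/seteqP; split => // w [_ /=]; exact: nbU.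
rewrite (_ : _ @^-1` _ = \bigcap_(i : 'I_n) [set w | `|h w ord0 i - ratr (c ord0 i)| < k.+1%:R^-1]).
  apply: fin_bigcap_measurable => // i _.
  have mi : measurable_fun setT (fun w => `|h w ord0 i - ratr (c ord0 i)| < k.+1%:R^-1).
    apply: measurable_fun_ltr => //; apply: measurableT_comp => //.
    exact: measurable_funB.
  rewrite -[X in measurable X]setTI; exact: (mi measurableT [set true]).
by apply/seteqP; split => [w [wb _] i _|w wb]; [exact: wb|split => // i; exact: wb].
Qed.

Lemma continuous_borelRn n (g : 'rV[R]_n -> R) : continuous g ->
  measurable_fun setT (g : borelRn R n -> R).
Proof.
move=> cg; apply: (measurability _ (RGenOInfty.measurableE R)) => //.
move=> _ [_ [a ->] <-]; rewrite setTI; apply: sub_sigma_algebra.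
by apply: open_comp => [x _|]; [exact: cg|exact: interval_open].
Qed.

Lemma measurable_coord n (i : 'I_n) :
  measurable_fun setT (fun x : borelRn R n => (x : 'rV[R]_n) ord0 i).
Proof. by apply: continuous_borelRn; exact: coord_continuous. Qed.

Lemma borel_open n (A : set 'rV[R]_n) : open A -> measurable (A : set (borelRn R n)).
Proof. by move=> oA; exact: sub_sigma_algebra. Qed.

Lemma borel_closed n (A : set 'rV[R]_n) : closed A -> measurable (A : set (borelRn R n)).
Proof.
move=> cA; rewrite -[A]setCK; apply: measurableC; apply: borel_open.
exact: closed_openC.
Qed.

Lemma closed_boundary n (A : set 'rV[R]_n) : closed (boundary A).
Proof.
rewrite /boundary setDE; apply: closedI; first exact: closed_closure.
by apply: open_closedC; exact: open_interior.
Qed.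

Lemma measurable_rV_comp d (T : measurableType d) n (h : T -> 'rV[R]_n) (g : 'rV[R]_n -> R) :
  (forall i, measurable_fun setT (fun w => h w ord0 i)) -> continuous g ->
  measurable_fun setT (fun w => g (h w)).
Proof.
move=> mh cg; apply: (@measurableT_comp _ _ _ _ _ _ (g : borelRn R n -> R)).
  exact: continuous_borelRn.
exact: measurable_fun_rV.
Qed.

End borel_rV.

(** * Trigonometric polynomials are dense on cubes, with control of the supremum *)

Section trig_poly.
Context (R : realType) (n : nat).
Implicit Types (x c : 'rV[R]_n) (f g : 'rV[R]_n -> R).

Definition dot c x : R := (c *m x^T) ord0 ord0.

Lemma dotE c x : dot c x = \sum_i c ord0 i * x ord0 i.
Proof. by rewrite /dot mxE; apply: eq_bigr => i _; rewrite mxE. Qed.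

Lemma dotDl c c' x : dot (c + c') x = dot c x + dot c' x.
Proof. by rewrite /dot mulmxDl mxE. Qed.

Lemma dotDr c x y : dot c (x + y) = dot c x + dot c y.
Proof. by rewrite /dot linearD mulmxDr mxE. Qed.

Lemma dotNl c x : dot (- c) x = - dot c x.
Proof. by rewrite /dot mulNmx mxE. Qed.

Lemma dotZr (a : R) c x : dot c (a *: x) = a * dot c x.
Proof. by rewrite /dot linearZ -scalemxAr mxE. Qed.

Lemma dotZl (a : R) c x : dot (a *: c) x = a * dot c x.
Proof. by rewrite /dot -scalemxAl mxE. Qed.

Lemma dot_delta i x : dot (delta_mx 0 i) x = x ord0 i.
Proof.
rewrite dotE (bigD1 i)//= big1 ?addr0 ?mxE ?eqxx ?mul1r// => j ji.
by rewrite mxE (negbTE ji) mul0r.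
Qed.

(** The phase [b] makes room for sines, and the product-to-sum formula keeps the
   span closed under multiplication. *)
Inductive trig_poly : ('rV[R]_n -> R) -> Prop :=
| trig_poly0 : trig_poly (fun=> 0)
| trig_polyD a c b f : trig_poly f ->
    trig_poly (fun x => a * cos (dot c x + b) + f x).

Lemma trig_poly_add f g : trig_poly f -> trig_poly g -> trig_poly (fun x => f x + g x).
Proof.
elim=> [tg|a c b {}f _ ih tg]; first by under eq_fun do rewrite add0r.
under eq_fun do rewrite -addrA.
by apply: trig_polyD; exact: ih.
Qed.

Lemma trig_poly_cosM a c b f : trig_poly f ->
  trig_poly (fun x => a * cos (dot c x + b) * f x).
Proof.
elim=> [|a' c' b' {}f _ ih].
  by under eq_fun do rewrite mulr0; exact: trig_poly0.
rewrite (_ : (fun x => _) = fun x =>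
    (a * a' / 2) * cos (dot (c + c') x + (b + b')) +
   ((a * a' / 2) * cos (dot (c - c') x + (b - b')) + a * cos (dot c x + b) * f x)).
  by do 2 apply: trig_polyD.
apply/funext => x; rewrite !dotDl dotNl.
rewrite (_ : dot c x + dot c' x + (b + b') = (dot c x + b) + (dot c' x + b')); last by ring.
rewrite (_ : dot c x - dot c' x + (b - b') = (dot c x + b) - (dot c' x + b')); last by ring.
by move: (dot c x + b) (dot c' x + b') => u v; rewrite cosD cosB; field.
Qed.

Lemma trig_poly_mul f g : trig_poly f -> trig_poly g -> trig_poly (fun x => f x * g x).
Proof.
elim=> [tg|a c b {}f _ ih tg]; first by under eq_fun do rewrite mul0r; exact: trig_poly0.
under eq_fun do rewrite mulrDl.
by apply: trig_poly_add; [exact: trig_poly_cosM|exact: ih].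
Qed.

Lemma trig_poly_cst a : trig_poly (fun=> a).
Proof.
rewrite (_ : (fun=> a) = fun x : 'rV_n => a * cos (dot 0 x + 0) + 0).
  by apply: trig_polyD; exact: trig_poly0.
by apply/funext => x; rewrite /dot mul0mx mxE !addr0 cos0 mulr1.
Qed.

Lemma trig_poly_sin c : trig_poly (fun x => sin (dot c x)).
Proof.
rewrite (_ : (fun x => _) = fun x => 1 * cos (dot c x + (- (pi / 2))) + 0).
  by apply: trig_polyD; exact: trig_poly0.
by apply/funext => x; rewrite addr0 mul1r cosBpihalf.
Qed.

End trig_poly.

Section walk.
Context (R : realType) (n : nat).
Implicit Types (js : seq 'I_n) (s : 'I_n -> R) (G H : ('I_n -> nat) -> R).

(** The mean of [G] at the numbers of successes per coordinate, when a coin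
   of bias [s j] is tossed for each entry [j] of [js].  When each coordinate
   occurs [m] times this is the tensor product of Bernstein operators of
   degree [m]; the recursive form avoids binomial coefficients. *)
Fixpoint walk js s G : R :=
  if js is j :: js' then
    s j * walk js' s (fun k => G (fun i => (i == j) + k i)%N)
    + (1 - s j) * walk js' s G
  else G (fun=> 0%N).

Lemma walkD js s G H : walk js s (fun k => G k + H k) = walk js s G + walk js s H.
Proof. by elim: js G H => //= j js ih G H; rewrite !ih; ring. Qed.

Lemma walkZ js s a G : walk js s (fun k => a * G k) = a * walk js s G.
Proof. by elim: js G => //= j js ih G; rewrite !ih; ring. Qed.

Lemma walk_cst js s a : walk js s (fun=> a) = a.
Proof. by elim: js => //= j js ->; ring. Qed.

Lemma walk_sum js s (I : Type) (r : seq I) (F : I -> ('I_n -> nat) -> R) :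
  walk js s (fun k => \sum_(i <- r) F i k) = \sum_(i <- r) walk js s (F i).
Proof.
elim: r => [|i r ih].
  by rewrite big_nil; under [X in walk _ _ X]eq_fun do rewrite big_nil; exact: walk_cst.
by rewrite big_cons -ih -walkD; under [X in walk _ _ X]eq_fun do rewrite big_cons.
Qed.

Lemma le_walk js s G H : (forall i, 0 <= s i <= 1) -> (forall k, G k <= H k) ->
  walk js s G <= walk js s H.
Proof.
move=> s01; elim: js G H => //= j js ih G H GH; have /andP[? ?] := s01 j.
by rewrite lerD// ler_wpM2l ?subr_ge0// ih.
Qed.

Lemma le_norm_walk js s G : (forall i, 0 <= s i <= 1) ->
  `|walk js s G| <= walk js s (fun k => `|G k|).
Proof.
move=> s01; elim: js G => //= j js ih G; have /andP[s0 s1] := s01 j.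
have s1' : 0 <= 1 - s j by rewrite subr_ge0.
rewrite (le_trans (ler_normD _ _))// !normrM (ger0_norm s0) (ger0_norm s1').
by rewrite lerD// ler_wpM2l.
Qed.

(** The second moment of a binomial count about [c]; it controls the error of the
   Bernstein approximation. *)
Lemma walk_variance js s i (c : R) :
  walk js s (fun k => ((k i)%:R - c) ^+ 2) =
  ((count_mem i js)%:R * s i - c) ^+ 2 + (count_mem i js)%:R * (s i * (1 - s i)).
Proof.
elim: js c => [|j js ih] c /=; first by ring.
rewrite [in X in _ * X + _](_ : (fun k => _) =
  fun k : 'I_n -> nat => ((k i)%:R - (c - (i == j)%:R)) ^+ 2); last first.
  by apply/funext => k; rewrite natrD; congr (_ ^+ 2); ring.
rewrite !ih eq_sym; case: eqVneq => [->|_] /=; rewrite ?add1n ?add0n -?natr1 /=; ring.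
Qed.

Lemma walk_trig_poly js (s : 'rV[R]_n -> 'I_n -> R) G :
  (forall j, trig_poly (fun x => s x j)) -> trig_poly (fun x => walk js (s x) G).
Proof.
move=> ts; elim: js G => /= [G|j js ih G]; first exact: trig_poly_cst.
apply: trig_poly_add; apply: trig_poly_mul => //.
rewrite (_ : (fun x => _) = fun x => 1 + -1 * s x j).
  by apply: trig_poly_add; [exact: trig_poly_cst|apply: trig_poly_mul => //; exact: trig_poly_cst].
by apply/funext => x; rewrite mulN1r.
Qed.

End walk.

Lemma unif_continuous_cube (R : realType) n (g : 'rV[R]_n -> R) (K e : R) :
  continuous g -> 0 < e ->
  exists2 r : R, 0 < r & forall x y : 'rV[R]_n, (forall i, `|x ord0 i| <= K) ->
    (forall i, `|x ord0 i - y ord0 i| < r) -> `|g x - g y| <= e.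
Proof.
move=> cg e0.
have cK : compact [set x : 'rV[R]_n | forall i, [set` `[- K, K]] (x ord0 i)].
  by apply: (@rV_compact R n (fun=> [set` `[- K, K]])) => i; exact: segment_compact.
have e20 : 0 < e / 2 by rewrite divr_gt0.
have := proj1 (compact_near_coveringP _) cK R (0 : R)^'+
  (fun r x => forall y : 'rV[R]_n, (forall i, `|x ord0 i - y ord0 i| < r) -> `|g x - g y| <= e) _.
case.
  move=> x _.
  have /cvgrPdist_lt/(_ _ e20)/nbhs_ballP[/= r r0 gr] := cg x.
  exists (ball x (r / 2), [set r' | r' < r / 2]) => /=.
    split; first by apply: nbhsx_ballx; rewrite divr_gt0.
    by apply: nbhs_right_lt; rewrite divr_gt0.
  move=> [x' r'] /= [[_ xx'] r'r] y x'y.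
  have r20 : 0 < r by [].
  rewrite (le_trans (ler_distD (g x) _ _))// (splitr e) lerD ?ltW//.
    rewrite distrC; apply: gr; split => // a j; rewrite (ord1 a).
    by apply: lt_trans (xx' _ _) _; rewrite ltr_pdivrMr// mulr_natr mulr2n ltrDl.
  apply: gr; split => // a j; rewrite (ord1 a) /ball /=.
  have := xx' ord0 j; rewrite /ball /= => h; have h2 := x'y j.
  rewrite (le_lt_trans (ler_distD (x' ord0 j) _ _))//.
  by rewrite (splitr r) ltrD// (lt_trans h2).
move=> r /= r0 Pr.
exists (r / 2) => [|x y xK xy]; first by rewrite divr_gt0.
apply: (Pr (r / 2)) => //=.
- by rewrite sub0r normrN gtr0_norm ?divr_gt0// ltr_pdivrMr// mulr_natr mulr2n ltrDl.
- by rewrite divr_gt0.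
- by move=> i /=; rewrite in_itv /= -ler_norml.
Qed.

(** On [-1, 1] the sine has slope at least [cos 1], so it has a Lipschitz
   inverse, which here also absorbs the clipping of [r] to the range of the
   sine. *)
Lemma sin_approx_inverse (R : realType) (r : R) : exists2 b : R, `|b| <= 1 &
  forall a : R, `|a| <= 1 -> cos 1 * `|b - a| <= `|r - sin a|.
Proof.
have slope (a b : R) : -1 <= a -> a <= b -> b <= 1 -> cos 1 * (b - a) <= sin b - sin a.
  move=> a1 ab b1.
  have dsin x : x \in `]a, b[ -> is_derive x 1 sin (cos x) by move=> _; exact: is_derive_sin.
  have csin : {within `[a, b], continuous (@sin R)}.
    by apply: continuous_subspaceT; exact: continuous_sin.
  have [c] := MVT_segment ab dsin csin.
  rewrite in_itv/= => /andP[ac cb] ->.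
  rewrite ler_wpM2r ?subr_ge0// -(cos_norm c).
  have c1 : `|c| <= 1 by rewrite ler_norml (le_trans a1)// (le_trans cb).
  have pi1 : (1 : R) <= pi by rewrite (le_trans _ (pi_ge2 R))// ler1n.
  rewrite leNgt ltr_cos ?in_itv/= ?normr_ge0 ?ler01 ?pi1 ?(le_trans c1)//.
  by rewrite -leNgt.
have main (b a : R) : `|b| <= 1 -> `|a| <= 1 -> cos 1 * `|b - a| <= `|sin b - sin a|.
  rewrite !ler_norml => /andP[b1 b2] /andP[a1 a2].
  case: (leP a b) => ab.
    rewrite ger0_norm ?subr_ge0//; apply: le_trans (ler_norm _); exact: slope.
  rewrite distrC (distrC (sin b)) gtr0_norm ?subr_gt0//.
  by apply: le_trans (ler_norm _); apply: slope => //; exact: ltW.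
have c1 := cos1_gt0 R.
have mono (a : R) : `|a| <= 1 -> sin (-1) <= sin a <= sin 1.
  rewrite ler_norml => /andP[a1 a2]; apply/andP; split; rewrite -subr_ge0.
    by apply: le_trans (slope _ _ (lexx _) a1 a2); rewrite mulr_ge0 ?subr_ge0// ltW.
  by apply: le_trans (slope _ _ a1 a2 (lexx _)); rewrite mulr_ge0 ?subr_ge0// ltW.
have [r1|r1] := leP (sin 1) r.
  exists 1; first by rewrite normr1.
  move=> a a1; apply: le_trans (main _ _ _ a1) _; first by rewrite normr1.
  have /andP[_ h] := mono _ a1.
  by rewrite !ger0_norm ?subr_ge0 ?(le_trans h)// lerD2r.
have [r2|r2] := leP r (sin (-1)).
  exists (-1); first by rewrite normrN normr1.
  move=> a a1; apply: le_trans (main _ _ _ a1) _; first by rewrite normrN normr1.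
  have /andP[h _] := mono _ a1.
  by rewrite distrC (distrC r) !ger0_norm ?subr_ge0 ?(le_trans r2)// lerD2l lerN2.
have csin : {within `[-1, 1], continuous (@sin R)}.
  by apply: continuous_subspaceT; exact: continuous_sin.
have le11 : -1 <= 1 :> R by rewrite (le_trans (lerN10 _)).
have r12 : Num.min (sin (-1)) (sin 1) <= r <= Num.max (sin (-1)) (sin 1).
  by rewrite min_l ?max_r ?(ltW r1) ?(ltW r2)// ltW// (lt_trans r2).
have [b] := IVT le11 csin r12.
rewrite in_itv /= -ler_norml => b1 <-.
by exists b => // a a1; exact: main.
Qed.

(** [g] is replaced by the average of its values at grid points [y k], where the
   weights are those of the Bernstein operator in the variables
   s = (1 + sin (x / K)) / 2; they are trigonometric polynomials.  The weights are
   nonnegative with sum one on the whole space, so the bound [M] survives off the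
   cube, where nothing is approximated. *)
Lemma trig_poly_dense (R : realType) n (g : 'rV[R]_n -> R) (K M e : R) :
  continuous g -> bounded_by M g -> 0 < K -> 0 < e ->
  exists f : 'rV[R]_n -> R, [/\ trig_poly f, bounded_by M f &
    forall x : 'rV[R]_n, (forall i, `|x ord0 i| <= K) -> `|f x - g x| <= e].
Proof.
move=> cg gM K0 e0.
have M0 : 0 <= M by apply: le_trans (gM 0).
have [r r0 gr] := unif_continuous_cube K cg (divr_gt0 e0 (ltr0n _ 2)).
have c1 := cos1_gt0 R.
pose D := 2 * M * (2 * K / cos 1 / r) ^+ 2.
have D0 : 0 <= D by apply: mulr_ge0; [exact: mulr_ge0|exact: sqr_ge0].
pose m := (Num.truncn (2 * (n%:R * D) / e)).+1.
have m0 : 0 < m%:R :> R by rewrite ltr0n.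
have mD : n%:R * D / m%:R <= e / 2.
  have : 2 * (n%:R * D) / e < m%:R by exact: truncnS_gt.
  by rewrite ltr_pdivrMr// ler_pdivrMr// => h; lra.
have bex (k : nat) : exists b : R, `|b| <= 1 /\
    forall a, `|a| <= 1 -> cos 1 * `|b - a| <= `|2 * (k%:R / m%:R) - 1 - sin a|.
  by have [b b1 bP] := sin_approx_inverse (2 * (k%:R / m%:R) - 1 : R); exists b.
have [b bP] := choice bex.
pose y (k : 'I_n -> nat) : 'rV[R]_n := \row_i (K * b (k i)).
pose s (x : 'rV[R]_n) i : R := 2^-1 + 2^-1 * sin (dot (delta_mx 0 i) (K^-1 *: x)).
pose js : seq 'I_n := flatten (nseq m (enum 'I_n)).
have cnt i : count_mem i js = m.
  by rewrite count_flatten map_nseq sumn_nseq count_uniq_mem ?enum_uniq// mem_enum mul1n.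
have s01 x i : 0 <= s x i <= 1.
  by rewrite /s; have := sin_geN1 (dot (delta_mx 0 i) (K^-1 *: x)); have := sin_le1 (dot (delta_mx 0 i) (K^-1 *: x)); lra.
exists (fun x => walk js (s x) (fun k => g (y k))); split.
- apply: walk_trig_poly => j.
  apply: trig_poly_add; first exact: trig_poly_cst.
  apply: trig_poly_mul; first exact: trig_poly_cst.
  rewrite (_ : (fun x => _) = fun x => sin (dot (K^-1 *: delta_mx 0 j) x)); first exact: trig_poly_sin.
  by apply/funext => x; rewrite dotZr dotZl.
- move=> x; rewrite ler_norml -{1}(walk_cst js (s x) (- M)) -{2}(walk_cst js (s x) M).
  by apply/andP; split; apply: le_walk => // k; have := gM (y k); rewrite ler_norml => /andP[].
- move=> x xK.
  have key k : `|g (y k) - g x| <= e / 2 + \sum_i D * ((k i)%:R / m%:R - s x i) ^+ 2.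
    have S0 (i : 'I_n) : 0 <= D * ((k i)%:R / m%:R - s x i) ^+ 2 by rewrite mulr_ge0// sqr_ge0.
    have [near|] := boolP [forall i, `|x ord0 i - y k ord0 i| < r].
      rewrite distrC (le_trans (gr _ _ xK _))//; first by move=> i; exact: (forallP near).
      by rewrite lerDl sumr_ge0.
    rewrite negb_forall => /existsP[i]; rewrite -leNgt => ri.
    apply: (@le_trans _ _ (2 * M)).
      by rewrite (le_trans (ler_normB _ _))// mulr_natl mulr2n lerD.
    rewrite (bigD1 i)//=.
    suff : 2 * M <= D * ((k i)%:R / m%:R - s x i) ^+ 2.
      have : 0 <= \sum_(j < n | j != i) D * ((k j)%:R / m%:R - s x j) ^+ 2.
        by apply: sumr_ge0 => j _.
      have : 0 < e / 2 by rewrite divr_gt0.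
      lra.
    have [_ /(_ (x ord0 i / K))] := bP (k i).
    rewrite normrM normfV (gtr0_norm K0) ler_pdivrMr// mul1r => /(_ (xK i)).
    have -> : 2 * ((k i)%:R / m%:R) - 1 - sin (x ord0 i / K) = 2 * ((k i)%:R / m%:R - s x i).
      by rewrite /s dotZr dot_delta [K^-1 * _]mulrC; field; rewrite lt0r_neq0.
    rewrite normrM (ger0_norm (ler0n _ 2)) -[_ ^+ 2]real_normK ?num_real//.
    set S := `|_ - s x i|; set B := `|b (k i) - _| => h.
    have h2 : r <= K * B.
      rewrite (le_trans ri)// mxE /B -[X in X * `|_|](gtr0_norm K0) -normrM distrC.
      by rewrite mulrBr mulrCA divff ?mulr1// lt0r_neq0.
    have u1 : 1 <= 2 * K / cos 1 / r * S.
      rewrite mulrAC ler_pdivlMr// mul1r mulrAC ler_pdivlMr//.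
      have : K * (cos 1 * B) <= K * (2 * S) by rewrite ler_wpM2l// ltW.
      have : r * cos 1 <= K * B * cos 1 by rewrite ler_wpM2r// ltW.
      lra.
    by rewrite /D -mulrA -exprMn ler_peMr ?mulr_ge0// expr_ge1// (le_trans _ u1).
  rewrite -(walk_cst js (s x) (g x)) -mulN1r -walkZ -walkD.
  apply: le_trans (le_norm_walk _ _ (s01 x)) _.
  apply: (@le_trans _ _ (walk js (s x) (fun k => e / 2 + \sum_i D * ((k i)%:R / m%:R - s x i) ^+ 2))).
    by apply: le_walk => // k; rewrite mulN1r; exact: key.
  rewrite walkD walk_cst walk_sum [leRHS](splitr e) lerD2l (le_trans _ mD)//.
  apply: (@le_trans _ _ (\sum_(i < n) D / m%:R)); last first.
    by rewrite sumr_const card_ord -[leLHS]mulr_natl mulrA.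
  apply: ler_sum => i _; rewrite walkZ ler_wpM2l//.
  rewrite (_ : (fun k => _) = fun k : 'I_n -> nat => m%:R ^- 2 * ((k i)%:R - m%:R * s x i) ^+ 2); last first.
    by apply/funext => k; field; rewrite lt0r_neq0.
  rewrite walkZ walk_variance cnt subrr expr0n /= add0r.
  have -> : m%:R ^- 2 * (m%:R * (s x i * (1 - s x i))) = m%:R^-1 * (s x i * (1 - s x i)).
    by field; rewrite lt0r_neq0.
  have /andP[s0 s1] := s01 x i.
  rewrite -[leRHS]mulr1 ler_wpM2l ?invr_ge0 ?ltW//.
  nra.
Qed.

(** * Levy's continuity theorem for random vectors *)

Section exceedance.
Context (R : realType) d (T : measurableType d) (P : probability T R) (n : nat).
Implicit Types V : T -> 'rV[R]_n.

Definition measurable_coords V :=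
  forall i, measurable_fun setT (fun w => V w ord0 i).

Definition outside_cube V (K : R) : set T := [set w | exists i, K < `|V w ord0 i|].

Lemma measurable_outside_cube V K : measurable_coords V ->
  measurable (outside_cube V K).
Proof.
move=> mV; rewrite (_ : outside_cube V K = \bigcup_(i : 'I_n) [set w | K < `|V w ord0 i|]).
  apply: fin_bigcup_measurable => // i _.
  have mi : measurable_fun setT (fun w => K < `|V w ord0 i|).
    by apply: measurable_fun_ltr => //; apply: measurableT_comp => //; exact: mV.
  rewrite -[X in measurable X]setTI; exact: (mi measurableT [set true]).
by apply/seteqP; split => [w [i wi]|w [i _ wi]]; exists i.
Qed.

Lemma measurable_dot V c : measurable_coords V -> measurable_fun setT (fun w => dot c (V w)).
Proof.
move=> mV; under eq_fun do rewrite dotE.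
by apply: measurable_sum => i; apply: measurable_funM.
Qed.

Lemma bounded_mfun_comp V (g : 'rV[R]_n -> R) M : measurable_coords V ->
  continuous g -> bounded_by M g -> bounded_mfun (fun w => g (V w)).
Proof. by move=> mV cg gM; split; [exact: measurable_rV_comp|exists M => w]. Qed.

Lemma tight_single V (e : R) : measurable_coords V -> 0 < e ->
  exists2 K, 0 < K & Pr P (outside_cube V K) <= e.
Proof.
move=> mV e0.
have : Ex P (\1_(outside_cube V k.+1%:R) : T -> R) @[k --> \oo] --> Ex P (fun=> 0).
  apply: (@Ex_cvg _ _ _ _ _ _ 1).
  - by move=> k; apply: measurable_indic; exact: measurable_outside_cube.
  - by move=> k w; rewrite indicE; case: (_ \in _); rewrite ?normr1 ?normr0.
  - move=> w; apply: cvg_near_cst; near=> k.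
    rewrite indicE memNset// => -[i]; apply/negP; rewrite -leNgt.
    rewrite (@le_trans _ _ `|V w|)//.
      by rewrite -[leRHS]/(mx_norm _) mx_normrE; apply/bigmax_geP; right; exists (ord0, i).
    rewrite (@le_trans _ _ k%:R) ?ler_nat//.
    by near: k; exact: nbhs_infty_ger.
rewrite Ex_cst => /cvgrPdist_le/(_ _ e0)[k _ /(_ k (leqnn k))] /=.
rewrite Ex_indic ?sub0r ?normrN; last exact: measurable_outside_cube.
by rewrite ger0_norm ?Pr_ge0// => h; exists k.+1%:R.
Unshelve. all: end_near. Qed.

Lemma Ex_close_on_cube V (f g : 'rV[R]_n -> R) K M e :
  measurable_coords V -> bounded_mfun (fun w => f (V w)) ->
  bounded_mfun (fun w => g (V w)) ->
  bounded_by M f -> bounded_by M g -> 0 <= e ->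
  (forall x : 'rV[R]_n, (forall i, `|x ord0 i| <= K) -> `|f x - g x| <= e) ->
  `|Ex P (fun w => f (V w)) - Ex P (fun w => g (V w))| <=
    e + 2 * M * Pr P (outside_cube V K).
Proof.
move=> mV bf bg fM gM e0 fg.
have M0 : 0 <= M by apply: le_trans (fM 0).
have mO := measurable_outside_cube K mV.
rewrite -ExB// (le_trans (le_norm_Ex _ (bounded_mfunB bf bg)))//.
rewrite -Ex_indic// -ExZ; last exact: bounded_mfun_indic.
rewrite -[in leRHS](Ex_cst P e) -ExD; [|exact: bounded_mfun_cst|apply: bounded_mfunZ; exact: bounded_mfun_indic].
apply: le_Ex; first by apply: bounded_mfun_norm; exact: bounded_mfunB.
  by apply: bounded_mfunD; [exact: bounded_mfun_cst|apply: bounded_mfunZ; exact: bounded_mfun_indic].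
move=> w; rewrite indicE; case: (boolP (w \in outside_cube V K)) => [_|].
  rewrite mulr1 (le_trans (ler_normB _ _))//.
  by have := fM (V w); have := gM (V w); lra.
rewrite notin_setE => nO; rewrite mulr0 addr0; apply: fg => i.
by rewrite leNgt; apply/negP => Ki; apply: nO; exists i.
Qed.

Lemma bounded_mfun_trig V (f : 'rV[R]_n -> R) : measurable_coords V -> trig_poly f ->
  bounded_mfun (fun w => f (V w)).
Proof.
move=> mV; elim=> [|a c b {}f _ ih]; first exact: bounded_mfun_cst.
apply: bounded_mfunD => //; apply: bounded_mfunZ; apply: bounded_mfun_cos.
by apply: measurable_funD => //; exact: measurable_dot.
Qed.

End exceedance.

Section levy.
Context (R : realType) d (T : measurableType d) (P : probability T R).
Context d' (T' : measurableType d') (Q : probability T' R) (n : nat).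
Variables (V : nat -> T -> 'rV[R]_n) (Z : T' -> 'rV[R]_n).
Hypotheses (mV : forall k, measurable_coords (V k)) (mZ : measurable_coords Z).
Hypothesis cvg_cos_dot : forall c,
  Ex P (fun w => cos (dot c (V k w))) @[k --> \oo] --> Ex Q (fun w => cos (dot c (Z w))).
Hypothesis cvg_sin_dot : forall c,
  Ex P (fun w => sin (dot c (V k w))) @[k --> \oo] --> Ex Q (fun w => sin (dot c (Z w))).
Hypothesis tight : forall e : R, 0 < e -> exists2 K, 0 < K &
  \forall k \near \oo, Pr P (outside_cube (V k) K) <= e.

Lemma cvg_Ex_trig (f : 'rV[R]_n -> R) : trig_poly f ->
  Ex P (fun w => f (V k w)) @[k --> \oo] --> Ex Q (fun w => f (Z w)).
Proof.
have E d0 (S : measurableType d0) (p : probability S R) (U : S -> 'rV[R]_n) a c b f0 :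
    measurable_coords U -> trig_poly f0 ->
    Ex p (fun w => a * cos (dot c (U w) + b) + f0 (U w)) =
    (a * cos b) * Ex p (fun w => cos (dot c (U w))) +
    ((- (a * sin b)) * Ex p (fun w => sin (dot c (U w))) + Ex p (fun w => f0 (U w))).
  move=> mU tf; have mc := measurable_dot c mU.
  have bc := bounded_mfun_cos mc; have bs := bounded_mfun_sin mc.
  have b1 := bounded_mfunZ (a * cos b) bc.
  have b2 := bounded_mfunZ (- (a * sin b)) bs.
  have b3 := bounded_mfun_trig mU tf.
  rewrite -!ExZ// -(ExD _ b2 b3) -(ExD _ b1 (bounded_mfunD b2 b3)).
  by congr Ex; apply/funext => w; rewrite cosD; ring.
elim=> [|a c b {}f tf ih]; first by rewrite !Ex_cst; exact: cvg_cst.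
rewrite E//; under eq_fun do rewrite E//.
by apply: cvgD; [apply: cvgMr|apply: cvgD => //; apply: cvgMr].
Qed.

(** A bounded continuous function is a trigonometric polynomial up to a small
   error on a cube that carries almost all the mass, and the polynomial obeys
   the same bound off the cube. *)
Lemma levy_continuity (g : 'rV[R]_n -> R) M : continuous g -> bounded_by M g ->
  Ex P (fun w => g (V k w)) @[k --> \oo] --> Ex Q (fun w => g (Z w)).
Proof.
move=> cg gM; apply/cvgrPdist_le => e e0.
have M0 : 0 <= M by apply: le_trans (gM 0).
pose e1 := e / 5; pose e2 := e1 / (2 * M + 1).
have e10 : 0 < e1 by rewrite divr_gt0.
have M1 : 0 < 2 * M + 1 by lra.
have e20 : 0 < e2 by rewrite divr_gt0.
have Me2 (p : R) : 0 <= p -> p <= e2 -> 2 * M * p <= e1.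
  move=> p0; rewrite ler_pdivlMr// => h; apply: le_trans h.
  by rewrite mulrC ler_wpM2l// lerDl.
have [K1 K10 hK1] := tight e20.
have [K2 K20 hK2] := tight_single Q mZ e20.
pose K := K1 + K2.
have K0 : 0 < K by rewrite addr_gt0.
have [f [tf fM fg]] := trig_poly_dense cg gM K0 e10.
have cf := cvg_Ex_trig tf.
move/cvgrPdist_le : cf => /(_ _ e10) cf.
have sub d0 (S : measurableType d0) (p : probability S R) (U : S -> 'rV[R]_n) (K' : R) :
    measurable_coords U -> K' <= K -> Pr p (outside_cube U K') <= e2 ->
    `|Ex p (fun w => f (U w)) - Ex p (fun w => g (U w))| <= e1 + e1.
  move=> mU K'K pU.
  have := @Ex_close_on_cube _ _ _ p _ U f g K M e1 mU (bounded_mfun_trig mU tf)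
    (bounded_mfun_comp mU cg gM) fM gM (ltW e10) fg.
  move=> h; apply: (le_trans h); rewrite lerD2l; apply: Me2; first exact: Pr_ge0.
  apply: le_trans pU; apply: le_Pr; [exact: measurable_outside_cube..|].
  by move=> w [i Ki]; exists i; apply: le_lt_trans Ki.
near=> k.
have hk : `|Ex Q (fun w => f (Z w)) - Ex P (fun w => f (V k w))| <= e1 by near: k.
have h1 : `|Ex P (fun w => f (V k w)) - Ex P (fun w => g (V k w))| <= e1 + e1.
  by apply: (sub _ _ _ _ K1) => //; [rewrite lerDl ltW|near: k].
have h2 : `|Ex Q (fun w => f (Z w)) - Ex Q (fun w => g (Z w))| <= e1 + e1.
  by apply: (sub _ _ _ _ K2) => //; rewrite lerDr ltW.
have ee : e = e1 * 5 by rewrite /e1; field.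
move: hk h1 h2; rewrite !ler_norml => /andP[? ?] /andP[? ?] /andP[? ?].
by apply/andP; split; lra.
Unshelve. all: end_near. Qed.

End levy.

(** * The characteristic function of the normal law *)

(** The fundamental theorem of calculus on growing symmetric intervals, passed to
   the limit by dominated convergence. *)
Lemma Rintegral_derive_eq0 (R : realType) (F f : R -> R) :
  (forall x : R, is_derive x (1 : R) F (f x)) -> continuous f ->
  (@lebesgue_measure R).-integrable setT (EFin \o f) ->
  (F k.+1%:R - F (- k.+1%:R) @[k --> \oo] --> (0 : R)) ->
  \int[@lebesgue_measure R]_x f x = 0.
Proof.
move=> dF cf intf F0; set mu := @lebesgue_measure R.
pose D (k : nat) : set R := [set` `[- k.+1%:R, k.+1%:R]].
have cF x : {for x, continuous F}.
  by apply: differentiable_continuous; apply/derivable1_diffP; have [] := dF x.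
have E k : (\int[mu]_x ((f \_ (D k)) x)%:E = (F k.+1%:R - F (- k.+1%:R))%:E)%E.
  transitivity (\int[mu]_(x in D k) (f x)%:E)%E.
    rewrite [RHS]integral_mkcond; apply: eq_integral => x _.
    by rewrite restrict_EFin.
  rewrite (@continuous_FTC2 _ f F).
  - by rewrite EFinB.
  - by rewrite (@lt_trans _ _ 0)// ltrNl oppr0.
  - exact: continuous_subspaceT.
  - split.
    + by move=> x _; have [] := dF x.
    + by apply: cvg_at_right_filter; exact: cF.
    + by apply: cvg_at_left_filter; exact: cF.
  - by move=> x _; rewrite derive1E; have [] := dF x.
have mf : measurable_fun setT f by exact: continuous_measurable_fun.
have c1 : (\int[mu]_x ((f \_ (D k)) x)%:E)%E @[k --> \oo] --> (\int[mu]_x (f x)%:E)%E.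
  apply: (@dominated_cvg _ _ _ mu _ measurableT _ _ (fun x => `|f x|%:E)).
  - move=> k; apply/measurable_EFinP; apply/(measurable_restrictT _ _).1; last exact: measurable_funTS.
    exact: measurable_itv.
  - move=> x _; apply: cvg_near_cst; near=> k.
    rewrite patchE mem_set// /D /= in_itv /= -ler_norml.
    rewrite (@le_trans _ _ k%:R) ?ler_nat//.
    by near: k; exact: nbhs_infty_ger.
  - by [].
  - exact: (integrable_norm intf).
  - move=> k x _; rewrite lee_fin patchE; case: ifPn => //.
    by rewrite normr0.
have c2 : (\int[mu]_x ((f \_ (D k)) x)%:E)%E @[k --> \oo] --> (0 : R)%:E.
  under eq_fun do rewrite E.
  by apply: cvg_EFin; [exact: nearW|exact: F0].
by rewrite /Rintegral (cvg_unique _ c1 c2).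
Unshelve. all: end_near. Qed.

Lemma is_derive_osc (R : realType) (a b c x dp : R) (p : R -> R) :
  is_derive x (1 : R) p dp ->
  is_derive x (1 : R) (fun y => a * (sin (c * y + b) * p y))
    (a * (sin (c * x + b) * dp + c * cos (c * x + b) * p x)).
Proof.
move=> dp_.
have d1 : is_derive x (1 : R) (fun y : R => c * y + b) c.
  by apply: is_derive_eq; rewrite /GRing.scale /= mulr1 addr0.
have d2 : is_derive x (1 : R) (fun y : R => sin (c * y + b)) (c * cos (c * x + b)).
  have := @is_derive1_comp R sin (fun y : R => c * y + b) x _ _ (is_derive_sin (c * x + b)) d1.
  by rewrite mulrC.
apply: is_derive_eq (is_deriveZ a (is_deriveM d2 dp_)) _.
by rewrite /GRing.scale /= (mulrC (p x)).
Qed.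

Section normal_char.
Context (R : realType) (s : R).
Hypothesis s0 : 0 < s.
Local Notation mu := (@lebesgue_measure R).
Local Notation phi := (normal_pdf 0 s).

Let sn0 : s != 0. Proof. by rewrite lt0r_neq0. Qed.

Let phiE x : phi x = normal_peak s * expR (- x ^+ 2 / (s ^+ 2 *+ 2)).
Proof. by rewrite normal_pdfE// /normal_fun subr0. Qed.

Lemma Ex_normal_prob (f : R -> R) : bounded_mfun f ->
  Ex (normal_prob 0 s) f = \int[mu]_x (f x * phi x).
Proof.
move=> bf; have [mf [M fM]] := bf.
have dom := @normal_prob_dominates R 0 s.
have intf := bounded_mfun_integrable (normal_prob 0 s) bf.
rewrite /Ex /Rintegral; congr fine.
rewrite -(Radon_Nikodym_change_of_variables dom measurableT intf).
apply: ae_eq_integral => //.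
- apply: emeasurable_funM; first exact/measurable_EFinP.
  by apply: (measurable_int mu); apply: Radon_Nikodym_integrable.
- by apply/measurable_EFinP; apply: measurable_funM => //; exact: measurable_normal_pdf.
- under [X in ae_eq _ _ _ X]eq_fun do rewrite EFinM.
  apply: ae_eqe_mul2l => /=.
  rewrite Radon_NikodymE//=.
  case: cid => /= h [h1 h2 h3].
  apply: integral_ae_eq => //=.
  + by apply/measurable_EFinP; exact: measurable_normal_pdf.
  + by move=> E E01 mE; rewrite -h3.
Qed.

Let dphi (x : R) : is_derive x (1 : R) (phi : R -> R) (- (x / s ^+ 2) * phi x).
Proof.
rewrite (_ : phi = fun x => normal_peak s * expR (- x ^+ 2 / (s ^+ 2 *+ 2))); last first.
  by apply/funext => y; rewrite phiE.
apply: is_derive_eq.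
rewrite /GRing.scale /= !mulr1; field.
by [].
Qed.

(** A majorant of [|x| * phi x]: the normal density of twice the variance absorbs
   the linear factor. *)
Let G (x : R) := 2 * s * (normal_peak s / normal_peak (Num.sqrt 2 * s)) *
  normal_pdf 0 (Num.sqrt 2 * s) x.

Let sq2s : Num.sqrt 2 * s != 0 :> R.
Proof. by rewrite mulf_neq0// gt_eqF// sqrtr_gt0. Qed.

Let xphi_le x : `|x| * phi x <= G x.
Proof.
rewrite /G phiE normal_pdfE// /normal_fun subr0.
have p2 : normal_peak (Num.sqrt 2 * s) != 0 by rewrite gt_eqF// normal_peak_gt0.
set e1 := expR _; set e2 := expR _.
have -> : 2 * s * (normal_peak s / normal_peak (Num.sqrt 2 * s)) *
  (normal_peak (Num.sqrt 2 * s) * e2) = normal_peak s * (2 * s * e2) by field.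
rewrite mulrCA ler_wpM2l ?normal_peak_ge0//.
have -> : e1 = e2 * e2.
  rewrite /e1 /e2 -expRD; congr expR; rewrite exprMn sqr_sqrtr//; field.
  by [].
rewrite mulrA ler_wpM2r ?expR_ge0//.
have e2E : e2 = expR (- (x / (2 * s)) ^+ 2).
  by rewrite /e2; congr expR; rewrite exprMn sqr_sqrtr//; field.
rewrite e2E expRN ler_pdivrMr ?expR_gt0//.
have := expR_ge1Dx ((x / (2 * s)) ^+ 2); set y := x / (2 * s) => h.
have -> : `|x| = 2 * s * `|y|.
  rewrite /y normrM normfV [`|2 * s|]ger0_norm ?mulr_ge0 ?ltW// mulrCA divff ?mulr1//.
  by rewrite mulf_neq0.
rewrite ler_wpM2l ?mulr_ge0 ?(ltW s0)// (le_trans _ h)// -(real_normK (num_real y)).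
have : 0 <= (`|y| - 2^-1) ^+ 2 by exact: sqr_ge0.
by rewrite sqrrB; lra.
Qed.

Let intG : mu.-integrable setT (EFin \o G).
Proof.
rewrite /G; under [EFin \o _]eq_fun do rewrite /= EFinM.
by apply: integrableZl => //; exact: integrable_normal_pdf.
Qed.


Let mosc (h : R -> R) (b c : R) : continuous h ->
  measurable_fun setT (fun x : R => h (c * x + b) * phi x).
Proof.
move=> ch; apply: measurable_funM; last exact: measurable_normal_pdf.
apply: measurableT_comp; first exact: continuous_measurable_fun.
by apply: measurable_funD => //; apply: measurable_funM.
Qed.

Let int_osc (h : R -> R) (b c : R) : continuous h -> bounded_by 1 h ->
  mu.-integrable setT (EFin \o (fun x => h (c * x + b) * phi x)).
Proof.
move=> ch h1; apply: le_integrable (integrable_normal_pdf 0 s) => //.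
  by apply/measurable_EFinP; exact: mosc.
by move=> x _ /=; rewrite lee_fin normrM ler_piMl.
Qed.

Let int_xosc (h : R -> R) (b c : R) : continuous h -> bounded_by 1 h ->
  mu.-integrable setT (EFin \o (fun x => x * (h (c * x + b) * phi x))).
Proof.
move=> ch h1; apply: le_integrable intG => //.
  by apply/measurable_EFinP; apply: measurable_funM => //; exact: mosc.
move=> x _ /=; rewrite lee_fin normrM normrM mulrCA.
have p0 : 0 <= `|x| * phi x by rewrite mulr_ge0 ?normal_pdf_ge0.
rewrite [leRHS]ger0_norm ?(le_trans p0)// (le_trans _ (xphi_le x))//.
by rewrite (@ger0_norm _ (phi x)) ?normal_pdf_ge0// ler_piMl.
Qed.

Let csin : continuous (@sin R). Proof. exact: continuous_sin. Qed.
Let ccos : continuous (@cos R). Proof. exact: continuous_cos. Qed.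
Let bsin : bounded_by 1 (@sin R). Proof. by move=> x; exact: sin_max. Qed.
Let bcos : bounded_by 1 (@cos R). Proof. by move=> x; exact: cos_max. Qed.


Let phi_le (k : nat) : phi k.+1%:R <= 2 * s * normal_peak s * k.+1%:R^-1.
Proof.
rewrite ler_pdivlMr// mulrC; have := xphi_le k.+1%:R.
rewrite ger0_norm// => h; apply: le_trans h _; rewrite /G.
have p2 : 0 < normal_peak (Num.sqrt 2 * s) by exact: normal_peak_gt0.
have -> : 2 * s * normal_peak s = 2 * s * (normal_peak s / normal_peak (Num.sqrt 2 * s)) *
    normal_peak (Num.sqrt 2 * s) by field; exact: lt0r_neq0.
apply: ler_wpM2l; last exact: normal_pdf_ub.
by rewrite mulr_ge0 ?divr_ge0 ?normal_peak_ge0// mulr_ge0 ?(ltW s0).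
Qed.

Let phiN x : phi (- x) = phi x. Proof. by rewrite !phiE sqrrN. Qed.

(** Integration by parts, since [x * phi x] is [- s ^+ 2] times the derivative of
   [phi]. *)
Lemma normal_stein (b c : R) :
  \int[mu]_x (x * (sin (c * x + b) * phi x)) =
  s ^+ 2 * c * \int[mu]_x (cos (c * x + b) * phi x).
Proof.
pose F (x : R) := - s ^+ 2 * (sin (c * x + b) * phi x).
pose f1 (x : R) := x * (sin (c * x + b) * phi x).
pose f2 (x : R) := s ^+ 2 * c * (cos (c * x + b) * phi x).
have i1 : mu.-integrable setT (EFin \o f1) by exact: int_xosc.
have ic : mu.-integrable setT (EFin \o (fun x => cos (c * x + b) * phi x)) by exact: int_osc.
have i2 : mu.-integrable setT (EFin \o f2).
  rewrite /f2; under [EFin \o _]eq_fun do rewrite /= EFinM.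
  exact: integrableZl.
pose f (x : R) := f1 x - f2 x.
have dF (x : R) : is_derive x (1 : R) F (f x).
  apply: is_derive_eq (is_derive_osc (- s ^+ 2) b c (dphi x)) _.
  by rewrite /f /f1 /f2; field.
have clin : continuous (fun x : R => c * x + b).
  by move=> x; apply: cvgD; [apply: cvgMr; exact: cvg_id|exact: cvg_cst].
have cphi : continuous phi by exact: continuous_normal_pdf.
have cf : continuous f.
  move=> x; apply: cvgB; [apply: cvgM; first exact: cvg_id|apply: cvgMr];
    (apply: cvgM; last exact: cphi).
    by apply: continuous_comp; [exact: clin|exact: csin].
  by apply: continuous_comp; [exact: clin|exact: ccos].
have intf : mu.-integrable setT (EFin \o f).
  rewrite /f; under [EFin \o _]eq_fun do rewrite /= EFinB.
  exact: integrableB.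
have F0 : F k.+1%:R - F (- k.+1%:R) @[k --> \oo] --> (0 : R).
  have h : (2 * s ^+ 2 * (2 * s * normal_peak s)) * k.+1%:R^-1 @[k --> \oo] --> (0 : R).
    by rewrite -[X in _ --> X](mulr0 (2 * s ^+ 2 * (2 * s * normal_peak s))); apply: cvgMr; exact: cvg_harmonic.
  apply: norm_cvg0; apply: (squeeze_cvgr _ (cvg_cst 0) h).
  near=> k; rewrite normr_ge0 /= /F phiN.
  have hp := phi_le k; have p0 : 0 <= phi k.+1%:R by exact: normal_pdf_ge0.
  have s2 : 0 <= s ^+ 2 by exact: sqr_ge0.
  rewrite -mulrA -mulrBr -mulrBl !normrM normrN (ger0_norm s2) (ger0_norm p0).
  have hs : `|sin (c * k.+1%:R + b) - sin (c * - k.+1%:R + b)| <= 2.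
    rewrite (le_trans (ler_normB _ _))//.
    by have := sin_max (c * k.+1%:R + b); have := sin_max (c * - k.+1%:R + b); lra.
  apply: (@le_trans _ _ (s ^+ 2 * (2 * (2 * s * normal_peak s * k.+1%:R^-1)))).
    by rewrite ler_wpM2l// ler_pM.
  by rewrite le_eqVlt; apply/orP; left; apply/eqP; ring.
have := Rintegral_derive_eq0 dF cf intf F0.
rewrite /f RintegralB// => /eqP; rewrite subr_eq0 => /eqP ->.
by rewrite /f2 RintegralZl.
Unshelve. all: end_near. Qed.

Let psi (b c : R) := \int[mu]_x (cos (c * x + b) * phi x).

Let dosc (b c x : R) :
  is_derive c (1 : R) (fun c => cos (c * x + b) * phi x) (- (x * (sin (c * x + b) * phi x))).
Proof.
have d1 : is_derive c (1 : R) (fun y : R => y * x + b) x.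
  by apply: is_derive_eq; rewrite /GRing.scale /= mulr1 addr0 ?mulr0 ?add0r.
have d2 : is_derive c (1 : R) (fun y : R => cos (y * x + b)) (- (x * sin (c * x + b))).
  have := @is_derive1_comp R cos (fun y : R => y * x + b) c _ _ (is_derive_cos (c * x + b)) d1.
  by rewrite mulNr mulrC.
apply: is_derive_eq (is_deriveM d2 (is_derive_cst (phi x) c 1)) _.
by rewrite /GRing.scale /=; ring.
Qed.

Let dpsi (b c : R) : is_derive c (1 : R) (psi b) (- (s ^+ 2 * c) * psi b c).
Proof.
pose f (y x : R) := cos (y * x + b) * phi x.
have cc : [set` `]c - 1, c + 1[] c by rewrite /= in_itv /= gtrBl ltrDl ltr01.
have d1f (y x : R) : partial1of2 f y x = - (x * (sin (y * x + b) * phi x)).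
  by rewrite partial1of2E; have [] := dosc b y x.
have h1 x : [set` `]c - 1, c + 1[] x -> mu.-integrable setT (EFin \o f x).
  by move=> _; exact: int_osc.
have h2 (x y : R) : [set` `]c - 1, c + 1[] x -> [set: R] y -> derivable (f ^~ y) x 1.
  by move=> _ _; have [] := dosc b x y.
have G0 y : 0 <= G y by apply: le_trans (xphi_le y); rewrite mulr_ge0 ?normal_pdf_ge0.
have h3 (x y : R) : [set` `]c - 1, c + 1[] x -> [set: R] y -> `|partial1of2 f x y| <= G y.
  move=> _ _; rewrite d1f normrN !normrM mulrCA (ger0_norm (normal_pdf_ge0 0 s y)).
  by rewrite (le_trans _ (xphi_le y))// ler_piMl ?sin_max// mulr_ge0 ?normal_pdf_ge0.
have D := derivable_under_integral measurableT cc h1 h2 G0 intG h3.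
have E := differentiation_under_integral measurableT cc h1 h2 G0 intG h3.
apply: DeriveDef; first exact: D.
rewrite -derive1E; transitivity (\int[mu]_x (- (x * (sin (c * x + b) * phi x)))).
  by rewrite [LHS]E; apply: eq_Rintegral => x _; rewrite d1f.
under eq_Rintegral do rewrite -mulN1r.
by rewrite RintegralZl ?normal_stein//; [rewrite mulN1r mulNr|exact: int_xosc].
Qed.

(** Stein's identity makes the integral, as a function of the frequency [c], solve
   the linear differential equation of the Gaussian.  The phase [b] treats sine and
   cosine at once. *)
Lemma normal_cos_phase (b c : R) :
  Ex (normal_prob 0 s) (fun x => cos (c * x + b)) = cos b * expR (- (s ^+ 2 * c ^+ 2 / 2)).
Proof.
rewrite Ex_normal_prob; last by apply: bounded_mfun_cos; apply: measurable_funD => //; exact: measurable_funM.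
rewrite -[LHS]/(psi b c).
pose h (y : R) := psi b y * expR (s ^+ 2 * y ^+ 2 / 2).
have dh (y : R) : is_derive y (1 : R) h 0.
  have d1 : is_derive y (1 : R) (fun y : R => s ^+ 2 * y ^+ 2 / 2) (s ^+ 2 * y).
    apply: is_derive_eq; rewrite /GRing.scale /= ?mulr1; field.
    by [].
  have d2 : is_derive y (1 : R) (fun y : R => expR (s ^+ 2 * y ^+ 2 / 2))
      (s ^+ 2 * y * expR (s ^+ 2 * y ^+ 2 / 2)).
    have := @is_derive1_comp R expR (fun y : R => s ^+ 2 * y ^+ 2 / 2) y _ _ (is_derive_expR _) d1.
    by rewrite mulrC.
  apply: is_derive_eq (is_deriveM (dpsi b y) d2) _.
  by rewrite /GRing.scale /=; ring.
have := is_derive_0_is_cst c 0 dh.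
have psi0 : psi b 0 = cos b.
  rewrite /psi; under eq_Rintegral do rewrite mul0r add0r.
  rewrite RintegralZl//; last exact: integrable_normal_pdf.
  by rewrite /Rintegral integral_normal_pdf mulr1.
rewrite /h psi0 expr0n /= mulr0 mul0r expR0 mulr1 => <-.
by rewrite expRN mulfK// gt_eqF// expR_gt0.
Qed.

Lemma normal_cos (c : R) :
  Ex (normal_prob 0 s) (fun x => cos (c * x)) = expR (- (s ^+ 2 * c ^+ 2 / 2)).
Proof.
have := normal_cos_phase 0 c; rewrite cos0 mul1r => <-.
by congr Ex; apply/funext => x; rewrite addr0.
Qed.

Lemma normal_sin (c : R) : Ex (normal_prob 0 s) (fun x => sin (c * x)) = 0.
Proof.
transitivity (Ex (normal_prob 0 s) (fun x => cos (c * x + - (pi / 2)))).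
  by congr Ex; apply/funext => x; rewrite cosBpihalf.
by rewrite normal_cos_phase cosN cos_pihalf mul0r.
Qed.

End normal_char.

(** * Gaussian vectors with a given covariance *)

Section psd.
Context (R : realType) (n : nat).
Implicit Types (S : 'M[R]_n) (c b : 'rV[R]_n).

Definition bform S c b : R := (c *m S *m b^T) ord0 ord0.

Definition psd S := S^T = S /\ forall c, 0 <= bform S c c.

Lemma bformDl S c c' b : bform S (c + c') b = bform S c b + bform S c' b.
Proof. by rewrite /bform !mulmxDl mxE. Qed.

Lemma bformZl S a c b : bform S (a *: c) b = a * bform S c b.
Proof. by rewrite /bform -!scalemxAl mxE. Qed.

Lemma bformC S c b : S^T = S -> bform S c b = bform S b c.
Proof.
move=> sS; rewrite /bform -[in LHS](trmxK (c *m S *m b^T)) [in LHS]mxE.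
by rewrite !trmx_mul trmxK sS mulmxA.
Qed.

Lemma bform_delta S i j : bform S (delta_mx 0 i) (delta_mx 0 j) = S i j.
Proof. by rewrite /bform -rowE trmx_delta -colE !mxE. Qed.

Lemma bformS S S' c b : bform (S + S') c b = bform S c b + bform S' c b.
Proof. by rewrite /bform mulmxDr mulmxDl mxE. Qed.

Lemma bformN S c b : bform (- S) c b = - bform S c b.
Proof. by rewrite /bform mulmxN mulNmx mxE. Qed.

Lemma bform_rank1 v c : bform (v^T *m v) c c = dot c v ^+ 2.
Proof.
rewrite /bform mulmxA -mulmxA mxE big_ord1 -/(dot c v) expr2; congr (_ * _).
rewrite -/(dot v c) !dotE; by apply: eq_bigr => i _; rewrite mulrC.
Qed.

Lemma bform_quad S c b (a : R) : S^T = S ->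
  bform S (c + a *: b) (c + a *: b) = bform S c c + 2 * a * bform S c b + a ^+ 2 * bform S b b.
Proof.
move=> sS; rewrite bformDl bformZl ![bform S _ (c + _)]bformC// !bformDl !bformZl.
by rewrite (bformC b c sS); ring.
Qed.

(** Otherwise the form would be negative in the plane of the coordinates [i], [j]. *)
Lemma psd_diag0 S i j : psd S -> S i i = 0 -> S i j = 0.
Proof.
move=> [sS pS] Sii; apply/eqP/negP => /negP Sij.
pose a := - (S j j + 1) / (2 * S i j).
have := pS (delta_mx 0 j + a *: delta_mx 0 i).
rewrite bform_quad// !bform_delta Sii mulr0 addr0.
have -> : S j i = S i j by rewrite -[in LHS]sS mxE.
rewrite /a (_ : 2 * (- (S j j + 1) / (2 * S i j)) * S i j = - (S j j + 1)); last by field.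
lra.
Qed.

(** Eliminating one positive diagonal entry, as in Cholesky's algorithm, leaves a
   positive semidefinite matrix with fewer nonzero diagonal entries. *)
Lemma psd_sum_rank1 S : psd S ->
  exists bs : seq 'rV[R]_n, S = \sum_(b <- bs) b^T *m b.
Proof.
have [m] := ubnP #|[pred i | S i i != 0]|.
elim: m S => // m ih S; rewrite ltnS => cS pS.
have [allz|] := boolP [forall i, S i i == 0].
  exists [::]; rewrite big_nil; apply/matrixP => i j.
  by rewrite (psd_diag0 _ pS) ?mxE//; apply/eqP; exact: (forallP allz).
rewrite negb_forall => /existsP[i Sii0].
have [sS qS] := pS.
have Sii : 0 < S i i by rewrite lt_neqAle eq_sym Sii0 -bform_delta; exact: qS.
pose b : 'rV[R]_n := (Num.sqrt (S i i))^-1 *: row i S.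
have bE j k : (b^T *m b) j k = S i j * S i k / S i i.
  rewrite mxE big_ord1 !mxE -[in RHS](sqr_sqrtr (ltW Sii)); field.
  by rewrite gt_eqF// sqrtr_gt0.
pose S' := S - b^T *m b.
have S'E j k : S' j k = S j k - S i j * S i k / S i i by rewrite /S' -bE; move: (b^T *m b) => V; rewrite !mxE.
have sS' : S'^T = S' by rewrite /S' linearB/= sS trmx_mul trmxK.
have dotb c : dot c b ^+ 2 = bform S c (delta_mx 0 i) ^+ 2 / S i i.
  rewrite /b dotZr exprMn exprVn sqr_sqrtr ?ltW// mulrC; congr (_ ^+ 2 * _).
  rewrite dotE /bform trmx_delta -colE mxE mxE; apply: eq_bigr => k _.
  by rewrite mxE -[in LHS]sS mxE.
have pS' : psd S'.
  split=> // c; rewrite /S' bformS bformN bform_rank1 dotb.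
  have := qS (c + (- (bform S c (delta_mx 0 i) / S i i)) *: delta_mx 0 i).
  rewrite bform_quad// bform_delta; set B := bform S c (delta_mx 0 i).
  have -> // : bform S c c + 2 * - (B / S i i) * B + (- (B / S i i)) ^+ 2 * S i i = bform S c c - B ^+ 2 / S i i.
  by field.
have [|//|bs bsE] := ih S'.
  apply: leq_trans cS; apply: proper_card; apply/properP; split.
    apply/fintype.subsetP => j; rewrite !inE; apply: contraNN => /eqP Sjj.
    rewrite S'E Sjj; have Sji : S j i = 0 by exact: psd_diag0.
    by have -> : S i j = 0; [rewrite -sS mxE|rewrite !mul0r subrr].
  by exists i; rewrite !inE // negbK S'E -mulrA divff ?mulr1 ?subrr.
by exists (b :: bs); rewrite big_cons -bsE /S' addrC subrK.
Qed.

End psd.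

Section gaussian.
Context (R : realType) (n : nat).

Lemma Ex_pushforward d d' (T : measurableType d) (T' : measurableType d')
    (P : probability T R) (h : {mfun T >-> T'}) (f : T' -> R) :
  bounded_mfun f -> Ex (distribution P h) f = Ex P (fun x => f (h x)).
Proof.
move=> [mf [M fM]]; rewrite /Ex /Rintegral; congr fine.
rewrite integral_distribution//; first exact/measurable_EFinP.
apply: (bounded_mfun_integrable P (f := fun x => f (h x))).
by split; [exact: measurableT_comp|exists M => x].
Qed.

Lemma Ex_product d d' (T : measurableType d) (T' : measurableType d')
    (P : probability T R) (Q : probability T' R) (f : T * T' -> R) :
  bounded_mfun f -> Ex (P \x Q)%E f = Ex P (fun x => Ex Q (fun y => f (x, y))).
Proof.
move=> bf; have [mf [M fM]] := bf; rewrite /Ex /Rintegral.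
have i := bounded_mfun_integrable (P \x Q)%E bf.
rewrite -integral12_prod_meas1//; congr fine; apply: eq_integral => x _.
rewrite /fubini_F /= fineK//; apply: integrable_fin_num => //.
apply: (bounded_mfun_integrable Q (f := fun y => f (x, y))); split.
  by apply: measurableT_comp => //; exact: measurable_pair1.
by exists M => y.
Qed.

(** Adding to a vector an independent standard normal multiple of [b] multiplies its
   characteristic function by a Gaussian factor in [dot c b]. *)
Lemma gaussian_sum_rank1 (bs : seq 'rV[R]_n) :
  exists nu : probability (borelRn R n) R, forall c,
    Ex nu (fun x => cos (dot c x)) = expR (- (\sum_(b <- bs) dot c b ^+ 2) / 2) /\
    Ex nu (fun x => sin (dot c x)) = 0.
Proof.
have mid : measurable_coords (fun x : borelRn R n => x : 'rV[R]_n).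
  by move=> i; exact: measurable_coord.
elim: bs => [|b bs [nu nuE]].
  exists (\d_(0 : borelRn R n)) => c.
  have dE (f : borelRn R n -> R) : measurable_fun setT f -> Ex (\d_(0 : borelRn R n)) f = f 0.
    move=> mf; rewrite /Ex /Rintegral integral_dirac//; last exact/measurable_EFinP.
    by rewrite diracT mul1e.
  rewrite !dE; [|by have [] := bounded_mfun_sin (measurable_dot c mid)
                |by have [] := bounded_mfun_cos (measurable_dot c mid)].
  rewrite big_nil oppr0 mul0r expR0.
  by rewrite /dot trmx0 mulmx0 mxE cos0 sin0.
pose N := normal_prob (0 : R) 1.
pose h (xz : borelRn R n * measurableTypeR R) : borelRn R n :=
  (xz.1 : 'rV[R]_n) + (xz.2 : R) *: b.
have mh : measurable_fun setT h.
  apply: measurable_fun_rV => i.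
  under eq_fun do rewrite mxE.
  apply: measurable_funD.
    by apply: (measurableT_comp (mid i)).
  under eq_fun do rewrite mxE.
  by apply: measurable_funM.
pose H : {mfun (borelRn R n * measurableTypeR R)%type >-> borelRn R n} :=
  HB.pack h (isMeasurableFun.Build _ _ _ _ h mh).
exists (distribution (nu \x N)%E H) => c.
have mc := measurable_dot c mid.
have bc := bounded_mfun_cos mc; have bs' := bounded_mfun_sin mc.
have mhc : measurable_fun setT (fun xz => dot c (h xz)) by exact: measurableT_comp mc mh.
have phase (a : R) : Ex (distribution (nu \x N)%E H) (fun x => cos (dot c x + a)) =
    expR (- dot c b ^+ 2 / 2) * Ex nu (fun x => cos (dot c x + a)).
  have mca : measurable_fun setT (fun x : borelRn R n => dot c x + a) by exact: measurable_funD.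
  rewrite Ex_pushforward; last exact: bounded_mfun_cos.
  rewrite Ex_product; last by apply: bounded_mfun_cos; apply: measurable_funD.
  rewrite -ExZ; last exact: bounded_mfun_cos.
  congr Ex; apply/funext => x; rewrite /h /=.
  rewrite -[RHS]mulrC (_ : - _ / 2 = - (1 ^+ 2 * dot c b ^+ 2 / 2)); last by rewrite expr1n mul1r mulNr.
  rewrite -normal_cos_phase//; congr Ex; apply/funext => z.
  by congr cos; rewrite dotDr dotZr addrAC addrC mulrC.
have [nc ns] := nuE c; split.
  transitivity (Ex (distribution (nu \x N)%E H) (fun x => cos (dot c x + 0))).
    by congr Ex; apply/funext => x; rewrite addr0.
  rewrite phase big_cons opprD mulrDl expRD -nc; congr (_ * Ex _ _).
  by apply/funext => x; rewrite addr0.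
transitivity (Ex (distribution (nu \x N)%E H) (fun x => cos (dot c x + - (pi / 2)))).
  by congr Ex; apply/funext => x; rewrite cosBpihalf.
rewrite phase -[RHS](mulr0 (expR (- dot c b ^+ 2 / 2))) -[in RHS]ns; congr (_ * Ex _ _).
by apply/funext => x; rewrite cosBpihalf.
Qed.

End gaussian.

(** * From characteristic functions to laws *)

Section same_law.
Context (R : realType) d (T : measurableType d) (P : probability T R).
Context d' (T' : measurableType d') (Q : probability T' R).

(** Continuous approximations, by their slope [k], of the indicator of the ray to the
   right of [x]. *)
Definition ramp (x : R) (k : nat) (y : R) : R := Num.min 1 (Num.max 0 (k%:R * (y - x))).

Lemma continuous_ramp x k : continuous (ramp x k).
Proof.
move=> y; apply: (@continuous_min R R (fun=> 1) (fun y => Num.max 0 (k%:R * (y - x)))).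
  exact: cvg_cst.
apply: (@continuous_max R R (fun=> 0) (fun y => k%:R * (y - x))); first exact: cvg_cst.
by apply: cvgMr; apply: cvgB; [exact: cvg_id|exact: cvg_cst].
Qed.

Lemma ramp_bounded x k : bounded_by 1 (ramp x k).
Proof.
move=> y; rewrite /ramp ger0_norm; first by rewrite ge_min lexx.
by rewrite le_min ler01 le_max lexx.
Qed.

Lemma ramp_cvg x y : ramp x k y @[k --> \oo] --> (((x < y)%R)%:R : R).
Proof.
apply: cvg_near_cst; have [xy|yx] := ltP x y; last first.
  apply: nearW => k; rewrite /ramp max_l ?min_r ?ler01//.
  by rewrite mulr_ge0_le0// subr_le0.
near=> k; rewrite /ramp min_l// le_max; apply/orP; right.
rewrite -ler_pdivrMr ?subr_gt0// mul1r.
by near: k; exact: nbhs_infty_ger.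
Unshelve. all: end_near. Qed.

(** Levy's theorem for a constant sequence equates the expectations of continuous
   functions; ramps turn this into equality on rays, which generate the Borel sets
   and are stable under intersection. *)
Lemma same_char_same_law (f : T -> R) (g : T' -> R) :
  measurable_fun setT f -> measurable_fun setT g ->
  (forall c, Ex P (fun w => cos (c * f w)) = Ex Q (fun w => cos (c * g w))) ->
  (forall c, Ex P (fun w => sin (c * f w)) = Ex Q (fun w => sin (c * g w))) ->
  forall B, measurable B -> P (f @^-1` B) = Q (g @^-1` B).
Proof.
move=> mf mg Hc Hs.
pose V (k : nat) w : 'rV[R]_1 := \row_i f w.
pose Z w : 'rV[R]_1 := \row_i g w.
have dV (c : 'rV[R]_1) k w : dot c (V k w) = c ord0 ord0 * f w.
  by rewrite dotE big_ord1 mxE.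
have dZ (c : 'rV[R]_1) w : dot c (Z w) = c ord0 ord0 * g w.
  by rewrite dotE big_ord1 mxE.
have mV k : measurable_coords (V k) by move=> i; under eq_fun do rewrite mxE.
have mZ : measurable_coords Z by move=> i; under eq_fun do rewrite mxE.
have cont (h : R -> R) : continuous h -> bounded_by 1 h ->
    Ex P (fun w => h (f w)) = Ex Q (fun w => h (g w)).
  move=> ch bh.
  have tight (e : R) : 0 < e -> exists2 K, 0 < K &
      \forall k \near \oo, Pr P (outside_cube (V k) K) <= e.
    move=> e0; have [K K0 KP] := tight_single P (mV 0%N) e0.
    by exists K => //; apply: nearW.
  have Lc c : Ex P (fun w => cos (dot c (V k w))) @[k --> \oo] --> Ex Q (fun w => cos (dot c (Z w))).
    under eq_fun do under [X in Ex _ X]eq_fun do rewrite dV.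
    by under [X in Ex Q X]eq_fun do rewrite dZ; rewrite Hc; exact: cvg_cst.
  have Ls c : Ex P (fun w => sin (dot c (V k w))) @[k --> \oo] --> Ex Q (fun w => sin (dot c (Z w))).
    under eq_fun do under [X in Ex _ X]eq_fun do rewrite dV.
    by under [X in Ex Q X]eq_fun do rewrite dZ; rewrite Hs; exact: cvg_cst.
  have chc : continuous (fun x : 'rV[R]_1 => h (x ord0 ord0)).
    by move=> x; apply: continuous_comp; [exact: coord_continuous|exact: ch].
  have bhc : bounded_by 1 (fun x : 'rV[R]_1 => h (x ord0 ord0)) by move=> x.
  have L := levy_continuity mV mZ Lc Ls tight chc bhc.
  have <- : Ex Q (fun w => h (Z w ord0 ord0)) = Ex Q (fun w => h (g w)).
    by congr Ex; apply/funext => w; rewrite mxE.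
  have L2 : Ex P (fun w => h (V k w ord0 ord0)) @[k --> \oo] --> Ex P (fun w => h (f w)).
    suff -> : (fun k => Ex P (fun w => h (V k w ord0 ord0))) = fun=> Ex P (fun w => h (f w)).
      exact: cvg_cst.
    by apply/funext => k; congr Ex; apply/funext => w; rewrite mxE.
  exact: (cvg_unique _ L2 L).
have mray d0 (S : measurableType d0) (e : S -> R) x : measurable_fun setT e ->
    measurable (e @^-1` `]x, +oo[).
  by move=> me; rewrite -[X in measurable X]setTI; apply: me => //; exact: measurable_itv.
have lim d0 (S : measurableType d0) (p : probability S R) (e : S -> R) x :
    measurable_fun setT e ->
    Ex p (fun w => ramp x k (e w)) @[k --> \oo] --> Pr p (e @^-1` `]x, +oo[).
  move=> me; rewrite -Ex_indic; last exact: mray.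
  apply: (@Ex_cvg _ _ _ _ _ _ 1).
  - move=> k; apply: measurableT_comp me.
    by apply: continuous_measurable_fun; exact: continuous_ramp.
  - by move=> k w; exact: ramp_bounded.
  - move=> w; rewrite indicE (_ : (w \in _) = (x < e w)%R); first exact: ramp_cvg.
    by apply/idP/idP; rewrite inE /= in_itv /= andbT.
have ray x : P (f @^-1` `]x, +oo[) = Q (g @^-1` `]x, +oo[).
  rewrite !Pr_fin; [|exact: mray..]; congr EFin.
  have L := lim _ _ P f x mf.
  have E : (fun k => Ex P (fun w => ramp x k (f w))) = fun k => Ex Q (fun w => ramp x k (g w)).
    by apply/funext => k; apply: cont; [exact: continuous_ramp|exact: ramp_bounded].
  rewrite E in L; exact: (cvg_unique _ L (lim _ _ Q g x mg)).
move=> B mB.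
pose F : {mfun T >-> R} := HB.pack f (isMeasurableFun.Build _ _ _ _ f mf).
pose G : {mfun T' >-> R} := HB.pack g (isMeasurableFun.Build _ _ _ _ g mg).
rewrite -[LHS]/(distribution P F B) -[RHS]/(distribution Q G B).
apply: (measure_unique (@RGenOInfty.G R) (fun k : nat => `]- k%:R, +oo[%classic)) => //.
- exact: RGenOInfty.measurableE.
- move=> _ _ [x ->] [y ->]; exists (Num.max x y).
  by apply/seteqP; split => z /=; rewrite !in_itv /= !andbT gt_max => /andP.
- by move=> k; exists (- k%:R).
- apply/seteqP; split => // z _; exists (Num.truncn `|z|).+1 => //=.
  rewrite in_itv /= andbT ltrNl.
  by rewrite (le_lt_trans _ (truncnS_gt _))// -normrN ler_norm.
- by move=> _ [x ->]; exact: ray.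
- by move=> k; rewrite -ge0_fin_numE// fin_num_measure.
Qed.
End same_law.

Lemma normal_law_char (R : realType) (v : R) : 0 <= v -> exists N : probability (measurableTypeR R) R,
  (forall B, measurable B -> N B = normal_law 0 v B) /\
  forall c, Ex N (fun x => cos (c * x)) = expR (- (v * c ^+ 2) / 2) /\
            Ex N (fun x => sin (c * x)) = 0.
Proof.
rewrite le_eqVlt => /predU1P[<-|v0].
  exists (\d_(0 : measurableTypeR R)); split; first by move=> B _; rewrite /normal_law eqxx.
  have dE (f : R -> R) : measurable_fun setT f -> Ex (\d_(0 : measurableTypeR R)) f = f 0.
    move=> mf; rewrite /Ex /Rintegral integral_dirac//; last exact/measurable_EFinP.
    by rewrite diracT mul1e.
  have mcx (c : R) : measurable_fun setT (fun x : R => c * x) by exact: measurable_funM.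
  move=> c; rewrite !dE ?mulr0 ?mul0r ?oppr0 ?mul0r ?expR0 ?cos0 ?sin0//.
    by have [] := bounded_mfun_sin (mcx c).
  by have [] := bounded_mfun_cos (mcx c).
have s0 : 0 < Num.sqrt v by rewrite sqrtr_gt0.
exists (normal_prob 0 (Num.sqrt v)); split.
  by move=> B _; rewrite /normal_law gt_eqF.
move=> c; rewrite normal_cos// normal_sin// sqr_sqrtr ?ltW//; split => //.
by rewrite mulNr.
Qed.

(** Only the characteristic function is built by hand.  That every linear combination
   is normal then follows from uniqueness in dimension one. *)
Lemma multinormal_exists (R : realType) n (S : 'M[R]_n) : psd S ->
  exists nu : probability (borelRn R n) R, multinormal nu 0 S /\
  forall c, Ex nu (fun x => cos (dot c x)) = expR (- bform S c c / 2) /\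
            Ex nu (fun x => sin (dot c x)) = 0.
Proof.
move=> pS; have [bs bsE] := psd_sum_rank1 pS.
have [nu nuE] := gaussian_sum_rank1 bs.
have qE c : bform S c c = \sum_(b <- bs) dot c b ^+ 2.
  rewrite bsE /bform mulmx_sumr mulmx_suml summxE.
  by apply: eq_bigr => b _; exact: bform_rank1.
have nuE' c : Ex nu (fun x => cos (dot c x)) = expR (- bform S c c / 2) /\
            Ex nu (fun x => sin (dot c x)) = 0 by rewrite qE; exact: nuE.
exists nu; split=> //; split; first by have [] := pS.
move=> c /=; rewrite -/(bform S c c); have [_ q0] := pS; split; first exact: q0.
rewrite trmx0 mulmx0 mxE => B mB.
have [N [NB Nchar]] := normal_law_char (q0 c).
have mid : measurable_coords (fun x : borelRn R n => x : 'rV[R]_n).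
  by move=> i; exact: measurable_coord.
have dotZl' (a : R) x : a * dot c x = dot (a *: c) x by rewrite dotZl.
have bZ (a : R) : bform S (a *: c) (a *: c) = bform S c c * a ^+ 2.
  by rewrite bformZl bformC ?bformZl ?(proj1 pS)//; ring.
rewrite -NB//.
have := @same_char_same_law R _ _ nu _ _ N (dot c) id (measurable_dot c mid) (@measurable_id _ _ setT) _ _ B mB.
apply=> a; have [Nc Ns] := Nchar a; have [nc ns] := nuE' (a *: c).
  by rewrite Nc -bZ -nc; congr Ex; apply/funext => x; rewrite dotZl'.
by rewrite Ns -[RHS]ns; congr Ex; apply/funext => x; rewrite dotZl'.
Qed.

(** * Covariance inequality under alpha-mixing *)

Section level_sets.
Context (R : realType).

(** The integer part of [y], written as a sum of indicators of level sets. *)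
Definition nlevels (m : nat) (y : R) : R := \sum_(i < m) ((i.+1)%:R <= y)%R%:R.

Lemma nlevels_approx m (y : R) : 0 <= y <= m%:R -> y - 1 <= nlevels m y <= y.
Proof.
elim: m y => [|m ih] y /andP[y0 ym].
  by rewrite /nlevels big_ord0 y0 andbT subr_le0 (le_trans ym)// ler01.
rewrite /nlevels big_ord_recr /=; case: (leP y m%:R) => [ym'|my].
  have -> : (m.+1%:R <= y)%R = false.
    by apply/negbTE; rewrite -ltNge (le_lt_trans ym')// ltr_nat.
  by rewrite addr0; apply: ih; rewrite y0.
rewrite (eq_bigr (fun=> 1)); last first.
  by move=> i _; rewrite (le_trans _ (ltW my))// ler_nat.
rewrite sumr_const card_ord.
move: ym; case: (leP m.+1%:R y) => h ym; move: h ym my; rewrite /= -natr1 => h ym my;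
  by apply/andP; split; lra.
Qed.

Lemma nlevels_unit m (y : R) : 0 <= y <= 1 ->
  `|y - m.+1%:R^-1 * nlevels m.+1 (m.+1%:R * y)| <= m.+1%:R^-1 /\
  0 <= m.+1%:R^-1 * nlevels m.+1 (m.+1%:R * y) <= 1.
Proof.
move=> /andP[y0 y1]; have m0 : 0 < m.+1%:R :> R by [].
have : m.+1%:R * y - 1 <= nlevels m.+1 (m.+1%:R * y) <= m.+1%:R * y.
  by apply: nlevels_approx; rewrite mulr_ge0//= ler_piMr.
have : 0 <= nlevels m.+1 (m.+1%:R * y) by apply: sumr_ge0.
set N := nlevels _ _; set k := m.+1%:R in m0 *.
move=> N0 /andP[h1 h2].
have kN : k^-1 * N <= y by rewrite ler_pdivrMl.
have kN2 : y <= k^-1 * N + k^-1.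
  by rewrite -[X in _ + X]mulr1 -mulrDr ler_pdivlMl//; lra.
have k0 : 0 <= k^-1 by rewrite invr_ge0 ltW.
have kN0 : 0 <= k^-1 * N by rewrite mulr_ge0.
split; last by rewrite kN0 (le_trans kN).
move: kN kN2 k0 kN0; move: (k^-1 * N) (k^-1) => u v ? ? ? ?.
by rewrite ler_norml; apply/andP; split; lra.
Qed.

End level_sets.

Section covariance_bound.
Context (R : realType) d (T : measurableType d) (P : probability T R).
Implicit Types f g : T -> R.

Definition cov f g : R := Ex P (fun w => f w * g w) - Ex P f * Ex P g.

Definition above f (a : R) : set T := [set w | a <= f w].

Lemma measurable_above f a : measurable_fun setT f -> measurable (above f a).
Proof.
move=> mf; have mi : measurable_fun setT (fun w => a <= f w) by exact: measurable_fun_ler.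
rewrite -[X in measurable X]setTI; exact: (mi measurableT [set true]).
Qed.

(** A function with values between 0 and 1 is a uniform limit of averages of indicators
   of its level sets, and the covariance is bilinear. *)
Lemma cov_unit_le f g (al : R) : measurable_fun setT f -> measurable_fun setT g ->
  (forall w, 0 <= f w <= 1) -> (forall w, 0 <= g w <= 1) ->
  (forall a b, `|Pr P (above f a `&` above g b) - Pr P (above f a) * Pr P (above g b)| <= al) ->
  `|cov f g| <= al.
Proof.
move=> mf mg f01 g01 H.
have unit_bounded (h : T -> R) : measurable_fun setT h -> (forall w, 0 <= h w <= 1) -> bounded_mfun h.
  by move=> mh h01; split => //; exists 1 => w; have /andP[? ?] := h01 w; rewrite ger0_norm.
have bf := unit_bounded _ mf f01; have bg := unit_bounded _ mg g01.
pose q m (h : T -> R) w : R := m.+1%:R^-1 * nlevels m.+1 (m.+1%:R * h w).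
have ind (h : T -> R) w (m : nat) (i : nat) : ((i.+1%:R <= m.+1%:R * h w)%R%:R : R) =
    \1_(above h (i.+1%:R / m.+1%:R)) w.
  rewrite indicE; congr (nat_of_bool _)%:R; apply/idP/idP;
    by rewrite inE /above /= ler_pdivrMr// mulrC.
have bind (h : T -> R) a : measurable_fun setT h -> bounded_mfun (\1_(above h a) : T -> R).
  by move=> mh; apply: bounded_mfun_indic; exact: measurable_above.
have qE m (h : T -> R) : q m h = fun w => m.+1%:R^-1 * \sum_(i < m.+1) \1_(above h (i.+1%:R / m.+1%:R)) w.
  by apply/funext => w; rewrite /q /nlevels; congr (_ * _); apply: eq_bigr => i _; exact: ind.
have bq m (h : T -> R) : measurable_fun setT h -> bounded_mfun (q m h).
  by move=> mh; rewrite qE; apply: bounded_mfunZ; apply: bounded_mfun_sum => i _; exact: bind.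
have covq m : `|cov (q m f) (q m g)| <= al.
  set k := m.+1%:R^-1 : R.
  have k0 : 0 <= k by rewrite invr_ge0.
  have -> : cov (q m f) (q m g) = \sum_(i < m.+1) \sum_(j < m.+1)
     k * k * (Pr P (above f (i.+1%:R / m.+1%:R) `&` above g (j.+1%:R / m.+1%:R))
       - Pr P (above f (i.+1%:R / m.+1%:R)) * Pr P (above g (j.+1%:R / m.+1%:R))).
    rewrite /cov !qE -/k.
    rewrite !ExZ; [|by apply: bounded_mfun_sum => i _; exact: bind..].
    rewrite !Ex_sum; [|by move=> i _; exact: bind..].
    have -> : (fun w => k * (\sum_(i < m.+1) \1_(above f (i.+1%:R / m.+1%:R)) w) *
        (k * \sum_(j < m.+1) \1_(above g (j.+1%:R / m.+1%:R)) w)) =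
       fun w => \sum_(i < m.+1) \sum_(j < m.+1) k * k *
         \1_(above f (i.+1%:R / m.+1%:R) `&` above g (j.+1%:R / m.+1%:R)) w.
      apply/funext => w; rewrite mulrACA mulr_suml mulr_sumr; apply: eq_bigr => i _.
      by rewrite mulr_sumr mulr_sumr; apply: eq_bigr => j _; rewrite indicI.
    have mI i j : measurable (above f (i.+1%:R / m.+1%:R) `&` above g (j.+1%:R / m.+1%:R)).
      by apply: measurableI; exact: measurable_above.
    rewrite Ex_sum; last first.
      move=> i _; apply: bounded_mfun_sum => j _; apply: bounded_mfunZ.
      exact: bounded_mfun_indic.
    rewrite mulrACA mulr_suml mulr_sumr -sumrB; apply: eq_bigr => i _.
    rewrite Ex_sum; last by move=> j _; apply: bounded_mfunZ; exact: bounded_mfun_indic.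
    rewrite mulr_sumr mulr_sumr -sumrB; apply: eq_bigr => j _.
    rewrite ExZ; last exact: bounded_mfun_indic.
    by rewrite !Ex_indic ?mulrBr//; exact: measurable_above.
  apply: (@le_trans _ _ (\sum_(i < m.+1) \sum_(j < m.+1) k * k * al)).
    apply: le_trans (ler_norm_sum _ _ _) _; apply: ler_sum => i _.
    apply: le_trans (ler_norm_sum _ _ _) _; apply: ler_sum => j _.
    by rewrite normrM ger0_norm ?mulr_ge0// ler_wpM2l ?mulr_ge0.
  rewrite !sumr_const card_ord -mulrnA -[leLHS]mulr_natl natrM.
  by rewrite le_eqVlt; apply/orP; left; apply/eqP; rewrite /k; field.
have close m : `|cov f g| <= al + 4 * m.+1%:R^-1.
  set k := m.+1%:R^-1 : R.
  have hf w := nlevels_unit m (f01 w); have hg w := nlevels_unit m (g01 w).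
  have diff (h : T -> R) w : (0 <= h w <= 1) -> `|h w - q m h w| <= k.
    by move=> h01; have [] := nlevels_unit m h01.
  have q01 (h : T -> R) w : (0 <= h w <= 1) -> `|q m h w| <= 1.
    by move=> h01; have [_ /andP[? ?]] := nlevels_unit m h01; rewrite ger0_norm.
  have n1 (h : T -> R) w : (0 <= h w <= 1) -> `|h w| <= 1 by move=> /andP[? ?]; rewrite ger0_norm.
  have prod (a b a' b' : R) : `|a| <= 1 -> `|b'| <= 1 -> `|a - a'| <= k -> `|b - b'| <= k ->
      `|a * b - a' * b'| <= k + k.
    move=> a1 b1 aa bb.
    rewrite (_ : _ - _ = a * (b - b') + (a - a') * b'); last by ring.
    rewrite (le_trans (ler_normD _ _))// lerD// normrM.
      by rewrite -[leRHS]mul1r ler_pM.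
    by rewrite -[leRHS]mulr1 ler_pM.
  have bqf := bq m f mf; have bqg := bq m g mg.
  have e1 : `|Ex P (fun w => f w * g w) - Ex P (fun w => q m f w * q m g w)| <= k + k.
    rewrite -ExB; [|exact: bounded_mfunM..].
    apply: Ex_bound; first by apply: bounded_mfunB; exact: bounded_mfunM.
    by move=> w; apply: prod; [exact: n1|exact: q01|exact: diff|exact: diff].
  have e2 : `|Ex P f * Ex P g - Ex P (q m f) * Ex P (q m g)| <= k + k.
    apply: prod.
    - by apply: Ex_bound => // w; exact: n1.
    - by apply: Ex_bound => // w; exact: q01.
    - by rewrite -ExB//; apply: Ex_bound; [exact: bounded_mfunB|move=> w; exact: diff].
    - by rewrite -ExB//; apply: Ex_bound; [exact: bounded_mfunB|move=> w; exact: diff].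
  have := covq m; rewrite /cov; move: e1 e2; rewrite !ler_norml.
  by move=> /andP[? ?] /andP[? ?] /andP[? ?]; apply/andP; split; lra.
have c : al + 4 * k.+1%:R^-1 @[k --> \oo] --> al.
  rewrite -[X in _ --> X]addr0 -[X in _ + X](mulr0 4).
  by apply: cvgD; [exact: cvg_cst|apply: cvgMr; exact: cvg_harmonic].
by apply: (cvgr_to_ge c); exact: nearW.
Qed.

Lemma cov_le f g (al : R) : measurable_fun setT f -> measurable_fun setT g ->
  bounded_by 1 f -> bounded_by 1 g ->
  (forall a b, `|Pr P (above f a `&` above g b) - Pr P (above f a) * Pr P (above g b)| <= al) ->
  `|cov f g| <= 4 * al.
Proof.
move=> mf mg f1 g1 H.
pose r (h : T -> R) (w : T) : R := 2^-1 * h w + 2^-1.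
have mr (h : T -> R) : measurable_fun setT h -> measurable_fun setT (r h).
  by move=> mh; apply: measurable_funD => //; exact: measurable_funM.
have r01 (h : T -> R) w : `|h w| <= 1 -> 0 <= r h w <= 1.
  by rewrite ler_norml /r => /andP[? ?]; apply/andP; split; lra.
have ab (h : T -> R) a : above (r h) a = above h (2 * a - 1).
  by apply/seteqP; split => w; rewrite /above /r /= => ?; lra.
have := @cov_unit_le (r f) (r g) al (mr _ mf) (mr _ mg) (fun w => r01 _ _ (f1 w))
  (fun w => r01 _ _ (g1 w)).
have -> : cov (r f) (r g) = 4^-1 * cov f g.
  have bf : bounded_mfun f by split => //; exists 1.
  have bg : bounded_mfun g by split => //; exists 1.
  have bc := @bounded_mfun_cst _ T R 2^-1.
  have b2f := bounded_mfunZ 2^-1 bf; have b2g := bounded_mfunZ 2^-1 bg.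
  have b4 := bounded_mfunZ 4^-1 bf; have b4g := bounded_mfunZ 4^-1 bg.
  have b4fg := bounded_mfunZ 4^-1 (bounded_mfunM bf bg).
  rewrite /cov /r !(ExD _ b2f bc) !(ExD _ b2g bc) !ExZ// !Ex_cst.
  have -> : (fun w => (2^-1 * f w + 2^-1) * (2^-1 * g w + 2^-1)) =
    (fun w => 4^-1 * (f w * g w) + (4^-1 * f w + (4^-1 * g w + 4^-1))).
    by apply/funext => w; field.
  have bc4 := @bounded_mfun_cst _ T R 4^-1.
  rewrite (ExD _ b4fg (bounded_mfunD b4 (bounded_mfunD b4g bc4))).
  rewrite (ExD _ b4 (bounded_mfunD b4g bc4)) (ExD _ b4g bc4) !ExZ// ?Ex_cst; last exact: bounded_mfunM.
  by field.
rewrite normrM ger0_norm// => h; rewrite -ler_pdivrMl//; apply: h => a b.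
by rewrite !ab; exact: H.
Qed.

End covariance_bound.

Section mixing.
Context {d : measure_display} {T : measurableType d} {R : realType}.
Variables (P : probability T R) (X : int -> {RV P >-> R}).

Lemma measurable_window s n : measurable_coords (window X s n).
Proof.
move=> i; under eq_fun do rewrite mxE.
exact: (measurable_funP (X (s + i%:Z))).
Qed.

Lemma measurable_margin n (s : 'I_n -> int) : measurable_coords (margin X s).
Proof.
move=> i; under eq_fun do rewrite mxE.
exact: (measurable_funP (X (s i))).
Qed.

Lemma measurable_rV_preimage n (V : T -> 'rV[R]_n) (A : set 'rV[R]_n) :
  measurable_coords V -> borel_set A -> measurable (V @^-1` A).
Proof.
move=> mV bA; have := measurable_fun_rV mV; rewrite /measurable_fun.
by move=> /(_ measurableT A bA); rewrite setTI.
Qed.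

(** Mixing is defined by events of infinite sequences and stationarity by finite
   windows; selecting coordinates is the bridge. *)
Lemma borel_reindex n m (f : 'I_n -> 'I_m) (A : set 'rV[R]_n) : borel_set A ->
  borel_set [set x : 'rV[R]_m | A (\row_i x ord0 (f i))].
Proof.
move=> bA.
have mf : measurable_fun setT
    ((fun x : borelRn R m => \row_i (x : 'rV[R]_m) ord0 (f i)) : borelRn R m -> borelRn R n).
  by apply: measurable_fun_rV => i; under eq_fun do rewrite mxE; exact: measurable_coord.
by have := mf measurableT A bA; rewrite setTI.
Qed.

Lemma borel_RN_reindex n (f : 'I_n -> nat) (A : set 'rV[R]_n) : borel_set A ->
  @borel_RN R [set x | A (\row_i x (f i))].
Proof.
move=> bA; pose G := \bigcup_i preimage_set_system setT (fun x : nat -> R => x i) (@measurable _ R).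
have mf : measurable_fun setT
    ((fun x : nat -> R => \row_i x (f i)) : g_sigma_algebraType G -> borelRn R n).
  apply: measurable_fun_rV => i.
  apply: (eq_measurable_fun ((fun x : nat -> R => x (f i)) : g_sigma_algebraType G -> R)).
    by move=> x _; rewrite mxE.
  move=> _ B mB; apply: sub_sigma_algebra; exists (f i) => //.
  by exists B => //; rewrite setTI.
by have := mf measurableT A bA; rewrite setTI.
Qed.

Lemma measurable_sequence (s : nat -> int) (A : set (nat -> R)) : borel_RN A ->
  measurable [set w | A (fun k => X (s k) w)].
Proof.
move=> bA; pose G := \bigcup_i preimage_set_system setT (fun x : nat -> R => x i) (@measurable _ R).
have ms : measurable_fun setT ((fun w k => X (s k) w) : T -> g_sigma_algebraType G).
  apply: (@measurability _ _ T (g_sigma_algebraType G) setT _ G) => //.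
  move=> _ [_ [i _ [B mB <-]] <-]; rewrite !setTI.
  have := measurable_funP (X (s i)) measurableT B mB; by rewrite setTI.
by have := ms measurableT A bA; rewrite setTI.
Qed.

Lemma le_mixing (h : nat) (A B : set (nat -> R)) : borel_RN A -> borel_RN B ->
  forall E F : set T, E = [set w | A (fun k => X (- k%:Z) w)] ->
  F = [set w | B (fun k => X (h%:Z + k%:Z) w)] ->
  `|Pr P (E `&` F) - Pr P E * Pr P F| <= mixing X h.
Proof.
move=> bA bB E F -> ->; apply: ub_le_sup; last by exists A, B.
exists 1 => _ [A' [B' [bA' bB' ->]]].
set E' := [set w | A' _]; set F' := [set w | B' _].
have mE : measurable E' by exact: measurable_sequence.
have mF : measurable F' by exact: measurable_sequence.
have := Pr_ge0 P (E' `&` F'); have := Pr_le1 P (measurableI _ _ mE mF).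
have := Pr_ge0 P E'; have := Pr_le1 P mE; have := Pr_ge0 P F'; have := Pr_le1 P mF.
move: (Pr P _) (Pr P _) (Pr P _) => x y z *.
by rewrite ler_norml; apply/andP; split; nra.
Qed.

Hypothesis stat : strictly_stationary X.

(** By stationarity the cut between past and future may be placed anywhere. *)
Lemma mixing_windows (s : int) (M M' h : nat) (A : set 'rV[R]_M.+1) (B : set 'rV[R]_M') :
  borel_set A -> borel_set B ->
  `|Pr P (window X s M.+1 @^-1` A `&` window X (s + M%:Z + h%:Z) M' @^-1` B)
    - Pr P (window X s M.+1 @^-1` A) * Pr P (window X (s + M%:Z + h%:Z) M' @^-1` B)|
  <= mixing X h.
Proof.
move=> bA bB.
pose idx (i : 'I_(M.+1 + M')) : int :=
  match fintype.split i with inl j => s + j%:Z | inr k => s + M%:Z + h%:Z + k%:Z end.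
pose c : int := - (s + M%:Z).
have bl (C : set 'rV[R]_M.+1) : borel_set C -> borel_set [set x : 'rV[R]_(M.+1 + M') | C (\row_j x ord0 (lshift M' j))].
  exact: borel_reindex.
have br (C : set 'rV[R]_M') : borel_set C -> borel_set [set x : 'rV[R]_(M.+1 + M') | C (\row_j x ord0 (rshift M.+1 j))].
  exact: borel_reindex.
have shiftP (C : set 'rV[R]_M.+1) (D : set 'rV[R]_M') : borel_set C -> borel_set D ->
    P (window X s M.+1 @^-1` C `&` window X (s + M%:Z + h%:Z) M' @^-1` D) =
    P ([set w | C (\row_(j < M.+1) X (- (M - j)%N%:Z) w)] `&` [set w | D (\row_(j < M') X (h%:Z + j%:Z) w)]).
  move=> bC bD.
  pose CD := [set x : 'rV[R]_(M.+1 + M') | C (\row_j x ord0 (lshift M' j))] `&`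
             [set x : 'rV[R]_(M.+1 + M') | D (\row_j x ord0 (rshift M.+1 j))].
  have bCD : borel_set CD.
    exact: (@measurableI _ (borelRn R (M.+1 + M')) _ _ (bl C bC) (br D bD)).
  have := stat idx c bCD.
  have -> : margin X idx @^-1` CD =
      window X s M.+1 @^-1` C `&` window X (s + M%:Z + h%:Z) M' @^-1` D.
    apply/seteqP; split => w; rewrite /CD /=.
      have -> : (\row_j margin X idx w ord0 (lshift M' j)) = window X s M.+1 w.
        by apply/rowP => j; rewrite !mxE /idx (unsplitK (inl j)).
      have -> // : (\row_j margin X idx w ord0 (rshift M.+1 j)) = window X (s + M%:Z + h%:Z) M' w.
      by apply/rowP => j; rewrite !mxE /idx (unsplitK (inr j)).
    have -> : (\row_j margin X idx w ord0 (lshift M' j)) = window X s M.+1 w.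
      by apply/rowP => j; rewrite !mxE /idx (unsplitK (inl j)).
    have -> // : (\row_j margin X idx w ord0 (rshift M.+1 j)) = window X (s + M%:Z + h%:Z) M' w.
    by apply/rowP => j; rewrite !mxE /idx (unsplitK (inr j)).
  move=> <-; congr (P _); apply/seteqP; split => w; rewrite /CD /=.
    have -> : (\row_j margin X (fun i => idx i + c) w ord0 (lshift M' j)) =
        \row_(j < M.+1) X (- (M - j)%N%:Z) w.
      apply/rowP => j; rewrite !mxE /idx (unsplitK (inl j)) /c; congr (X _ w).
      by rewrite -subzn ?leq_ord//; ring.
    have -> // : (\row_j margin X (fun i => idx i + c) w ord0 (rshift M.+1 j)) =
        \row_(j < M') X (h%:Z + j%:Z) w.
    apply/rowP => j; rewrite !mxE /idx (unsplitK (inr j)) /c; congr (X _ w).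
    by ring.
  have -> : (\row_j margin X (fun i => idx i + c) w ord0 (lshift M' j)) =
      \row_(j < M.+1) X (- (M - j)%N%:Z) w.
    apply/rowP => j; rewrite !mxE /idx (unsplitK (inl j)) /c; congr (X _ w).
    by rewrite -subzn ?leq_ord//; ring.
  have -> // : (\row_j margin X (fun i => idx i + c) w ord0 (rshift M.+1 j)) =
      \row_(j < M') X (h%:Z + j%:Z) w.
  apply/rowP => j; rewrite !mxE /idx (unsplitK (inr j)) /c; congr (X _ w).
  by ring.
have bT n : borel_set [set: 'rV[R]_n] by exact: (@measurableT _ (borelRn R n)).
have := @le_mixing h _ _ (borel_RN_reindex (fun j : 'I_M.+1 => (M - j)%N) bA) (borel_RN_reindex (fun j : 'I_M' => j : nat) bB) _ _ erefl erefl.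
rewrite /= /Pr (shiftP _ _ bA bB).
have eT n (V : T -> 'rV[R]_n) : [set w | [set: 'rV[R]_n] (V w)] = setT by [].
by have := shiftP _ _ bA (bT M'); rewrite preimage_setT eT !setIT => ->;
  have := shiftP _ _ (bT M.+1) bB; rewrite preimage_setT eT !setTI => ->.
Qed.

(** The level sets of a Borel function of a window are events of that window, so the
   bound for events carries over to functions. *)
Lemma cov_windows (s : int) (M M' h : nat) (phi : 'rV[R]_M.+1 -> R) (psi : 'rV[R]_M' -> R) :
  measurable_fun setT (phi : borelRn R M.+1 -> R) ->
  measurable_fun setT (psi : borelRn R M' -> R) ->
  bounded_by 1 phi -> bounded_by 1 psi ->
  `|cov P (fun w => phi (window X s M.+1 w))
          (fun w => psi (window X (s + M%:Z + h%:Z) M' w))| <= 4 * mixing X h.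
Proof.
move=> mphi mpsi bphi bpsi; apply: cov_le.
- apply: (@measurableT_comp _ _ _ _ _ _ (phi : borelRn R M.+1 -> R)) => //.
  by apply: measurable_fun_rV; exact: measurable_window.
- apply: (@measurableT_comp _ _ _ _ _ _ (psi : borelRn R M' -> R)) => //.
  by apply: measurable_fun_rV; exact: measurable_window.
- by move=> w; exact: bphi.
- by move=> w; exact: bpsi.
- move=> a b.
  have bA : borel_set [set x | a <= phi x] by exact: (measurable_above a mphi).
  have bB : borel_set [set x | b <= psi x] by exact: (measurable_above b mpsi).
  exact: (mixing_windows s h bA bB).
Qed.

End mixing.

(** * Blocks: a recursion for characteristic functions *)

Section elementary.
Context (R : realType).
Implicit Types x y : R.

Lemma norm_le_derive (f df : R -> R) (M x : R) :
  (forall y : R, is_derive y (1 : R) f (df y)) -> f 0 = 0 ->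
  (forall y, `|y| <= `|x| -> `|df y| <= M) -> `|f x| <= M * `|x|.
Proof.
move=> fd f0 dM.
have cf (a b : R) : {within `[a, b], continuous f}.
  apply: continuous_subspaceT => y; apply: differentiable_continuous.
  by apply/derivable1_diffP; have [] := fd y.
have [x0|x0] := leP 0 x.
  have [c] := MVT_segment x0 (fun y _ => fd y) (cf 0 x).
  rewrite in_itv /= f0 !subr0 => /andP[c0 cx] ->.
  by rewrite normrM ler_wpM2r// dM// !ger0_norm// (le_trans c0).
have [c] := MVT_segment (ltW x0) (fun y _ => fd y) (cf x 0).
rewrite in_itv /= f0 !sub0r => /andP[cx c0] E.
rewrite -normrN E normrM normrN ler_wpM2r// dM//.
by rewrite !ler0_norm ?lerN2// ltW.
Qed.

Lemma norm_sin_le x : `|sin x| <= `|x|.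
Proof.
have fd (y : R) : is_derive y (1 : R) sin (cos y) by exact: is_derive_sin.
rewrite -[leRHS]mul1r; apply: (norm_le_derive fd (sin0 R)) => y _; exact: cos_max.
Qed.

Lemma norm_cosB1_le x : `|cos x - 1| <= `|x| ^+ 2.
Proof.
have fd (y : R) : is_derive y (1 : R) (fun x => cos x - 1) (- sin y).
  by apply: is_derive_eq; rewrite subr0.
have f0 : cos 0 - 1 = 0 :> R by rewrite cos0 subrr.
rewrite expr2; apply: (@norm_le_derive _ _ `|x| x fd f0) => y yx.
by rewrite normrN (le_trans (norm_sin_le y)).
Qed.

Lemma norm_sinB_le x : `|sin x - x| <= `|x| ^+ 3.
Proof.
have fd (y : R) : is_derive y (1 : R) (fun x => sin x - x) (cos y - 1).
  exact: is_derive_eq.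
have f0 : sin 0 - 0 = 0 :> R by rewrite sin0 subrr.
rewrite exprSr; apply: (@norm_le_derive _ _ (`|x| ^+ 2) x fd f0) => y yx.
by rewrite (le_trans (norm_cosB1_le y))// lerXn2r ?nnegrE.
Qed.

Lemma norm_cos2_le x : `|cos x - 1 + x ^+ 2 / 2| <= `|x| ^+ 4.
Proof.
have fd (y : R) : is_derive y (1 : R) (fun x => cos x - 1 + x ^+ 2 / 2) (y - sin y).
  by apply: is_derive_eq; rewrite /GRing.scale /= ?mulr1; field.
have f0 : cos 0 - 1 + 0 ^+ 2 / 2 = 0 :> R by rewrite cos0 subrr expr0n /= mul0r addr0.
rewrite [leRHS]exprSr; apply: (@norm_le_derive _ _ (`|x| ^+ 3) x fd f0) => y yx.
by rewrite distrC (le_trans (norm_sinB_le y))// lerXn2r ?nnegrE.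
Qed.

Lemma expRN_le2 y : 0 <= y -> `|expR (- y) - 1 + y| <= y ^+ 2.
Proof.
move=> y0; have h1 := expR_ge1Dx (- y); rewrite ger0_norm; last by lra.
have := expR_ge1Dx y; have := expR_gt0 y => e0 e1.
have : expR (- y) <= (1 + y)^-1 by rewrite expRN lef_pV2 ?posrE//; lra.
have y1 : 0 < 1 + y by lra.
have : (1 + y)^-1 <= 1 - y + y ^+ 2.
  rewrite -[leLHS]mul1r ler_pdivrMr//.
  have : 0 <= y ^+ 3 by rewrite exprn_ge0.
  by rewrite (_ : (1 - y + y ^+ 2) * (1 + y) = 1 + y ^+ 3); [lra|ring].
by lra.
Qed.

Lemma norm_exprB_le (q r : R) m : `|q| <= 1 -> `|r| <= 1 -> `|q ^+ m - r ^+ m| <= m%:R * `|q - r|.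
Proof.
move=> q1 r1; elim: m => [|m ih]; first by rewrite !expr0 subrr normr0 mul0r.
have -> : q ^+ m.+1 - r ^+ m.+1 = q * (q ^+ m - r ^+ m) + (q - r) * r ^+ m by rewrite !exprS; ring.
rewrite (le_trans (ler_normD _ _))// -natr1 [leRHS]mulrDl mul1r lerD//.
  by rewrite normrM -[leRHS]mul1r ler_pM.
by rewrite normrM -[leRHS]mulr1 ler_pM// normrX exprn_ile1.
Qed.

End elementary.

Section block_char.
Context (R : realType) d (T : measurableType d) (P : probability T R).
Variables (m : nat) (beta : nat -> T -> R) (q e a : R).
Hypothesis mbeta : forall i, measurable_fun setT (beta i).
Hypothesis cosq : forall i, (i < m)%N -> Ex P (fun w => cos (beta i w)) = q.
Hypothesis sine : forall i, (i < m)%N -> `|Ex P (fun w => sin (beta i w))| <= e.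
Let S i w := \sum_(j < i) beta j w.
Hypothesis mix : forall i (F G : R -> R), (i < m)%N ->
  (F = cos \/ F = sin) -> (G = cos \/ G = sin) ->
  `|cov P (fun w => F (S i w)) (fun w => G (beta i w))| <= a.

Let mS i : measurable_fun setT (S i).
Proof. by apply: measurable_sum => j. Qed.

Let bcos f : measurable_fun setT f -> bounded_mfun (fun w : T => cos (f w : R)).
Proof. exact: bounded_mfun_cos. Qed.

Let bsin f : measurable_fun setT f -> bounded_mfun (fun w : T => sin (f w : R)).
Proof. exact: bounded_mfun_sin. Qed.

Let Ecos1 f : measurable_fun setT f -> `|Ex P (fun w : T => cos (f w : R))| <= 1.
Proof. by move=> mf; apply: Ex_bound; [exact: bcos|move=> w; exact: cos_max]. Qed.

Let Esin1 f : measurable_fun setT f -> `|Ex P (fun w : T => sin (f w : R))| <= 1.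
Proof. by move=> mf; apply: Ex_bound; [exact: bsin|move=> w; exact: sin_max]. Qed.

(** One step of the addition formulas of cosine and sine: up to the mixing error
   the new block acts on (E cos, E sin) as multiplication by [q], because its
   own sine has almost zero mean. *)
Lemma block_char i : (i <= m)%N ->
  `|Ex P (fun w => cos (S i w)) - q ^+ i| <= i%:R * (e + 2 * a) /\
  `|Ex P (fun w => sin (S i w))| <= i%:R * (e + 2 * a).
Proof.
elim: i => [_|i ih im].
  rewrite /S; split.
    under eq_fun do rewrite big_ord0 cos0.
    by rewrite Ex_cst expr0 subrr normr0 mul0r.
  under eq_fun do rewrite big_ord0 sin0.
  by rewrite Ex_cst normr0 mul0r.
have [ihc ihs] := ih (ltnW im).
have SE w : S i.+1 w = S i w + beta i w by rewrite /S big_ord_recr.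
have bcS := bcos (mS i); have bsS := bsin (mS i).
have bcb := bcos (mbeta i); have bsb := bsin (mbeta i).
have lc : (@cos R) = cos \/ (@cos R) = sin by left.
have ls : (@sin R) = cos \/ (@sin R) = sin by right.
have cc := mix im lc lc; have ss := mix im ls ls.
have cs := mix im lc ls; have sc := mix im ls lc.
have E1 : Ex P (fun w => cos (S i.+1 w)) =
    Ex P (fun w => cos (S i w) * cos (beta i w)) - Ex P (fun w => sin (S i w) * sin (beta i w)).
  rewrite -ExB; [|exact: bounded_mfunM..].
  by congr Ex; apply/funext => w; rewrite SE cosD.
have E2 : Ex P (fun w => sin (S i.+1 w)) =
    Ex P (fun w => sin (S i w) * cos (beta i w)) + Ex P (fun w => cos (S i w) * sin (beta i w)).
  rewrite -ExD; [|exact: bounded_mfunM..].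
  by congr Ex; apply/funext => w; rewrite SE sinD.
move: cc ss cs sc; rewrite /cov cosq//.
have C1 := Ecos1 (mS i); have S1 := Esin1 (mS i); have si := sine im.
have q1 : `|q| <= 1 by rewrite -(cosq im); exact: Ecos1.
move: E1 E2 ihc ihs C1 S1 si; set C := Ex P (fun w => cos (S i w)); set s := Ex P (fun w => sin (S i w)).
set b := Ex P (fun w => sin (beta i w)).
move=> -> -> ihc ihs C1 S1 si cc ss cs sc.
have qC : `|q * (C - q ^+ i)| <= i%:R * (e + 2 * a) by rewrite normrM -[leRHS]mul1r ler_pM.
have sb : `|s * b| <= e by rewrite normrM -[leRHS]mul1r ler_pM.
have Cb : `|C * b| <= e by rewrite normrM -[leRHS]mul1r ler_pM.
have sq : `|s * q| <= i%:R * (e + 2 * a) by rewrite normrM -[leRHS]mulr1 ler_pM.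
rewrite -natr1 mulrDl mul1r exprS.
set c1 := Ex P (fun w => cos (S i w) * cos _) in cc *.
set c2 := Ex P (fun w => sin (S i w) * sin _) in ss *.
set c3 := Ex P (fun w => cos (S i w) * sin _) in cs *.
set c4 := Ex P (fun w => sin (S i w) * cos _) in sc *.
move: cc ss cs sc qC sb Cb sq; move: (i%:R * (e + 2 * a)) => K.
rewrite !ler_norml => /andP[? ?] /andP[? ?] /andP[? ?] /andP[? ?].
move=> /andP[? ?] /andP[? ?] /andP[? ?] /andP[? ?].
by split; apply/andP; split; lra.
Qed.

End block_char.

Section small_variable.
Context (R : realType) d (T : measurableType d) (P : probability T R).
Variables (b : T -> R) (eta : R).
Hypotheses (mb : measurable_fun setT b) (bb : bounded_by eta b).
Hypotheses (eta0 : 0 <= eta) (eta1 : eta <= 1) (b0 : Ex P b = 0).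
Let v := Ex P (fun w => b w ^+ 2).

Let bmb : bounded_mfun b. Proof. by split => //; exists eta. Qed.

(** The sine of a small centred variable is the variable itself up to third order. *)
Lemma Ex_sin_small : `|Ex P (fun w => sin (b w))| <= eta * v.
Proof.
have bs := bounded_mfun_sin mb; have b2 := bounded_mfunX 2 bmb.
have -> : Ex P (fun w => sin (b w)) = Ex P (fun w => sin (b w) - b w).
  by rewrite ExB// b0 subr0.
apply: le_trans (le_norm_Ex _ (bounded_mfunB bs bmb)) _.
rewrite -ExZ//; apply: le_Ex.
- by apply: bounded_mfun_norm; exact: bounded_mfunB.
- exact: bounded_mfunZ.
- move=> w; apply: le_trans (norm_sinB_le _) _.
  by rewrite exprS real_normK ?num_real// ler_wpM2r ?sqr_ge0.
Qed.

Lemma Ex_cos_small : `|Ex P (fun w => cos (b w)) - 1 + v / 2| <= eta * v.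
Proof.
have bc := bounded_mfun_cos mb; have b2 := bounded_mfunX 2 bmb.
have b2' := bounded_mfunZ 2^-1 b2; have b1 := @bounded_mfun_cst _ T R (-1).
have -> : Ex P (fun w => cos (b w)) - 1 + v / 2 =
    Ex P (fun w => cos (b w) + (-1 + 2^-1 * b w ^+ 2)).
  by rewrite ExD ?ExD ?ExZ ?Ex_cst//; [rewrite addrA (mulrC v)|exact: bounded_mfunD].
apply: le_trans (le_norm_Ex _ (bounded_mfunD bc (bounded_mfunD b1 b2'))) _.
rewrite -ExZ//; apply: le_Ex.
- by apply: bounded_mfun_norm; apply: bounded_mfunD => //; exact: bounded_mfunD.
- exact: bounded_mfunZ.
- move=> w; rewrite addrA (mulrC 2^-1); apply: le_trans (norm_cos2_le _) _.
  rewrite (_ : 4 = 2 + 2)%N// exprD real_normK ?num_real// ler_wpM2r ?sqr_ge0//.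
  rewrite -real_normK ?num_real// expr2 (le_trans _ (bb w))// ler_piMl//.
  exact: le_trans (bb w) eta1.
Qed.

Lemma small_variance : 0 <= v <= eta ^+ 2.
Proof.
apply/andP; split; first by apply: Ex_ge0 => w; exact: sqr_ge0.
rewrite -[leRHS](Ex_cst P); apply: le_Ex; [exact: bounded_mfunX|exact: bounded_mfun_cst|].
by move=> w; rewrite -real_normK ?num_real// lerXn2r ?nnegrE.
Qed.

Lemma Ex_cos_pow m : `|Ex P (fun w => cos (b w)) ^+ m - expR (- (m%:R * v / 2))| <= m%:R * (2 * eta * v).
Proof.
have /andP[v0 v1] := small_variance.
have -> : expR (- (m%:R * v / 2)) = expR (- (v / 2)) ^+ m.
  by rewrite -expRM_natl; congr expR; ring.
apply: le_trans (norm_exprB_le _ _ _) _.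
- by apply: Ex_bound; [exact: bounded_mfun_cos|move=> w; exact: cos_max].
- rewrite ger0_norm ?expR_ge0// -[leRHS]expR0 ler_expR oppr_le0 divr_ge0//.
- rewrite ler_wpM2l//.
  have h1 := Ex_cos_small; have := expRN_le2 (_ : 0 <= v / 2).
  have v20 : 0 <= v / 2 by rewrite divr_ge0.
  move=> /(_ v20) h2.
  have h3 : (v / 2) ^+ 2 <= eta * v.
    have : eta ^+ 2 <= eta by rewrite expr2 ler_piMl.
    move=> ?; have : v * v <= eta * v by rewrite ler_wpM2r// (le_trans v1).
    nra.
  move: h1 h2; rewrite !ler_norml => /andP[? ?] /andP[? ?]; apply/andP; split; lra.
Qed.

End small_variable.

(** * Sums over blocks of a stationary mixing sequence *)

Lemma sum_dist_le (R : realType) (f : nat -> R) (L k : nat) : (k < L)%N ->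
  (forall h, 0 <= f h) -> \sum_(l < L) f `|k - l|%N <= 2 * \sum_(h < L) f h.
Proof.
move=> kL f0; rewrite -(big_mkord xpredT (fun l => f `|k - l|%N)) -(big_mkord xpredT f).
have mono a b : (a <= b)%N -> \sum_(0 <= h < a) f h <= \sum_(0 <= h < b) f h.
  by move=> ab; rewrite [leRHS](@big_cat_nat _ _ _ a)//= lerDl sumr_ge0.
rewrite (@big_cat_nat _ _ _ k)//= ?(ltnW kL)// mulr_natl mulr2n lerD//.
  rewrite big_nat_rev /= add0n (@le_trans _ _ (\sum_(0 <= h < k.+1) f h)) ?mono//.
  rewrite big_nat_recl//= -[leLHS]add0r lerD//.
  rewrite big_nat [leRHS]big_nat le_eqVlt; apply/orP; left; apply/eqP.
  apply: eq_bigr => l /andP[_ lk]; congr f.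
  by rewrite distnEl ?leq_subr// subKn.
rewrite -[X in \sum_(X <= _ < _) _]add0n big_addn (le_trans _ (mono _ _ (leq_subr k L)))//.
rewrite le_eqVlt; apply/orP; left; apply/eqP; apply: eq_bigr => l _.
by congr f; rewrite distnEr ?leq_addl// addnK.
Qed.

Section array.
Context {d : measure_display} {T : measurableType d} {R : realType}.
Variables (P : probability T R) (X : int -> {RV P >-> R}).
Hypothesis stat : strictly_stationary X.

Lemma Ex_same_law n (V V' : T -> 'rV[R]_n) (phi : 'rV[R]_n -> R) :
  measurable_coords V -> measurable_coords V' ->
  (forall B, borel_set B -> P (V @^-1` B) = P (V' @^-1` B)) ->
  bounded_mfun (phi : borelRn R n -> R) ->
  Ex P (fun w => phi (V w)) = Ex P (fun w => phi (V' w)).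
Proof.
move=> mV mV' H bphi.
pose F : {mfun T >-> borelRn R n} := HB.pack V (isMeasurableFun.Build _ _ _ _ _ (measurable_fun_rV mV)).
pose F' : {mfun T >-> borelRn R n} := HB.pack V' (isMeasurableFun.Build _ _ _ _ _ (measurable_fun_rV mV')).
have := Ex_pushforward P F bphi; have := Ex_pushforward P F' bphi.
rewrite /F /F' /= => <- <-; rewrite /Ex /Rintegral; congr fine.
by apply: eq_measure_integral => B mB _; exact: H.
Qed.

Lemma Ex_margin_shift n (s : 'I_n -> int) (c : int) (phi : 'rV[R]_n -> R) :
  bounded_mfun (phi : borelRn R n -> R) ->
  Ex P (fun w => phi (margin X (fun i => s i + c) w)) = Ex P (fun w => phi (margin X s w)).
Proof.
move=> bphi; apply: Ex_same_law => //; [exact: measurable_margin..|].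
by move=> B bB; exact: stat.
Qed.

Lemma Ex_window_shift n (s : int) (phi : 'rV[R]_n -> R) :
  bounded_mfun (phi : borelRn R n -> R) ->
  Ex P (fun w => phi (window X s n w)) = Ex P (fun w => phi (window X 0 n w)).
Proof.
move=> bphi; rewrite -[RHS](Ex_margin_shift _ s bphi); congr Ex; apply/funext => w.
congr phi; apply/rowP => i; rewrite !mxE; congr (X _ w).
by rewrite add0r addrC.
Qed.

Variables (t : nat) (z : 'rV[R]_t.+2 -> R) (C : R).
Hypotheses (mz : measurable_fun setT (z : borelRn R t.+2 -> R)) (zC : bounded_by C z).

Definition xi (k : nat) (w : T) : R := z (window X k%:Z t.+2 w).

Definition subrow (M k : nat) (x : 'rV[R]_M.+1) : 'rV[R]_t.+2 :=
  \row_(l < t.+2) x ord0 (inord (k + l)).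

Lemma subrow_window (s : int) M k w : (k + t.+1 <= M)%N ->
  subrow k (window X s M.+1 w) = window X (s + k%:Z) t.+2 w.
Proof.
move=> kM; apply/rowP => l; rewrite !mxE; congr (X _ w).
rewrite inordK; first by rewrite PoszD addrA.
by have := ltn_ord l; lia.
Qed.

Lemma measurable_subrow M k : measurable_fun setT (fun x : borelRn R M.+1 => z (subrow k x)).
Proof.
apply: (@measurableT_comp _ _ _ _ _ _ (z : borelRn R t.+2 -> R)) => //.
apply: measurable_fun_rV => i; under eq_fun do rewrite mxE.
exact: measurable_coord.
Qed.

Lemma measurable_xi k : measurable_fun setT (xi k).
Proof.
apply: (@measurableT_comp _ _ _ _ _ _ (z : borelRn R t.+2 -> R)) => //.
by apply: measurable_fun_rV; exact: measurable_window.
Qed.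

Lemma bounded_xi k : bounded_mfun (xi k).
Proof. by split; [exact: measurable_xi|exists C => w; exact: zC]. Qed.

Lemma C_ge0 : 0 <= C. Proof. exact: le_trans (zC 0). Qed.

(** The covariance function of the centred stationary sequence. *)
Definition gam (h : nat) : R := Ex P (fun w => xi 0 w * xi h w).

Lemma Ex_xi k : Ex P (xi k) = Ex P (xi 0).
Proof. by rewrite /xi Ex_window_shift//; split => //; exists C. Qed.

Lemma Ex_xi2 k h : Ex P (fun w => xi k w * xi (k + h) w) = gam h.
Proof.
pose phi (x : 'rV[R]_(h + t.+1).+1) := z (subrow 0 x) * z (subrow h x).
have E s w : phi (window X s (h + t.+1).+1 w) = z (window X s t.+2 w) * z (window X (s + h%:Z) t.+2 w).
  by rewrite /phi !subrow_window ?addr0//; lia.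
have bphi : bounded_mfun (phi : borelRn R _ -> R).
  by apply: bounded_mfunM; split; (try exact: measurable_subrow); exists C => x; exact: zC.
rewrite /gam.
transitivity (Ex P (fun w => phi (window X k%:Z _ w))).
  by congr Ex; apply/funext => w; rewrite E /xi PoszD.
rewrite Ex_window_shift//; congr Ex; apply/funext => w.
by rewrite E /xi add0r.
Qed.

(** Each index meets every lag at most twice, so the double sum of covariances is
   linear in the total weight. *)
Lemma Ex_weighted_sum_sqr (L : nat) (c : nat -> R) : (forall k, 0 <= c k <= 1) ->
  Ex P (fun w => (\sum_(k < L) c k * xi k w) ^+ 2) <=
    2 * (\sum_(k < L) c k) * \sum_(h < L) `|gam h|.
Proof.
move=> c01.
have E : (fun w => (\sum_(k < L) c k * xi k w) ^+ 2) =
    fun w => \sum_(k < L) \sum_(l < L) (c k * c l) * (xi k w * xi l w).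
  apply/funext => w; rewrite expr2 mulr_suml; apply: eq_bigr => k _.
  by rewrite mulr_sumr; apply: eq_bigr => l _; ring.
have bxx k l : bounded_mfun (fun w => xi k w * xi l w) by apply: bounded_mfunM; exact: bounded_xi.
rewrite E Ex_sum; last by move=> k _; apply: bounded_mfun_sum => l _; exact: bounded_mfunZ.
rewrite -mulrA mulr_suml mulr_sumr; apply: ler_sum => k _.
rewrite Ex_sum; last by move=> l _; exact: bounded_mfunZ.
have /andP[ck0 ck1] := c01 k.
apply: (@le_trans _ _ (c k * \sum_(l < L) `|gam `|k - l|%N|)).
  rewrite mulr_sumr; apply: ler_sum => l _; rewrite ExZ// -mulrA ler_wpM2l//.
  have /andP[cl0 cl1] := c01 l.
  have -> : Ex P (fun w => xi k w * xi l w) = gam `|k - l|%N.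
    have [kl|lk] := leqP k l.
      by rewrite -(Ex_xi2 k) distnC distnEl// subnKC.
    rewrite -(Ex_xi2 l) distnEl ?(ltnW lk)// subnKC ?(ltnW lk)//.
    by congr Ex; apply/funext => w; rewrite mulrC.
  rewrite (le_trans (ler_norm _))// normrM (ger0_norm cl0) ler_piMl//.
rewrite mulrCA ler_wpM2l//.
by apply: (sum_dist_le (f := fun h => `|gam h|)).
Qed.

(** By stationarity the pairs of indices are collected by their lag. *)
Lemma Ex_block_sqr (b : nat) :
  Ex P (fun w => (\sum_(k < b) xi k w) ^+ 2) =
    b%:R * gam 0 + 2 * \sum_(1 <= h < b) (b - h)%:R * gam h.
Proof.
elim: b => [|b ih].
  rewrite big_geq// mulr0 addr0 mul0r.
  under eq_fun do rewrite big_ord0 expr0n.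
  by rewrite Ex_cst.
have bS k : bounded_mfun (fun w => \sum_(j < k) xi j w).
  by apply: bounded_mfun_sum => j _; exact: bounded_xi.
have bx := bounded_xi b.
have -> : (fun w => (\sum_(k < b.+1) xi k w) ^+ 2) = fun w =>
    (\sum_(k < b) xi k w) ^+ 2 + (2 * (\sum_(k < b) xi k w * xi b w) + xi b w * xi b w).
  apply/funext => w; rewrite big_ord_recr /= -mulr_suml.
  by move: (\sum_(i < b) _) => y; ring.
have bxx k l : bounded_mfun (fun w => xi k w * xi l w) by apply: bounded_mfunM; exact: bounded_xi.
have b1 : bounded_mfun (fun w => \sum_(k < b) xi k w * xi b w) by apply: bounded_mfun_sum.
have b2 := bounded_mfunZ 2 b1; have bb := bxx b b.
rewrite (ExD _ (bounded_mfunX 2 (bS b)) (bounded_mfunD b2 bb)) (ExD _ b2 bb) ExZ// Ex_sum// ih.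
have g0 : Ex P (fun w => xi b w * xi b w) = gam 0 by rewrite -(Ex_xi2 b) addn0.
have gk : \sum_(k < b) Ex P (fun w => xi k w * xi b w) = \sum_(1 <= h < b.+1) gam h.
  rewrite (eq_bigr (fun k : 'I_b => gam (b - k))); last first.
    by move=> k _; rewrite -(Ex_xi2 k) subnKC// ltnW.
  rewrite -(big_mkord xpredT (fun k => gam (b - k))) big_nat_rev /= add0n.
  rewrite big_add1 /= big_nat [RHS]big_nat; apply: eq_bigr => k /andP[_ kb].
  by rewrite subKn.
rewrite g0 gk -natr1.
have -> : \sum_(1 <= h < b.+1) (b.+1 - h)%:R * gam h =
    \sum_(1 <= h < b) (b - h)%:R * gam h + \sum_(1 <= h < b.+1) gam h.
  case: b {ih bS bx b1 b2 bb bxx g0 gk} => [|b]; first by rewrite !big_geq// addr0.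
  rewrite big_nat_recr//= [X in _ = _ + X]big_nat_recr//= addrA -big_split /= subSnn mul1r.
  congr (_ + _); rewrite big_nat [RHS]big_nat; apply: eq_bigr => h /andP[_ hb].
  by rewrite subSn ?(ltnW hb)// -natr1; ring.
by ring.
Qed.
End array.

Section block_sums.
Context {d : measure_display} {T : measurableType d} {R : realType}.
Variables (P : probability T R) (X : int -> {RV P >-> R}).
Hypothesis stat : strictly_stationary X.

Lemma mixing_ge0 h : 0 <= mixing X h.
Proof.
have bT : @borel_RN R setT.
  exact: (@measurableT _ (g_sigma_algebraType (\bigcup_i preimage_set_system setT
    (fun x : nat -> R => x i) (@measurable _ R)))).
exact: le_trans (normr_ge0 _) (@le_mixing _ _ _ _ X h _ _ bT bT _ _ erefl erefl).
Qed.

Variables (t : nat) (z : 'rV[R]_t.+2 -> R) (C : R).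
Hypotheses (mz : measurable_fun setT (z : borelRn R t.+2 -> R)) (zC : bounded_by C z).
Local Notation xi := (xi X z).
Hypothesis xi0 : Ex P (xi 0) = 0.
Variables (b h m : nat) (lam : R).
Hypothesis lam0 : 0 <= lam.

Definition block (i : nat) (w : T) : R := lam * \sum_(r < b) xi (i * (b + h + t) + r) w.

Let mxi := measurable_xi X mz.

Lemma measurable_block i : measurable_fun setT (block i).
Proof. by apply: measurable_funM => //; apply: measurable_sum => r; exact: mxi. Qed.

Let phi0 (G : R -> R) (x : 'rV[R]_(b + t).+1) : R := G (lam * \sum_(r < b) z (subrow t r x)).

Let phi0_window G i w :
  phi0 G (window X (i * (b + h + t))%:Z (b + t).+1 w) = G (block i w).
Proof.
rewrite /phi0 /block; congr (G (_ * _)); apply: eq_bigr => r _.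
by rewrite subrow_window ?PoszD//; have := ltn_ord r; lia.
Qed.

Let trig_fun (G : R -> R) := G = cos \/ G = sin.

Let bounded_trig d0 (S : measurableType d0) (f : S -> R) G : trig_fun G ->
  measurable_fun setT f -> bounded_mfun (fun w => G (f w)) /\ bounded_by 1 (fun w => G (f w)).
Proof.
case=> -> mf; split=> [|w].
- exact: bounded_mfun_cos.
- exact: cos_max.
- exact: bounded_mfun_sin.
- exact: sin_max.
Qed.

Let mphi0 : measurable_fun setT
  (fun x : borelRn R (b + t).+1 => lam * \sum_(r < b) z (subrow t r x)).
Proof.
by apply: measurable_funM => //; apply: measurable_sum => r; exact: measurable_subrow.
Qed.

Let Ex_block G i : trig_fun G -> Ex P (fun w => G (block i w)) = Ex P (fun w => G (block 0 w)).
Proof.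
move=> tG; have [bG _] := bounded_trig tG mphi0.
have E j : Ex P (fun w => G (block j w)) = Ex P (fun w => phi0 G (window X 0 (b + t).+1 w)).
  rewrite -[RHS](Ex_window_shift stat ((j * (b + h + t))%:Z) bG).
  by congr Ex; apply/funext => w; rewrite -phi0_window.
by rewrite !E.
Qed.

Let block_cov i (F G : R -> R) : trig_fun F -> trig_fun G ->
  `|cov P (fun w => F (\sum_(j < i) block j w)) (fun w => G (block i w))| <= 4 * mixing X h.
Proof.
move=> tF tG; have [bG G1] := bounded_trig tG mphi0.
case: i => [|i].
  rewrite /cov; under [X in Ex P X - _]eq_fun do rewrite big_ord0.
  under [X in _ - Ex P X * _]eq_fun do rewrite big_ord0.
  rewrite ExZ; last by have [] := bounded_trig tG (measurable_block 0).
  by rewrite Ex_cst subrr normr0 mulr_ge0// mixing_ge0.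
pose M := (i * (b + h + t) + b + t)%N.
pose past (x : 'rV[R]_M.+1) : R :=
  \sum_(j < i.+1) lam * \sum_(r < b) z (subrow t (j * (b + h + t) + r) x).
have mpast : measurable_fun setT (past : borelRn R M.+1 -> R).
  apply: measurable_sum => j; apply: measurable_funM => //.
  by apply: measurable_sum => r; exact: measurable_subrow.
have [bF F1] := bounded_trig tF mpast.
have := cov_windows stat 0 h bF.1 bG.1 F1 G1.
have -> : (fun w => phi0 G (window X (0 + M%:Z + h%:Z) (b + t).+1 w)) = fun w => G (block i.+1 w).
  apply/funext => w; rewrite -phi0_window; congr (phi0 G (window X _ _ w)).
  by rewrite add0r -PoszD; congr Posz; rewrite /M mulSn; lia.
have -> // : (fun w => F (past (window X 0 M.+1 w))) = fun w => F (\sum_(j < i.+1) block j w).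
apply/funext => w; congr F; apply: eq_bigr => j _; congr (_ * _); apply: eq_bigr => r _.
rewrite subrow_window ?add0r// /M.
have jb : (j * (b + h + t) <= i * (b + h + t))%N by rewrite leq_mul2r -ltnS ltn_ord orbT.
by have := ltn_ord r; lia.
Qed.

Let v := lam ^+ 2 * Ex P (fun w => (\sum_(r < b) xi r w) ^+ 2).
Let eta := lam * (b%:R * C).
Hypothesis eta1 : eta <= 1.

(** Mixing across the gaps makes the blocks almost independent with a common law, and
   a block is bounded by the small number [eta], so that the mean of its cosine is
   [1 - v / 2] up to third order. *)
Lemma block_sum_char :
  `|Ex P (fun w => cos (\sum_(i < m) block i w)) - expR (- (m%:R * v / 2))|
     <= m%:R * (3 * eta * v + 8 * mixing X h) /\
  `|Ex P (fun w => sin (\sum_(i < m) block i w))| <= m%:R * (3 * eta * v + 8 * mixing X h).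
Proof.
have bxi := bounded_xi X mz zC.
have bB0 : bounded_by eta (block 0).
  move=> w; rewrite /block normrM (ger0_norm lam0) ler_wpM2l//.
  rewrite (le_trans (ler_norm_sum _ _ _))//.
  apply: (@le_trans _ _ (\sum_(r < b) C)); first by apply: ler_sum => r _; exact: zC.
  by rewrite sumr_const card_ord mulr_natl.
have eta0 : 0 <= eta by rewrite !mulr_ge0//; exact: C_ge0 zC.
have bsum : bounded_mfun (fun w => \sum_(r < b) xi r w).
  by apply: bounded_mfun_sum => r _; exact: bxi.
have EB0 : Ex P (block 0) = 0.
  rewrite /block; under eq_fun do under eq_bigr do rewrite mul0n add0n.
  rewrite ExZ// Ex_sum; last by move=> r _; exact: bxi.
  by rewrite big1 ?mulr0// => r _; rewrite (Ex_xi stat mz zC).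
have vE : Ex P (fun w => block 0 w ^+ 2) = v.
  rewrite /v -ExZ; last exact: bounded_mfunX.
  congr Ex; apply/funext => w; rewrite /block exprMn.
  by under eq_bigr do rewrite mul0n add0n.
have mB0 := measurable_block 0.
have sB := Ex_sin_small mB0 bB0 EB0.
have cB := Ex_cos_pow P mB0 bB0 eta0 eta1 m.
have /andP[v0 _] := small_variance P mB0 bB0 eta0.
rewrite vE in sB cB v0.
have lc : trig_fun cos by left.
have ls : trig_fun sin by right.
have [|||hc hs] := @block_char R _ _ P m block (Ex P (fun w => cos (block 0 w))) (eta * v)
   (4 * mixing X h) measurable_block _ _ _ m (leqnn m).
- by move=> i _; exact: Ex_block.
- by move=> i _; rewrite Ex_block.
- by move=> i F G _ tF tG; exact: block_cov.
have m0 : 0 <= m%:R :> R by [].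
have ev0 : 0 <= eta * v by exact: mulr_ge0.
have al0 := mixing_ge0 h.
have mev : 0 <= m%:R * (eta * v) by exact: mulr_ge0.
split.
  move: hc cB; rewrite !ler_norml => /andP[? ?] /andP[? ?]; apply/andP; split; lra.
apply: le_trans hs _; lra.
Qed.

End block_sums.

(** * Continuous approximations of closed sets *)

Section cutoff.
Context (R : realType) (n : nat).
Implicit Types (F : set 'rV[R]_n) (x y : 'rV[R]_n).

Let bump (k : nat) (y g : 'rV[R]_n) : R := Num.max 0 (1 - k%:R * `|y - g|).

Let bump01 k y g : 0 <= bump k y g <= 1.
Proof.
rewrite /bump le_max lexx /= ge_max ler01 /=.
by rewrite gerBl mulr_ge0.
Qed.

(** A tent of slope [k] around [F]; the supremum over an empty [F] is [0]. *)
Definition cutoff F (k : nat) y : R := sup [set bump k y g | g in F].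

Let cutoff_ub F k y : has_ubound [set bump k y g | g in F].
Proof. by exists 1 => _ [g _ <-]; have /andP[] := bump01 k y g. Qed.

Lemma cutoff_le F k y M : 0 <= M -> (forall g, F g -> Num.max 0 (1 - k%:R * `|y - g|) <= M) ->
  cutoff F k y <= M.
Proof.
move=> M0 H; rewrite /cutoff; have [->|/set0P[g Fg]] := eqVneq F set0.
  by rewrite image_set0 sup0.
by apply: ge_sup; [by exists (bump k y g), g|move=> _ [g' Fg' <-]; exact: H].
Qed.

Lemma le_cutoff F k y g : F g -> Num.max 0 (1 - k%:R * `|y - g|) <= cutoff F k y.
Proof. by move=> Fg; apply: ub_le_sup; [exact: cutoff_ub|exists g]. Qed.

Lemma cutoff_ge0 F k y : 0 <= cutoff F k y.
Proof.
have [F0|/set0P[g Fg]] := eqVneq F set0; first by rewrite /cutoff F0 image_set0 sup0.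
by apply: le_trans (le_cutoff k y Fg); have /andP[] := bump01 k y g.
Qed.

Lemma cutoff_le1 F k y : cutoff F k y <= 1.
Proof. by apply: cutoff_le => // g _; have /andP[] := bump01 k y g. Qed.

Lemma cutoff_bounded F k : bounded_by 1 (cutoff F k).
Proof. by move=> y; rewrite ger0_norm ?cutoff_ge0// cutoff_le1. Qed.

Lemma cutoff1 F k y : F y -> cutoff F k y = 1.
Proof.
move=> Fy; apply/eqP; rewrite eq_le cutoff_le1 (le_trans _ (le_cutoff k y Fy))//.
by rewrite subrr normr0 mulr0 subr0 le_max lexx orbT.
Qed.

Lemma cutoff_lip F k y y' : cutoff F k y <= cutoff F k y' + k%:R * `|y - y'|.
Proof.
apply: cutoff_le => [|g Fg]; first by rewrite addr_ge0 ?cutoff_ge0 ?mulr_ge0.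
rewrite ge_max; apply/andP; split; first by rewrite addr_ge0 ?cutoff_ge0 ?mulr_ge0.
apply: (@le_trans _ _ (1 - k%:R * `|y' - g| + k%:R * `|y - y'|)).
  have : `|y' - g| <= `|y - y'| + `|y - g| by rewrite (distrC y y'); exact: ler_distD.
  have : 0 <= k%:R :> R by [].
  nra.
by rewrite lerD2r (le_trans _ (le_cutoff k y' Fg))// le_max lexx orbT.
Qed.

Lemma cutoff_continuous F k : continuous (cutoff F k).
Proof.
move=> y; apply/(@cvgrPdist_le _ _ _ (nbhs y)) => e e0.
have k0 : 0 <= k%:R :> R by [].
apply/nbhs_ballP; exists (e / k.+1%:R) => /=; first by rewrite divr_gt0.
move=> y'; rewrite -ball_normE /ball_ /= => yy'.
have h : k%:R * `|y - y'| <= e.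
  move: yy'; rewrite ltr_pdivlMr// mulrC => /ltW h; apply: le_trans h.
  by rewrite ler_wpM2r// ler_nat.
have h1 := cutoff_lip F k y y'; have h2 := cutoff_lip F k y' y.
by rewrite distrC in h2; rewrite ler_norml; apply/andP; split; lra.
Qed.

Lemma cutoff_near F k y : cutoff F k.+1 y != 0 -> exists2 g, F g & `|y - g| < k.+1%:R^-1.
Proof.
move=> c0; apply: contrapT => H; move/eqP: c0; apply.
apply/eqP; rewrite eq_le cutoff_ge0 andbT; apply: cutoff_le => // g Fg.
rewrite max_l// subr_le0 mulrC -ler_pdivrMr// mul1r leNgt; apply/negP => h.
by apply: H; exists g.
Qed.

Lemma cutoff_cvg0 F y (y_ : nat -> 'rV[R]_n) (s : nat -> nat) : closed F -> ~ F y ->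
  (forall k, (k <= s k)%N) -> y_ k @[k --> \oo] --> y ->
  cutoff F (s k).+1 (y_ k) @[k --> \oo] --> (0 : R).
Proof.
move=> cF Fy ks yc.
have [r /= r0 rF] : exists2 r : R, 0 < r & ball y r `<=` ~` F.
  by apply/nbhs_ballP; apply: open_nbhs_nbhs; split => //; exact: closed_openC.
apply: cvg_near_cst; near=> k; apply/eqP/negPn/negP => /cutoff_near[g Fg yg].
apply: (rF g) => //; rewrite -ball_normE /ball_ /=.
rewrite (splitr r) (le_lt_trans (ler_distD (y_ k) _ _))// ltr_leD//.
  by near: k; apply: cvgr_dist_lt => //; rewrite divr_gt0.
rewrite (le_trans (ltW yg))//.
apply: (@le_trans _ _ k.+1%:R^-1); first by rewrite lef_pV2 ?posrE// ler_nat ltnS.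
near: k.
have : (k.+1%:R^-1 : R) @[k --> \oo] --> (0 : R) by exact: cvg_harmonic.
move=> /cvgrPdist_le/(_ (r / 2)); rewrite divr_gt0// => /(_ isT); apply: filterS => k.
by rewrite sub0r normrN ger0_norm.
Unshelve. all: end_near. Qed.

End cutoff.

(** * Consequences of the convergence to the tail process *)

Lemma measurable_scaled_window d (T : measurableType d) (R : realType)
    (P : probability T R) (X : int -> {RV P >-> R}) (x : R) s n :
  measurable_coords (fun w => x *: window X s n w).
Proof.
move=> i; under eq_fun do rewrite mxE.
by apply: measurable_funM => //; exact: measurable_window.
Qed.

Lemma measurable_gt d (T : measurableType d) (R : realType) (P : probability T R)
    (X : int -> {RV P >-> R}) (x : R) k : measurable [set w | x < X k w].
Proof.
have m0 : measurable_fun setT (X k) by exact: (measurable_funP (X k)).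
have mi : measurable_fun setT (fun w => x < X k w) by exact: measurable_fun_ltr.
rewrite -[X in measurable X]setTI; exact: (mi measurableT [set true]).
Qed.

Section tail_process.
Context (R : realType) (d : measure_display) (T : measurableType d) (P : probability T R).
Context (d' : measure_display) (T' : measurableType d') (Q : probability T' R).
Variables (X : int -> {RV P >-> R}) (Y : int -> {RV Q >-> R}) (alpha : R).
Hypotheses (stat : strictly_stationary X) (tailY : is_tail_process X Y alpha).
Hypothesis p_gt0 : forall x, 0 < tailp X x.

Lemma measurable_exceeds x : measurable (exceeds X x).
Proof. exact: measurable_gt. Qed.

Definition Ex_on (x : R) (f : T -> R) : R := Ex P (fun w => \1_(exceeds X x) w * f w).

Lemma bounded_mfun_on x f : bounded_mfun f -> bounded_mfun (fun w => (\1_(exceeds X x) w : R) * f w).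
Proof.
by move=> bf; apply: bounded_mfunM => //; apply: bounded_mfun_indic; exact: measurable_exceeds.
Qed.

Lemma weak_tail n (g : 'rV[R]_n.+2 -> R) M : continuous g -> bounded_by M g ->
  Ex_on x (fun w => g (x^-1 *: window X (-1) n.+2 w)) / tailp X x @[x --> +oo] -->
  Ex Q (fun w => g (window Y (-1) n.+2 w)).
Proof.
move=> cg gM; have n1 : (-1 : int) < n%:Z by lia.
have [_ /(_ _ _ n1)] := tailY.
have -> : (absz (n%:Z - (-1))%R).+1 = n.+2 by lia.
move=> /= /(_ g cg).
have bg : bounded_fun g.
  exists M; split; first exact: num_real.
  by move=> y My x _ /=; rewrite (le_trans (gM x))// ltW.
move=> /(_ bg).
rewrite (_ : (fun x => cond_mean _ _ _ _) = fun x =>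
  Ex_on x (fun w => g (x^-1 *: window X (-1) n.+2 w)) / tailp X x)//.
apply/funext => x; rewrite /cond_mean /Ex_on /Ex /tailp; congr (_ / _).
rewrite Rintegral_mkcond; apply: eq_Rintegral => w _.
rewrite patchE indicE; case: (w \in _); first by rewrite mul1r.
by rewrite mul0r.
Qed.

Let X0_window n w : window X (-1) n.+2 w ord0 (inord 1) = X 0 w.
Proof. by rewrite mxE inordK. Qed.

Let Y0_window n w : window Y (-1) n.+2 w ord0 (inord 1) = Y 0 w.
Proof. by rewrite mxE inordK. Qed.

(** The law of [Y 0] charges the points above 3, so the conditional probability of
   [X 0 > 2 * x] given [X 0 > x] stays away from zero. *)
Lemma tailp_ratio : exists2 K, 0 < K & \forall x \near +oo, tailp X x <= K * tailp X (2 * x).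
Proof.
pose f (y : 'rV[R]_2) := ramp 2 1 (y ord0 (inord 1)).
have cf : continuous f.
  move=> y; apply: (@continuous_comp _ _ _ (fun y : 'rV[R]_2 => y ord0 (inord 1)) (ramp 2 1)).
    exact: coord_continuous.
  exact: continuous_ramp.
have fb : bounded_by 1 f by move=> y; exact: ramp_bounded.
have wt := weak_tail cf fb.
set l := Ex Q _ in wt.
have l0 : 3 `^ (- alpha) <= l.
  have <- : tailp Y 3 = 3 `^ (- alpha) by have [H _] := tailY; apply: H; rewrite ler1n.
  have mY : measurable (exceeds Y 3) by exact: measurable_gt.
  rewrite /tailp -Ex_indic// /l; apply: le_Ex.
  - exact: bounded_mfun_indic.
  - by apply: (bounded_mfun_comp _ cf fb); exact: measurable_window.
  - move=> w; rewrite /f Y0_window indicE; case: (boolP (w \in _)) => [|_].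
      rewrite inE /exceeds /= /ramp => h; rewrite le_min lexx /= le_max.
      by apply/orP; right; rewrite mul1r; lra.
    by rewrite /ramp le_min ler01 le_max lexx.
have c0 : 0 < (3 : R) `^ (- alpha) by exact: powR_gt0.
have lp : 0 < l by exact: lt_le_trans l0.
exists (2 / l); first by rewrite divr_gt0.
have := cvgr_gt _ wt (l / 2); rewrite ltr_pdivrMr// mulr_natr mulr2n ltrDl => /(_ _ lp) H.
near=> x.
have x0 : 0 < x by near: x; exact: nbhs_pinfty_gt.
have : l / 2 < Ex_on x (fun w => f (x^-1 *: window X (-1) 2 w)) / tailp X x by near: x.
rewrite ltr_pdivlMr// => h.
have : Ex_on x (fun w => f (x^-1 *: window X (-1) 2 w)) <= tailp X (2 * x).
  rewrite /tailp -Ex_indic; last exact: measurable_exceeds.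
  apply: le_Ex.
  - apply: bounded_mfun_on; apply: (bounded_mfun_comp _ cf fb).
    exact: measurable_scaled_window.
  - by apply: bounded_mfun_indic; exact: measurable_exceeds.
  - move=> w; rewrite /f mxE X0_window.
    have [e2|e2] := ltP (2 * x) (X 0 w).
      rewrite [in leRHS]indicE mem_set//= -[leRHS]mul1r.
      have /(_ (x^-1 * X 0 w)) := @ramp_bounded R 2 1; rewrite ler_norml => /andP[_ r1].
      rewrite indicE; case: (_ \in _); rewrite ?mul0r ?mul1r// ler01//.
    rewrite [ramp _ _ _](_ : _ = 0) ?mulr0 ?indicE//.
    rewrite /ramp max_l ?min_r// mul1r subr_le0 mulrC ler_pdivrMr//.
move=> h2; rewrite mulrAC ler_pdivlMr// mulrC.
have : l / 2 * tailp X x < tailp X (2 * x) by exact: lt_le_trans h2.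
lra.
Unshelve. all: end_near. Qed.

Lemma le_tailp x y : x <= y -> tailp X y <= tailp X x.
Proof.
move=> xy; apply: le_Pr; [exact: measurable_exceeds..|].
by move=> w /=; rewrite /exceeds /=; exact: le_lt_trans.
Qed.

Lemma continuous_subrow t M k : continuous (@subrow R t M k).
Proof.
move=> x; apply/(@cvgrPdist_le _ _ _ (nbhs x)) => e e0.
apply/nbhs_ballP; exists e => //= y [_ xy].
rewrite -[leLHS]/(mx_norm _) mx_normrE; apply/bigmax_leP; split; first exact: ltW.
by move=> [a l] _ /=; rewrite !mxE; apply/ltW; exact: xy.
Qed.

Variable t : nat.
Local Notation WX h := (window X (h%:Z - 1) t.+2).
Local Notation WY h := (window Y (h%:Z - 1) t.+2).

Let subrowX h w : subrow t h (window X (-1) (h + t).+2 w) = WX h w.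
Proof. by rewrite subrow_window ?addnS// addrC. Qed.

Let subrowY h w : subrow t h (window Y (-1) (h + t).+2 w) = WY h w.
Proof. by rewrite subrow_window ?addnS// addrC. Qed.

Let subrowZ M h x (y : 'rV[R]_M.+1) : subrow t h (x *: y) = x *: subrow t h y.
Proof. by apply/rowP => l; rewrite !mxE. Qed.

Lemma weak_tail_prod (f1 f2 : 'rV[R]_t.+2 -> R) h :
  continuous f1 -> continuous f2 -> bounded_by 1 f1 -> bounded_by 1 f2 ->
  Ex_on x (fun w => f1 (x^-1 *: WX 0 w) * f2 (x^-1 *: WX h w)) / tailp X x @[x --> +oo] -->
  Ex Q (fun w => f1 (WY 0 w) * f2 (WY h w)).
Proof.
move=> c1 c2 b1 b2.
pose g (x : 'rV[R]_(h + t).+2) := f1 (subrow t 0 x) * f2 (subrow t h x).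
have cg : continuous g.
  move=> x; apply: (@continuousM _ _ (fun x => f1 (@subrow R t (h + t).+1 0 x)) (fun x => f2 (@subrow R t (h + t).+1 h x))).
    by apply: continuous_comp; [exact: continuous_subrow|exact: c1].
  by apply: continuous_comp; [exact: continuous_subrow|exact: c2].
have bg : bounded_by 1 g.
  by move=> x; rewrite normrM -[leRHS]mulr1 ler_pM.
have subX0 w : subrow t 0 (window X (-1) (h + t).+2 w) = WX 0 w.
  by rewrite subrow_window ?add0n ?ltnS ?leq_addl// addrC.
have subY0 w : subrow t 0 (window Y (-1) (h + t).+2 w) = WY 0 w.
  by rewrite subrow_window ?add0n ?ltnS ?leq_addl// addrC.
have E x : Ex_on x (fun w => f1 (x^-1 *: WX 0 w) * f2 (x^-1 *: WX h w)) / tailp X x =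
    Ex_on x (fun w => g (x^-1 *: window X (-1) (h + t).+2 w)) / tailp X x.
  congr (_ / _); rewrite /Ex_on; congr Ex; apply/funext => w.
  by rewrite /g !subrowZ subX0 subrowX.
under eq_fun do rewrite E.
have -> : Ex Q (fun w => f1 (WY 0 w) * f2 (WY h w)) = Ex Q (fun w => g (window Y (-1) (h + t).+2 w)).
  by congr Ex; apply/funext => w; rewrite /g subY0 subrowY.
exact: weak_tail cg bg.
Qed.

Lemma weak_tail_window (f : 'rV[R]_t.+2 -> R) h : continuous f -> bounded_by 1 f ->
  Ex_on x (fun w => f (x^-1 *: WX h w)) / tailp X x @[x --> +oo] --> Ex Q (fun w => f (WY h w)).
Proof.
move=> cf bf.
have c1 : continuous (fun _ : 'rV[R]_t.+2 => 1 : R) by exact: cst_continuous.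
have b1 : bounded_by 1 (fun _ : 'rV[R]_t.+2 => 1 : R) by move=> x; rewrite normr1.
have := @weak_tail_prod _ _ h c1 cf b1 bf.
have -> : (fun w => 1 * f (WY h w)) = (fun w => f (WY h w)) by apply/funext => w; rewrite mul1r.
have E x : Ex_on x (fun w => 1 * f (x^-1 *: WX h w)) / tailp X x =
           Ex_on x (fun w => f (x^-1 *: WX h w)) / tailp X x.
  by congr (Ex_on _ _ / _); apply/funext => w; rewrite mul1r.
by under eq_fun do rewrite E.
Qed.

(** The tail process is not stationary, but the event that a late window lies in
   a closed set of points with time coordinate at least one can be moved back to
   the window at time zero, at the cost of a constant: a stationary process
   exceeding a slightly lower threshold at the late time is no more likely than
   one doing so at time zero. *)
Lemma null_shift (G : set 'rV[R]_t.+2) h : closed G ->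
  (forall g, G g -> 1 <= g ord0 (inord 1)) ->
  Q (WY 0 @^-1` G) = 0%E -> Q (WY h @^-1` G) = 0%E.
Proof.
move=> cG G1 Q0.
have bG : borel_set G by exact: borel_closed.
have mWY k : measurable (WY k @^-1` G).
  by apply: measurable_rV_preimage => //; exact: measurable_window.
have [K K0 ratio] := tailp_ratio.
pose c (k : nat) : R := 1 - k.+2%:R^-1.
pose a k := Ex Q (fun w => cutoff G k.+2 (WY h w)).
pose e k := Ex Q (fun w => cutoff G k.+2 (c k *: WY 0 w)).
have c2 k : 2^-1 <= c k <= 1.
  rewrite /c; have : k.+2%:R^-1 <= 2^-1 :> R by rewrite lef_pV2 ?posrE// ler_nat.
  have : 0 <= k.+2%:R^-1 :> R by [].
  move: (k.+2%:R^-1 : R) => i i0 i2.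
  by apply/andP; split; lra.
have cutc k : continuous (cutoff G k.+2) by exact: cutoff_continuous.
have cutb k : bounded_by 1 (cutoff G k.+2) by exact: cutoff_bounded.
have qa k : Pr Q (WY h @^-1` G) <= a k.
  rewrite -Ex_indic// /a; apply: le_Ex; first exact: bounded_mfun_indic.
    by apply: (bounded_mfun_comp _ (cutc k) (cutb k)); exact: measurable_window.
  move=> w; rewrite indicE; case: (boolP (w \in _)) => [|_]; last exact: cutoff_ge0.
  by rewrite inE /= => Gw; rewrite cutoff1.
have ae k : a k <= K * e k.
  have ck0 : 0 < c k by have /andP[h1 _] := c2 k; apply: lt_le_trans h1.
  have cg2 : continuous (fun x : 'rV[R]_t.+2 => cutoff G k.+2 (c k *: x)).
    by move=> x; apply: (@continuous_comp _ _ _ (fun x : 'rV[R]_t.+2 => c k *: x) (cutoff G k.+2)); [exact: scaler_continuous|exact: cutc].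
  have L : Ex_on x (fun w => cutoff G k.+2 (x^-1 *: WX h w)) / tailp X x @[x --> +oo] --> a k.
    exact: weak_tail_window.
  pose r y := Ex_on y (fun w => cutoff G k.+2 (c k *: (y^-1 *: WX 0 w))) / tailp X y.
  have Rc : r y @[y --> +oo] --> e k.
    exact: (@weak_tail_window _ 0 cg2 (fun x => cutb k _)).
  have L' : Ex_on ((c k)^-1 * y) (fun w => cutoff G k.+2 (((c k)^-1 * y)^-1 *: WX h w)) /
      tailp X ((c k)^-1 * y) @[y --> +oo] --> a k.
    apply: (cvg_comp (fun y => (c k)^-1 * y) _ _ L).
    by apply: gt0_cvgMry; [rewrite invr_gt0|exact: cvg_id].
  have RK : K * r y @[y --> +oo] --> K * e k by exact: (cvgMl_tmp Rc).
  apply: (ler_cvg_to L' RK).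
  near=> y; rewrite /r.
  have y0 : 0 < y by near: y; exact: nbhs_pinfty_gt.
  set x := (c k)^-1 * y.
  have x0 : 0 < x by rewrite mulr_gt0 ?invr_gt0.
  have xc : x^-1 = c k * y^-1 by rewrite /x invfM invrK.
  have yx : y = c k * x by rewrite /x mulrA divff ?mul1r// gt_eqF.
  have x2y : x <= 2 * y.
    by rewrite yx; have /andP[? _] := c2 k; nra.
  have py : tailp X y <= K * tailp X x.
    have : tailp X y <= K * tailp X (2 * y) by near: y.
    move=> h1; apply: le_trans h1 _; rewrite ler_wpM2l ?(ltW K0)//; exact: le_tailp.
  have cx : continuous (fun v : 'rV[R]_t.+2 => cutoff G k.+2 (x^-1 *: v)).
    by move=> v; apply: (@continuous_comp _ _ _ (fun v : 'rV[R]_t.+2 => x^-1 *: v) (cutoff G k.+2)); [exact: scaler_continuous|exact: cutc].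
  have bx : bounded_mfun ((fun v : 'rV[R]_t.+2 => cutoff G k.+2 (x^-1 *: v)) : borelRn R t.+2 -> R).
    by split; [exact: continuous_borelRn|exists 1 => v; exact: cutb].
  have bw j : bounded_mfun (fun w => cutoff G k.+2 (x^-1 *: WX j w)).
    by apply: (bounded_mfun_comp _ cx (fun v => cutb k _)); exact: measurable_window.
  have h1 : Ex_on x (fun w => cutoff G k.+2 (x^-1 *: WX h w)) <=
            Ex_on y (fun w => cutoff G k.+2 (c k *: (y^-1 *: WX 0 w))).
    apply: (@le_trans _ _ (Ex P (fun w => cutoff G k.+2 (x^-1 *: WX h w)))).
      apply: le_Ex; [exact: bounded_mfun_on|exact: bw|move=> w].
      by rewrite indicE; case: (_ \in _); rewrite ?mul1r ?mul0r ?cutoff_ge0.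
    rewrite (Ex_window_shift stat _ bx) -(Ex_window_shift stat (0%:Z - 1) bx).
    apply: le_Ex; first exact: bw.
      apply: bounded_mfun_on; apply: (bounded_mfun_comp _ cg2 (fun v => cutb k _)).
      exact: measurable_scaled_window.
    move=> w; rewrite scalerA -xc indicE.
    have [->|nz] := eqVneq (cutoff G k.+2 (x^-1 *: WX 0 w)) 0; first by rewrite mulr0.
    rewrite mem_set ?mul1r//.
    have [g Gg] := cutoff_near nz.
    rewrite -[X in X < _]/(mx_norm _) mx_normrE => /bigmax_ltP[_ /(_ (ord0, inord 1) isT)] /=.
    rewrite !mxE inordK// sub0r (_ : - 1 + 1%N%:Z = 0)//.
    have := G1 g Gg => g1; rewrite ltr_norml => /andP[lo _].
    have : c k < x^-1 * X 0 w by rewrite /c; move: lo g1; move: (k.+2%:R^-1 : R) => i lo g1; lra.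
    by rewrite ltr_pdivlMl// => lx; rewrite /exceeds /= yx mulrC.
  rewrite ler_pdivrMr//.
  apply: le_trans h1 _; set E := Ex_on y _.
  have E0 : 0 <= E.
    by apply: Ex_ge0 => w; rewrite mulr_ge0 ?cutoff_ge0.
  have -> : K * (E / tailp X y) * tailp X x = E / tailp X y * (K * tailp X x) by ring.
  rewrite -[leLHS](divfK (lt0r_neq0 (p_gt0 y))) ler_wpM2l// divr_ge0// ltW//.
have e0 : e k @[k --> \oo] --> (0 : R).
  pose f k w := cutoff G k.+2 (c k *: WY 0 w) * \1_(~` (WY 0 @^-1` G)) w.
  have ck1 : c k @[k --> \oo] --> (1 : R).
    rewrite -[X in _ --> X]subr0; apply: cvgB; first exact: cvg_cst.
    by have := @cvg_harmonic R; rewrite -cvg_shiftS.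
  have mN : measurable (~` (WY 0 @^-1` G)) by exact: measurableC.
  have bcW k : bounded_mfun (fun w => cutoff G k.+2 (c k *: WY 0 w)).
    split; last by exists 1 => w; exact: cutb.
    by apply: measurable_rV_comp (cutc k); exact: measurable_scaled_window.
  have bf k : bounded_mfun (f k) by apply: bounded_mfunM => //; exact: bounded_mfun_indic.
  have f0 : Ex Q (f k) @[k --> \oo] --> Ex Q (fun=> 0).
    apply: (@Ex_cvg _ _ _ _ _ _ 1).
    - by move=> k; have [] := bf k.
    - move=> k w; rewrite normrM -[leRHS]mulr1 ler_pM//; first exact: cutb.
      by rewrite indicE; case: (_ \in _); rewrite ?normr1 ?normr0.
    - move=> w; have [Gw|nGw] := pselect (G (WY 0 w)).
        under eq_fun do rewrite /f indicE memNset ?mulr0 //; first exact: cvg_cst.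
      under eq_fun do rewrite /f indicE mem_set // mulr1.
      have sc : c k *: WY 0 w @[k --> \oo] --> WY 0 w.
        by rewrite -[X in _ --> X]scale1r; apply: cvgZr_tmp.
      exact: (cutoff_cvg0 cG nGw leqnSn sc).
  rewrite Ex_cst in f0; apply: (squeeze_cvgr _ (cvg_cst 0) f0).
  - near=> k; apply/andP; split; first by apply: Ex_ge0 => w; exact: cutoff_ge0.
    have G0 : Ex Q (\1_(WY 0 @^-1` G) : T' -> R) = 0 by rewrite Ex_indic// /Pr Q0.
    have bi := @bounded_mfun_indic _ T' R _ (mWY 0%N).
    apply: (@le_trans _ _ (Ex Q (fun w => f k w + \1_(WY 0 @^-1` G) w))); last first.
      by rewrite (ExD _ (bf k) bi) G0 addr0.
    apply: le_Ex; [exact: bcW|exact: bounded_mfunD|].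
    move=> w; rewrite /f !indicE in_setC; case: (_ \in _) => /=.
      by rewrite mulr0 [leRHS]add0r; exact: cutoff_le1.
    by rewrite mulr1 [leRHS]addr0.
rewrite Pr_fin//; congr EFin; apply/eqP; rewrite eq_le Pr_ge0 andbT.
have : K * e k @[k --> \oo] --> K * 0 by exact: cvgMl_tmp.
rewrite mulr0 => Ke; apply: (cvgr_to_ge Ke); apply: nearW => k.
exact: le_trans (qa k) (ae k).
Unshelve. all: end_near. Qed.

(** The indicators are squeezed between continuous functions supported near the closure
   and inside the interior.  The gap is governed by the boundaries, which the tail
   process does not charge: for the late window this is [null_shift]. *)
Lemma joint_limit (A B : set 'rV[R]_t.+2) h : borel_set A -> borel_set B ->
  A `<=` @evt_domain R t -> B `<=` @evt_domain R t ->
  Q (WY 0 @^-1` boundary A) = 0%E -> Q (WY 0 @^-1` boundary B) = 0%E ->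
  Pr P (WX 0 @^-1` scaled_set x A `&` WX h @^-1` scaled_set x B) / tailp X x @[x --> +oo] -->
  Pr Q (WY 0 @^-1` A `&` WY h @^-1` B).
Proof.
move=> bA bB dA dB nA nB.
have nBh : Q (WY h @^-1` boundary B) = 0%E.
  apply: null_shift nB; first exact: closed_boundary.
  move=> g [clB _].
  have c1 : closed [set y : 'rV[R]_t.+2 | 1 <= y ord0 (inord 1)].
    apply: (@closed_comp _ _ (fun y : 'rV[R]_t.+2 => y ord0 (inord 1)) [set y | 1 <= y]).
      by move=> y _; exact: coord_continuous.
    exact: closed_ge.
  apply: (c1 g); apply: closure_subset clB => y /dB /(_ (inord 1)).
  by rewrite inordK// => /ltW.
have mW j (D : set 'rV[R]_t.+2) : borel_set D -> measurable (WY j @^-1` D).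
  by apply: measurable_rV_preimage; exact: measurable_window.
pose U (D : set 'rV[R]_t.+2) k y := cutoff (closure D) k.+1 y.
pose L (D : set 'rV[R]_t.+2) k y := 1 - cutoff (~` D^°) k.+1 y.
have Uc D k : continuous (U D k) by exact: cutoff_continuous.
have Lc D k : continuous (L D k).
  by move=> y; apply: continuousB; [exact: cst_continuous|exact: cutoff_continuous].
have Ub D k : bounded_by 1 (U D k) by exact: cutoff_bounded.
have L01 D k y : 0 <= L D k y <= 1.
  by rewrite /L subr_ge0 cutoff_le1 gerBl cutoff_ge0.
have U01 D k y : 0 <= U D k y <= 1 by rewrite /U cutoff_ge0 cutoff_le1.
have Lb D k : bounded_by 1 (L D k) by move=> y; have /andP[? ?] := L01 D k y; rewrite ger0_norm.
have LD D k y : ~ D y -> L D k y = 0.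
  by move=> nDy; rewrite /L cutoff1 ?subrr// => /interior_subset.
have UD D k y : D y -> U D k y = 1 by move=> Dy; rewrite /U cutoff1//; exact: subset_closure.
pose eU k := Ex Q (fun w => U A k (WY 0 w) * U B k (WY h w)).
pose eL k := Ex Q (fun w => L A k (WY 0 w) * L B k (WY h w)).
pose q := Pr Q (WY 0 @^-1` A `&` WY h @^-1` B).
have mQ j (f : 'rV[R]_t.+2 -> R) : continuous f -> bounded_by 1 f -> bounded_mfun (fun w => f (WY j w)).
  by move=> cf bf; apply: (bounded_mfun_comp _ cf bf); exact: measurable_window.
have mcl (D : set 'rV[R]_t.+2) : borel_set (closure D) by apply: borel_closed; exact: closed_closure.
have min (D : set 'rV[R]_t.+2) : borel_set (D^°) by apply: borel_open; exact: open_interior.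
have mbd (D : set 'rV[R]_t.+2) : borel_set (boundary D) by apply: borel_closed; exact: closed_boundary.
have nullPr j D : Q (WY j @^-1` boundary D) = 0%E -> Pr Q (WY j @^-1` boundary D) = 0.
  by rewrite /Pr => ->.
have prod01 (a b : R) : `|a| <= 1 -> `|b| <= 1 -> `|a * b| <= 1.
  by move=> a1 b1; rewrite normrM -[leRHS]mulr1 ler_pM.
pose iD j (D : set 'rV[R]_t.+2) w : R := \1_D (WY j w).
have iDE j D : iD j D = \1_(WY j @^-1` D) by [].
have biD j D : borel_set D -> bounded_mfun (iD j D).
  by move=> bD; rewrite iDE; apply: bounded_mfun_indic; exact: mW.
have qE : q = Ex Q (fun w => iD 0%N A w * iD h B w).
  rewrite /q -Ex_indic; last by apply: measurableI; exact: mW.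
  by congr Ex; apply/funext => w; rewrite indicI.
have i01 (D : set 'rV[R]_t.+2) y : `|\1_D y : R| <= 1.
  by rewrite indicE; case: (_ \in _); rewrite ?normr1 ?normr0.
have same (D D' : set 'rV[R]_t.+2) : borel_set D -> borel_set D' ->
    (forall y, `|(\1_D y : R) - \1_A y| <= \1_(boundary A) y) ->
    (forall y, `|(\1_D' y : R) - \1_B y| <= \1_(boundary B) y) ->
    Ex Q (fun w => iD 0%N D w * iD h D' w) = q.
  move=> bD bD' DE DE'; rewrite qE; apply/eqP; rewrite -subr_eq0 -normr_le0.
  have b1 := bounded_mfunM (biD 0%N _ bD) (biD h _ bD').
  have b2 := bounded_mfunM (biD 0%N _ bA) (biD h _ bB).
  rewrite -ExB//; apply: le_trans (le_norm_Ex _ (bounded_mfunB b1 b2)) _.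
  have bb := biD 0%N _ (mbd A); have bb' := biD h _ (mbd B).
  apply: (@le_trans _ _ (Ex Q (fun w => iD 0%N (boundary A) w + iD h (boundary B) w))).
    apply: le_Ex; [exact/bounded_mfun_norm/bounded_mfunB|exact: bounded_mfunD|].
    move=> w; rewrite /iD; have := DE (WY 0 w); have := DE' (WY h w).
    have := i01 A (WY 0 w); have := i01 D' (WY h w).
    move: (\1_D _) (\1_A _) (\1_D' _) (\1_B _) => a b c e c1 b1' h1 h2.
    rewrite (_ : a * c - b * e = (a - b) * c + b * (c - e)); last by ring.
    rewrite (le_trans (ler_normD _ _))// lerD// normrM.
      by rewrite (le_trans _ h2)// ler_piMr.
    by rewrite (le_trans _ h1)// ler_piMl.
  rewrite ExD// !iDE !Ex_indic; [|exact: mW..].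
  by rewrite !nullPr// addr0.
have closureE (D : set 'rV[R]_t.+2) y : `|(\1_(closure D) y : R) - \1_D y| <= \1_(boundary D) y.
  have [Dy|nDy] := pselect (D y).
    have cDy := @subset_closure _ D y Dy.
    by rewrite !indicE (mem_set Dy) (mem_set cDy) subrr normr0.
  rewrite [\1_D y]indicE memNset// subr0 indicE.
  have [cDy|ncDy] := pselect (closure D y); last by rewrite memNset// normr0.
  rewrite mem_set// normr1 indicE mem_set//; split => // /interior_subset.
  exact: nDy.
have interiorE (D : set 'rV[R]_t.+2) y : `|(\1_(D^°) y : R) - \1_D y| <= \1_(boundary D) y.
  have [nDy|iDy] := pselect (~ (D^°) y); last first.
    have {}iDy := contrapT iDy; have Dy := interior_subset iDy.
    by rewrite !indicE (mem_set Dy) (mem_set iDy) subrr normr0.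
  rewrite indicE memNset// sub0r normrN indicE.
  have [Dy|nD] := pselect (D y); last by rewrite memNset// normr0.
  by rewrite mem_set// normr1 indicE mem_set//; split => //; exact: subset_closure.
have Ucvg D y : U D k y @[k --> \oo] --> (\1_(closure D) y : R).
  have [cy|ncy] := pselect (closure D y).
    rewrite indicE mem_set//; apply: cvg_near_cst; apply: nearW => k.
    by rewrite /U cutoff1.
  rewrite indicE memNset//.
  exact: (cutoff_cvg0 (@closed_closure _ D) ncy leqnn (cvg_cst y)).
have Lcvg D y : L D k y @[k --> \oo] --> (\1_(D^°) y : R).
  have [iy|niy] := pselect ((D^°) y); last first.
    rewrite indicE memNset//; apply: cvg_near_cst; apply: nearW => k.
    by rewrite /L cutoff1// subrr.
  rewrite indicE mem_set// -[X in _ --> X]subr0; apply: cvgB; first exact: cvg_cst.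
  have cI : closed (~` D^°) by apply: open_closedC; exact: open_interior.
  by apply: (cutoff_cvg0 cI _ leqnn (cvg_cst y)) => /(_ iy).
have eUq : eU k @[k --> \oo] --> q.
  rewrite -(same _ _ (mcl A) (mcl B) (closureE A) (closureE B)).
  apply: (@Ex_cvg _ _ _ _ _ _ 1).
  - by move=> k; have [] := bounded_mfunM (mQ 0%N _ (Uc A k) (Ub A k)) (mQ h _ (Uc B k) (Ub B k)).
  - by move=> k w; apply: prod01; exact: Ub.
  - by move=> w; apply: cvgM; exact: Ucvg.
have eLq : eL k @[k --> \oo] --> q.
  rewrite -(same _ _ (min A) (min B) (interiorE A) (interiorE B)).
  apply: (@Ex_cvg _ _ _ _ _ _ 1).
  - by move=> k; have [] := bounded_mfunM (mQ 0%N _ (Lc A k) (Lb A k)) (mQ h _ (Lc B k) (Lb B k)).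
  - by move=> k w; apply: prod01; exact: Lb.
  - by move=> w; apply: cvgM; exact: Lcvg.
apply/cvgrPdist_le => e e0.
have e20 : 0 < e / 2 by rewrite divr_gt0.
have [k [kU kL]] : exists k, `|q - eU k| <= e / 2 /\ `|q - eL k| <= e / 2.
  move/cvgrPdist_le : eUq => /(_ _ e20)[k1 _ H1].
  move/cvgrPdist_le : eLq => /(_ _ e20)[k2 _ H2].
  by exists (maxn k1 k2); split; [apply: H1; exact: leq_maxl|apply: H2; exact: leq_maxr].
have wU := weak_tail_prod (h:=h) (Uc A k) (Uc B k) (Ub A k) (Ub B k).
have wL := weak_tail_prod (h:=h) (Lc A k) (Lc B k) (Lb A k) (Lb B k).
move/cvgrPdist_le : wU => /(_ _ e20) wU; move/cvgrPdist_le : wL => /(_ _ e20) wL.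
near=> x.
have x0 : 0 < x by near: x; exact: nbhs_pinfty_gt.
have HU : `|eU k - Ex_on x (fun w => U A k (x^-1 *: WX 0 w) * U B k (x^-1 *: WX h w)) / tailp X x| <= e / 2.
  by near: x.
have HL : `|eL k - Ex_on x (fun w => L A k (x^-1 *: WX 0 w) * L B k (x^-1 *: WX h w)) / tailp X x| <= e / 2.
  by near: x.
have scE j (D : set 'rV[R]_t.+2) w : (WX j @^-1` scaled_set x D) w <-> D (x^-1 *: WX j w).
  rewrite /scaled_set /=; split => [[a Da <-]|Dw].
    by rewrite scalerA mulVf ?scale1r// gt_eqF.
  by exists (x^-1 *: WX j w) => //; rewrite scalerA divff ?scale1r// gt_eqF.
have mX j (D : set 'rV[R]_t.+2) : borel_set D -> measurable (WX j @^-1` scaled_set x D).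
  move=> bD; rewrite (_ : _ @^-1` _ = (fun w => x^-1 *: WX j w) @^-1` D).
    by apply: measurable_rV_preimage => //; exact: measurable_scaled_window.
  by apply/seteqP; split => w /scE.
set ev := _ @^-1` scaled_set _ _ `&` _.
have mev : measurable ev by apply: measurableI; exact: mX.
have bX (f g : 'rV[R]_t.+2 -> R) : continuous f -> continuous g -> bounded_by 1 f -> bounded_by 1 g ->
    bounded_mfun (fun w => (\1_(exceeds X x) w : R) * (f (x^-1 *: WX 0 w) * g (x^-1 *: WX h w))).
  move=> cf cg bf bg; apply: bounded_mfun_on; apply: bounded_mfunM.
    by apply: (bounded_mfun_comp _ cf bf); exact: measurable_scaled_window.
  by apply: (bounded_mfun_comp _ cg bg); exact: measurable_scaled_window.
have upper : Pr P ev <= Ex_on x (fun w => U A k (x^-1 *: WX 0 w) * U B k (x^-1 *: WX h w)).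
  rewrite -Ex_indic//; apply: le_Ex; [exact: bounded_mfun_indic|exact: bX|move=> w].
  rewrite indicE; case: (boolP (w \in ev)) => [|_]; last first.
    have /andP[u0 _] := U01 A k (x^-1 *: WX 0 w); have /andP[u0' _] := U01 B k (x^-1 *: WX h w).
    by rewrite mulr_ge0// mulr_ge0.
  rewrite inE => -[/scE wA /scE wB]; rewrite !UD// mulr1 mulr1 indicE mem_set//.
  have := dA _ wA (inord 1); rewrite inordK//= !mxE inordK// sub0r (_ : - 1 + 1%N%:Z = 0)//.
  by rewrite ltr_pdivlMl// mulr1.
have lower : Ex_on x (fun w => L A k (x^-1 *: WX 0 w) * L B k (x^-1 *: WX h w)) <= Pr P ev.
  rewrite -Ex_indic//; apply: le_Ex; [exact: bX|exact: bounded_mfun_indic|move=> w].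
  have /andP[a0 a1] := L01 A k (x^-1 *: WX 0 w); have /andP[b0 b1] := L01 B k (x^-1 *: WX h w).
  have /andP[x0' x1] : 0 <= (\1_(exceeds X x) w : R) <= 1 by rewrite indicE; case: (_ \in _); rewrite ?lexx ?ler01.
  rewrite [in leRHS]indicE; case: (boolP (w \in ev)) => [_|].
    exact: (mulr_ile1 x0' (mulr_ge0 a0 b0) x1 (mulr_ile1 a0 b0 a1 b1)).
  rewrite notin_setE => nev.
  have [wA|nA'] := pselect (A (x^-1 *: WX 0 w)); last by rewrite (LD A)// mul0r mulr0.
  have [wB|nB'] := pselect (B (x^-1 *: WX h w)); last by rewrite (LD B)// mulr0 mulr0.
  by exfalso; apply: nev; split; apply/scE.
have px := p_gt0 x.
have upper' : Pr P ev / tailp X x <= Ex_on x (fun w => U A k (x^-1 *: WX 0 w) * U B k (x^-1 *: WX h w)) / tailp X x.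
  by rewrite ler_pM2r// invr_gt0.
have lower' : Ex_on x (fun w => L A k (x^-1 *: WX 0 w) * L B k (x^-1 *: WX h w)) / tailp X x <= Pr P ev / tailp X x.
  by rewrite ler_pM2r// invr_gt0.
move: HU HL kU kL upper' lower'; rewrite -/q.
move: (Ex_on x _ / _) (Ex_on x _ / _) (Pr P ev / _) (eU k) (eL k) (q) => r1 r2 r3 r4 r5 r6.
rewrite !ler_norml => /andP[? ?] /andP[? ?] /andP[? ?] /andP[? ?] ? ?.
by apply/andP; split; lra.
Unshelve. all: end_near. Qed.

End tail_process.

(** * Covariances of the exceedance indicators *)

Section exceedance_covariance.
Context {R : realType} {d : measure_display} {T : measurableType d}.
Variables (P : probability T R) (X : int -> {RV P >-> R}).
Hypothesis stat : strictly_stationary X.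

Lemma borel_scaled_set n x (A : set 'rV[R]_n) : borel_set A -> borel_set (scaled_set x A).
Proof.
move=> bA; have [->|x0] := eqVneq x 0; last first.
  have mV : measurable_coords ((fun y => x^-1 *: y) : borelRn R n -> 'rV[R]_n).
    move=> i; under eq_fun do rewrite mxE.
    by apply: measurable_funM => //; exact: measurable_coord.
  have := measurable_rV_preimage mV bA; rewrite /measurable/= /borel_set.
  congr (<<s _ >> _); apply/seteqP; split => y /=.
    by move=> Ay; exists (x^-1 *: y) => //; rewrite scalerA divff// scale1r.
  by move=> [a Aa <-]; rewrite scalerA mulVf// scale1r.
(* The degenerate scaling collapses the set to the origin or to nothing. *)
apply: borel_closed.
have [->|/set0P[a Aa]] := eqVneq A set0; first by rewrite /scaled_set image_set0; exact: closed0.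
have -> : scaled_set 0 A = \bigcap_(i in [set: 'I_n]) [set y : 'rV[R]_n | y ord0 i = 0].
  apply/seteqP; split => [_ [b _ <-] i _|y y0]; first by rewrite /= scale0r mxE.
  by exists a => //; rewrite scale0r; apply/rowP => i; rewrite mxE -(y0 i I).
apply: closed_bigI => i _.
apply: (@closed_comp _ _ (fun y : 'rV[R]_n => y ord0 i) [set y | y = 0]).
  by move=> y _; exact: coord_continuous.
exact: closed_eq.
Qed.

Variable t : nat.
Implicit Types (A B : set 'rV[R]_t.+2) (x : R) (h : nat).

(** The window starts one step before time [h], so that a hit of a subset of
   [evt_domain] is an exceedance at time [h]. *)
Definition hit x A h : set T := window X (h%:Z - 1) t.+2 @^-1` scaled_set x A.

Definition hit_cov x A B h : R :=
  Pr P (hit x A 0 `&` hit x B h) - Pr P (hit x A 0) * Pr P (hit x B 0).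

Definition exceed_twice x h : R := Pr P (exceeds X x `&` [set w | x < X h%:Z w]).

Lemma measurable_hit x A h : borel_set A -> measurable (hit x A h).
Proof.
move=> bA; apply: measurable_rV_preimage; first exact: measurable_window.
by exact: borel_scaled_set.
Qed.

Lemma Pr_window_shift n (D : set 'rV[R]_n) s s' : borel_set D ->
  Pr P (window X s n @^-1` D) = Pr P (window X s' n @^-1` D).
Proof.
move=> bD; have := stat (fun i : 'I_n => s' + (i : nat)%:Z) (s - s') bD.
rewrite /Pr /window => <-; congr fine; congr (P _).
suff -> : (fun i : 'I_n => s' + (i : nat)%:Z + (s - s')) = (fun i => s + (i : nat)%:Z) by [].
by apply/funext => i; ring.
Qed.

Lemma Pr_hit x A h : borel_set A -> Pr P (hit x A h) = Pr P (hit x A 0).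
Proof.
by move=> bA; apply: Pr_window_shift; exact: borel_scaled_set.
Qed.

Lemma hit_exceeds x A h : 0 < x -> A `<=` @evt_domain R t ->
  hit x A h `<=` [set w | x < X h%:Z w].
Proof.
move=> x0 dA w [a Aa ax]; have := dA _ Aa (inord 1); rewrite inordK//= => a1.
have : (window X (h%:Z - 1) t.+2 w) ord0 (inord 1) = X h%:Z w.
  by rewrite mxE inordK// subrK.
by rewrite -ax mxE => <-; rewrite ltr_pMr.
Qed.

Let borel_gt x : borel_set [set y : 'rV[R]_1 | x < y ord0 ord0].
Proof.
apply: borel_open.
apply: (@open_comp _ _ (fun y : 'rV[R]_1 => y ord0 ord0) [set z | x < z]).
  by move=> y _; exact: coord_continuous.
exact: open_gt.
Qed.

Lemma Pr_gt x k : Pr P [set w | x < X k w] = tailp X x.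
Proof.
have b1 := borel_gt x.
have := Pr_window_shift k 0 b1; rewrite /tailp /exceeds.
have E s : window X s 1 @^-1` [set y | x < y ord0 ord0] = [set w | x < X s w].
  by apply/seteqP; split => w; rewrite /= mxE addr0.
by rewrite !E.
Qed.

Lemma Pr_hit_le x A h : 0 < x -> borel_set A -> A `<=` @evt_domain R t ->
  Pr P (hit x A h) <= tailp X x.
Proof.
move=> x0 bA dA; rewrite -(Pr_gt x h%:Z); apply: le_Pr; first exact: measurable_hit.
  exact: measurable_gt.
exact: hit_exceeds.
Qed.

Lemma hit_cov_le x A B h : 0 < x -> borel_set A -> borel_set B ->
  A `<=` @evt_domain R t -> B `<=` @evt_domain R t ->
  `|hit_cov x A B h| <= exceed_twice x h + tailp X x ^+ 2.
Proof.
move=> x0 bA bB dA dB.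
have mA := measurable_hit x 0%N bA; have mB := measurable_hit x h bB.
apply: le_trans (ler_normB _ _) _; rewrite !ger0_norm ?mulr_ge0 ?Pr_ge0//.
apply: lerD; last by rewrite expr2 ler_pM ?Pr_ge0// Pr_hit_le.
apply: le_Pr; first exact: measurableI.
  by apply: measurableI; exact: measurable_gt.
by move=> w [/(hit_exceeds x0 dA) ? /(hit_exceeds x0 dB) ?].
Qed.

Lemma exceed_twice_le x h : exceed_twice x h <= tailp X x.
Proof.
apply: le_Pr; [apply: measurableI; exact: measurable_gt|exact: measurable_gt|].
by move=> w [].
Qed.

Lemma tailp_ge0 x : 0 <= tailp X x. Proof. exact: Pr_ge0. Qed.

Lemma tailp_le1 x : tailp X x <= 1.
Proof. by apply: Pr_le1; exact: measurable_gt. Qed.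

Lemma hit_cov_le2 x A B h : 0 < x -> borel_set A -> borel_set B ->
  A `<=` @evt_domain R t -> B `<=` @evt_domain R t ->
  `|hit_cov x A B h| <= 2 * tailp X x.
Proof.
move=> x0 bA bB dA dB; apply: le_trans (hit_cov_le h x0 bA bB dA dB) _.
have := exceed_twice_le x h; have := tailp_le1 x; have := tailp_ge0 x.
by move: (tailp X x) => p *; nra.
Qed.

Lemma exceed_twice_mixing x h : exceed_twice x h <= tailp X x ^+ 2 + mixing X h.
Proof.
have b1 := borel_gt x.
have := mixing_windows stat 0 h b1 b1; rewrite !addr0 add0r.
have E s : window X s 1 @^-1` [set y | x < y ord0 ord0] = [set w | x < X s w].
  by apply/seteqP; split => w; rewrite /= mxE addr0.
rewrite !E !Pr_gt -/(exceeds X x) -/(exceed_twice x h) -expr2 ler_norml.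
by move=> /andP[_]; rewrite lerBlDl.
Qed.

(** Windows of length [t + 2] at lag [t + 1 + h] leave a gap of [h]. *)
Lemma hit_cov_mixing x A B h : borel_set A -> borel_set B ->
  `|hit_cov x A B (t.+1 + h)| <= mixing X h.
Proof.
move=> bA bB.
have := mixing_windows stat (0%:Z - 1) h (borel_scaled_set x bA) (borel_scaled_set x bB).
rewrite /hit_cov -(Pr_hit x (t.+1 + h) bB) /hit.
by have -> : (0%:Z - 1 + t.+1%:Z + h%:Z) = (t.+1 + h)%:Z - 1 by lia.
Qed.

End exceedance_covariance.

Lemma ler_sum_lt (R : realDomainType) (f : nat -> R) k M a : (forall h, 0 <= f h) ->
  \sum_(k <= h < M) (if (h < a)%N then f h else 0) <= \sum_(k <= h < a) f h.
Proof.
move=> f0; rewrite -big_mkcond (@big_nat_widen _ _ _ _ M (maxn M a)) ?leq_maxl//.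
rewrite (@big_nat_widen _ _ _ _ a (maxn M a)) ?leq_maxr//.
rewrite big_mkcond [leRHS]big_mkcond; apply: ler_sum => h _ /=.
by case: (h < a)%N; case: (h < M)%N => /=.
Qed.

Lemma ler_sum_ge (R : realDomainType) (f : nat -> R) k M a : (forall h, 0 <= f h) ->
  \sum_(k <= h < M) (if (a <= h)%N then f h else 0) <= \sum_(a <= h < M) f h.
Proof.
move=> f0; rewrite -big_mkcond (@big_nat_widenl _ _ _ k (minn k a)) ?geq_minl//.
rewrite (@big_nat_widenl _ _ _ a (minn k a)) ?geq_minr//.
rewrite big_mkcond [leRHS]big_mkcond; apply: ler_sum => h _ /=.
by case: (a <= h)%N; case: (k <= h)%N => /=.
Qed.

Lemma limn_esup_lt (R : realType) (v : nat -> R) (e : R) :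
  (limn_esup (fun n => (v n)%:E) < e%:E)%E -> \forall n \near \oo, v n < e.
Proof.
rewrite limn_esup_lim (cvg_lim (@ereal_hausdorff R) (@cvg_esups_inf R (fun n => (v n)%:E))).
move=> /ereal_inf_lt[_ [N _ <-]] vN; exists N => // n /= Nn.
rewrite -lte_fin; apply: le_lt_trans vN; apply: ereal_sup_ubound.
by exists n.
Qed.

Section condition_M.
Context {R : realType} {d : measure_display} {T : measurableType d}.
Variables (P : probability T R) (X : int -> {RV P >-> R}).
Hypothesis stat : strictly_stationary X.
Variables (u : nat -> R) (r : nat -> nat).
Let p n := tailp X (u n).
Hypotheses (p_gt0 : forall x, 0 < tailp X x) (uoo : u n @[n --> \oo] --> +oo).
Hypothesis roo : (r n)%:R @[n --> \oo] --> (+oo : set_system R).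
Hypothesis rp : (r n)%:R * p n @[n --> \oo] --> (0 : R).
Hypothesis mixsum :
  ((p n)^-1%:E * \sum_(r n <= h <oo) (mixing X h)%:E)%E @[n --> \oo] --> 0%E.
Hypothesis anticluster :
  limn_esup (fun n => (\sum_(k <= h < (r n).+1)
      cond_Pr P [set w | u n < X h%:Z w] (exceeds X (u n)))%:E) @[k --> \oo] --> 0%E.

Lemma tailp_cvg0 : p n @[n --> \oo] --> (0 : R).
Proof.
apply: (squeeze_cvgr _ (cvg_cst 0) rp); near=> n.
rewrite tailp_ge0/= ler_peMl ?tailp_ge0//.
by near: n; move/cvgryPge : roo; exact.
Unshelve. all: end_near. Qed.

Let mix_small e : 0 < e ->
  \forall n \near \oo, forall M, \sum_(r n <= h < M) mixing X h <= e * p n.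
Proof.
move=> e0; move: mixsum => /fine_cvgP[fn] /cvgrPdist_le/(_ _ e0) H.
near=> n => M.
have pn : 0 < p n := p_gt0 (u n).
have fnn : ((p n)^-1%:E * \sum_(r n <= h <oo) (mixing X h)%:E)%E \is a fin_num by near: n.
have : `|0 - fine ((p n)^-1%:E * \sum_(r n <= h <oo) (mixing X h)%:E)%E| <= e by near: n.
rewrite sub0r normrN => h; have {h} := le_trans (ler_norm _) h.
rewrite -lee_fin fineK// => h.
rewrite -ler_pdivrMr// mulrC -lee_fin; apply: le_trans h.
rewrite EFinM lee_pmul2l ?lte_fin ?invr_gt0// -sumEFin.
by apply: nneseries_lim_ge => i _ _; rewrite lee_fin mixing_ge0.
Unshelve. all: end_near. Qed.

Let anticluster_small e : 0 < e -> exists k0, forall k, (k0 <= k)%N ->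
  \forall n \near \oo, \sum_(k <= h < (r n).+1) exceed_twice X (u n) h < e * p n.
Proof.
move=> e0; move: anticluster => /fine_cvgP[[k1 _ H1] /cvgrPdist_lt/(_ _ e0)[k2 _ H2]].
exists (maxn k1 k2) => k; rewrite geq_max => /andP[k1k k2k].
have fk := H1 k k1k; have := H2 k k2k; rewrite /= sub0r normrN => /(le_lt_trans (ler_norm _)).
rewrite -lte_fin fineK// => /limn_esup_lt; apply: filterS => n.
move=> He; rewrite -ltr_pdivrMr; last exact: p_gt0.
rewrite mulr_suml; apply: le_lt_trans He; rewrite le_eqVlt; apply/orP; left; apply/eqP.
by apply: eq_bigr => h _; rewrite /cond_Pr /exceed_twice setIC.
Qed.

Variable t : nat.
Implicit Types (A B : set 'rV[R]_t.+2).

(** Beyond a fixed lag the covariances are summable to a small multiple of the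
   tail probability: lags up to [r n] are controlled by the anticlustering part of
   the condition, larger ones by mixing. *)
Lemma hit_cov_tail A B e : borel_set A -> borel_set B ->
  A `<=` @evt_domain R t -> B `<=` @evt_domain R t -> 0 < e ->
  exists k0, forall k, (k0 <= k)%N -> \forall n \near \oo, forall M,
    \sum_(k <= h < M) `|hit_cov X (u n) A B h| <= e * p n.
Proof.
move=> bA bB dA dB e0; have e40 : 0 < e / 4 by rewrite divr_gt0.
have [k0 H] := anticluster_small e40.
exists k0 => k k0k; have {}H := H k k0k.
have small : \forall n \near \oo, ((r n)%:R + t.+2%:R) * (2 * p n) <= e / 4.
  have c : ((r n)%:R + t.+2%:R) * (2 * p n) @[n --> \oo] --> (0 : R).
    have E n : ((r n)%:R + t.+2%:R) * (2 * p n) = 2 * ((r n)%:R * p n) + (t.+2%:R * 2) * p n by ring.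
    under eq_fun do rewrite E.
    have -> : (0 : R) = 2 * 0 + (t.+2%:R * 2) * 0 by rewrite !mulr0 addr0.
    by apply: cvgD; apply: cvgMl_tmp => //; exact: tailp_cvg0.
  by apply: (cvgr_le _ c).
near=> n => M.
have u0 : 0 < u n by near: n; move/cvgryPgt : uoo; exact.
have pn : 0 < p n := p_gt0 (u n).
have Ha : \sum_(k <= h < (r n).+1) exceed_twice X (u n) h < e / 4 * p n by near: n.
have Hm : forall M, \sum_(r n <= h < M) mixing X h <= e / 4 * p n.
  by near: n; exact: mix_small.
have Hs : ((r n)%:R + t.+2%:R) * (2 * p n) <= e / 4 by near: n.
have et0 h : 0 <= exceed_twice X (u n) h by exact: Pr_ge0.
pose f1 h := if (h < (r n).+1)%N then exceed_twice X (u n) h else 0.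
pose f2 h := if (h < r n + t.+2)%N then 2 * p n ^+ 2 else 0.
pose f3 h := if (r n <= h)%N then mixing X h else 0.
pose f4 h := if (r n + t.+1 <= h)%N then mixing X (h - t.+1) else 0.
have p20 : 0 <= 2 * p n ^+ 2 by rewrite mulr_ge0// sqr_ge0.
have fE h : `|hit_cov X (u n) A B h| <= f1 h + f2 h + f3 h + f4 h.
  have f10 : 0 <= f1 h by rewrite /f1; case: ifP.
  have f20 : 0 <= f2 h by rewrite /f2; case: ifP.
  have f30 : 0 <= f3 h by rewrite /f3; case: ifP => // _; exact: mixing_ge0.
  have f40 : 0 <= f4 h by rewrite /f4; case: ifP => // _; exact: mixing_ge0.
  have [hr|rh] := ltnP h (r n).+1.
    apply: le_trans (hit_cov_le stat h u0 bA bB dA dB) _; rewrite -/(p n).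
    have -> : exceed_twice X (u n) h = f1 h by rewrite /f1 hr.
    have : p n ^+ 2 <= f2 h by rewrite /f2 ifT; [move: (sqr_ge0 (p n)); lra|clear -hr; lia].
    lra.
  have [ht|th] := ltnP h (r n + t.+2).
    apply: le_trans (hit_cov_le stat h u0 bA bB dA dB) _; rewrite -/(p n).
    have := exceed_twice_mixing stat (u n) h; rewrite -/(p n).
    have -> : mixing X h = f3 h by rewrite /f3 ifT//; clear -rh; lia.
    have : 2 * p n ^+ 2 = f2 h by rewrite /f2 ht.
    lra.
  have := hit_cov_mixing stat (u n) (h - t.+1) bA bB.
  rewrite subnKC; last by clear -th; lia.
  have -> : mixing X (h - t.+1) = f4 h by rewrite /f4 ifT//; clear -th; lia.
  lra.
apply: (@le_trans _ _ (\sum_(k <= h < M) (f1 h + f2 h + f3 h + f4 h))).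
  by apply: ler_sum => h _; exact: fE.
rewrite !big_split/=.
have S1 : \sum_(k <= h < M) f1 h <= e / 4 * p n.
  by apply: le_trans (ler_sum_lt _ _ _ et0) (ltW Ha).
have S2 : \sum_(k <= h < M) f2 h <= e / 4 * p n.
  apply: le_trans (ler_sum_lt _ _ _ (fun=> p20)) _.
  rewrite sumr_const_nat -[X in X <= _]mulr_natl.
  apply: (@le_trans _ _ (((r n)%:R + t.+2%:R) * (2 * p n) * p n)); last by rewrite ler_pM2r.
  rewrite -[leRHS]mulrA -[2 * p n * p n]mulrA -expr2 ler_wpM2r// -natrD ler_nat.
  exact: leq_subr.
have S3 : \sum_(k <= h < M) f3 h <= e / 4 * p n.
  exact: le_trans (ler_sum_ge _ _ _ (fun h => mixing_ge0 X h)) (Hm _).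
have S4 : \sum_(k <= h < M) f4 h <= e / 4 * p n.
  apply: le_trans (ler_sum_ge _ _ _ (fun h => mixing_ge0 X (h - t.+1))) _.
  have := Hm (M - t.+1)%N.
  rewrite big_addn; under eq_bigr do rewrite addnK.
  by [].
have -> : e * p n = e / 4 * p n + e / 4 * p n + e / 4 * p n + e / 4 * p n by field.
by rewrite !lerD.
Unshelve. all: end_near. Qed.

(** Finitely many lags cost at most twice the tail probability each; the others are
   summed by [hit_cov_tail]. *)
Lemma hit_cov_sum A B : borel_set A -> borel_set B ->
  A `<=` @evt_domain R t -> B `<=` @evt_domain R t ->
  exists K, \forall n \near \oo, forall M,
    \sum_(0 <= h < M) `|hit_cov X (u n) A B h| <= K * p n.
Proof.
move=> bA bB dA dB; have [k /(_ _ (leqnn k)) H] := hit_cov_tail bA bB dA dB ltr01.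
exists (2 * k%:R + 1); near=> n => M.
have u0 : 0 < u n by near: n; move/cvgryPgt : uoo; exact.
have pn : 0 < p n := p_gt0 (u n).
have Hk : forall M, \sum_(k <= h < M) `|hit_cov X (u n) A B h| <= 1 * p n by near: n.
apply: (@le_trans _ _ (\sum_(0 <= h < k + M) `|hit_cov X (u n) A B h|)).
  by rewrite [leRHS](@big_cat_nat _ _ _ M)//= ?leq_addl// lerDl sumr_ge0.
rewrite (@big_cat_nat _ _ _ k)//= ?leq_addr// mulrDl lerD//.
apply: (@le_trans _ _ (\sum_(0 <= h < k) 2 * p n)).
  by apply: ler_sum => h _; exact: hit_cov_le2.
by rewrite sumr_const_nat subn0 -[X in X <= _]mulr_natl mulrA [_ * 2]mulrC.
Unshelve. all: end_near. Qed.

End condition_M.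

(** Dominated convergence for series with Cesaro weights, in the form that suits
   variances of blocks; uniform smallness of the tails replaces a dominating series. *)
Lemma tannery (R : realType) (c : nat -> nat -> R) (q : nat -> R) :
  (forall h, 0 <= q h) -> (forall h, c n h @[n --> \oo] --> q h) ->
  (forall e, 0 < e -> exists k0, forall k, (k0 <= k)%N ->
    \forall n \near \oo, forall M, \sum_(k <= h < M) `|c n h| <= e) ->
  exists s : R, (\sum_(1 <= h < M) q h @[M --> \oo] --> s) /\
    forall b : nat -> nat, (forall m, \forall n \near \oo, (m <= b n)%N) ->
    \sum_(1 <= h < b n) ((b n - h)%:R / (b n)%:R) * c n h @[n --> \oo] --> s.
Proof.
move=> q0 cq tail.
have qtail e : 0 < e -> exists k0, forall k, (k0 <= k)%N ->
    forall M, \sum_(k <= h < M) q h <= e.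
  move=> e0; have [k0 H] := tail e e0; exists k0 => k k0k M.
  have S : \sum_(k <= h < M) c n h @[n --> \oo] --> \sum_(k <= h < M) q h.
    by apply: cvg_big => [|h _]; [exact: add_continuous|exact: cq].
  apply: (cvgr_to_le S); apply: filterS (H k k0k) => n /(_ M); apply: le_trans.
  by apply: ler_sum => h _; exact: ler_norm.
have mono : nondecreasing_seq (fun M => \sum_(1 <= h < M) q h).
  move=> a b ab; have [a1|a1] := leqP a 1; first by rewrite big_geq// sumr_ge0.
  by rewrite [leRHS](@big_cat_nat _ _ _ a) ?(ltnW a1)//= lerDl sumr_ge0.
have ub : has_ubound (range (fun M => \sum_(1 <= h < M) q h)).
  have [k0 H] := qtail 1 ltr01; exists (\sum_(1 <= h < k0.+1) q h + 1) => _ [M _ <-].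
  apply: le_trans (mono _ _ (leq_addl k0.+1 M)) _.
  rewrite (@big_cat_nat _ _ _ k0.+1)//= ?leq_addr// lerD2l.
  by apply: H; exact: leqnSn.
have := nondecreasing_is_cvgn mono ub.
set s := limn _ => cs; exists s; split=> // b boo.
apply/cvgrPdist_le => e e0; have e30 : 0 < e / 3 by rewrite divr_gt0.
have [k1 H1] := tail _ e30.
move/cvgrPdist_le : (cs) => /(_ _ e30)[k2 _ H2].
pose k := (maxn k1 k2).+1.
have {}H1 : \forall n \near \oo, forall M, \sum_(k <= h < M) `|c n h| <= e / 3.
  by apply: H1; rewrite /k; lia.
have {}H2 : `|s - \sum_(1 <= h < k) q h| <= e / 3 by apply: H2; rewrite /k /=; lia.
have boo' : (b n)%:R^-1 @[n --> \oo] --> (0 : R).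
  apply/cvgrPdist_le => a a0; have [m am] := ltr_add_invr a0.
  near=> n; have mb : (m.+1 <= b n)%N by near: n; exact: boo.
  rewrite sub0r normrN ger0_norm; last by rewrite invr_ge0.
  apply/ltW/(le_lt_trans _ am); rewrite add0r lef_pV2 ?posrE ?ltr0n// ?ler_nat//.
  exact: leq_trans mb.
have fin : \sum_(1 <= h < k) ((b n - h)%:R / (b n)%:R) * c n h @[n --> \oo] -->
    \sum_(1 <= h < k) q h.
  apply: cvg_big => [|h _]; first exact: add_continuous.
  rewrite -[X in _ --> X]mul1r; apply: cvgM; last exact: cq.
  have c1 : 1 - h%:R * (b n)%:R^-1 @[n --> \oo] --> (1 : R).
    rewrite -[X in _ --> X]subr0 -[X in _ --> _ - X](mulr0 h%:R).
    by apply: cvgB; [exact: cvg_cst|exact: cvgMl_tmp].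
  apply: (cvg_trans _ c1); apply: near_eq_cvg; near=> n.
  have hb : (h < b n)%N by near: n; exact: boo.
  rewrite natrB; last exact: ltnW.
  by rewrite mulrBl divff// pnatr_eq0; lia.
move/cvgrPdist_le : fin => /(_ _ e30) fin.
near=> n.
have kb : (k <= b n)%N by near: n; exact: boo.
have Hf : `|\sum_(1 <= h < k) q h - \sum_(1 <= h < k) ((b n - h)%:R / (b n)%:R) * c n h| <= e / 3 by near: n.
have Ht : \sum_(k <= h < b n) `|c n h| <= e / 3.
  by have : forall M, \sum_(k <= h < M) `|c n h| <= e / 3 by near: n.
have Ht' : `|\sum_(k <= h < b n) ((b n - h)%:R / (b n)%:R) * c n h| <= e / 3.
  apply: le_trans (ler_norm_sum _ _ _) _; apply: le_trans _ Ht.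
  apply: ler_sum => h _; rewrite normrM ler_piMl// ger0_norm ?divr_ge0//.
  have b0 : (0 < b n)%N by apply: leq_trans kb.
  by rewrite ler_pdivrMr ?ltr0n// mul1r ler_nat leq_subr.
rewrite (@big_cat_nat _ _ _ k)//=.
move: H2 Hf Ht'; move: (\sum_(1 <= h < k) q h) (\sum_(1 <= h < k) _) (\sum_(k <= h < b n) _) => x y v.
rewrite !ler_norml => /andP[? ?] /andP[? ?] /andP[? ?].
by apply/andP; split; lra.
Unshelve. all: end_near. Qed.

(** * The limiting covariance matrix *)

Section score.
Context {R : realType} {d : measure_display} {T : measurableType d}.
Variables (P : probability T R) (X : int -> {RV P >-> R}).
Hypothesis stat : strictly_stationary X.
Variables (t N : nat) (A : 'I_N.+1 -> set 'rV[R]_t.+2).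
Hypothesis A_borel : forall j, borel_set (A j).

(** The scalar observable of the Cramer-Wold device: its sums along the series are the
   linear combinations, with coefficients [c], of the centred hit counts. *)
Definition score (x : R) (c : 'rV[R]_N.+1) (y : 'rV[R]_t.+2) : R :=
  \sum_j c 0 j * (\1_(scaled_set x (A j)) y - Pr P (hit X x (A j) 0)).

Implicit Types (x : R) (c : 'rV[R]_N.+1).

Lemma measurable_score x c : measurable_fun setT (score x c : borelRn R t.+2 -> R).
Proof.
apply: measurable_sum => j; apply: measurable_funM => //.
apply: measurable_funB => //.
apply: (@measurable_indic _ (borelRn R t.+2)).
exact: borel_scaled_set.
Qed.

Lemma bounded_score x c : bounded_by (\sum_j `|c 0 j|) (score x c).
Proof.
move=> y; apply: le_trans (ler_norm_sum _ _ _) _; apply: ler_sum => j _.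
rewrite normrM ler_piMr//.
have := Pr_ge0 P (hit X x (A j) 0); have := Pr_le1 P (measurable_hit X x 0 (A_borel j)).
move: (Pr P _) => q q1 q0; rewrite indicE; case: (_ \in _); rewrite ler_norml /=; apply/andP; split; lra.
Qed.

Lemma Pr_pair_shift s h (D D' : set 'rV[R]_t.+2) : borel_set D -> borel_set D' ->
  Pr P (window X s t.+2 @^-1` D `&` window X (s + h%:Z) t.+2 @^-1` D') =
  Pr P (window X 0 t.+2 @^-1` D `&` window X h%:Z t.+2 @^-1` D').
Proof.
move=> bD bD'.
pose E := [set x : 'rV[R]_(h + t.+1).+1 | D (subrow t 0 x)] `&` [set x | D' (subrow t h x)].
have bsub k (F : set 'rV[R]_t.+2) : borel_set F -> borel_set [set x : 'rV[R]_(h + t.+1).+1 | F (subrow t k x)].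
  by move=> bF; exact: (borel_reindex (fun l : 'I_t.+2 => inord (k + l)) bF).
have bE : borel_set E.
  exact: (@measurableI _ (borelRn R _) _ _ (bsub 0%N _ bD) (bsub h _ bD')).
have EE s0 : window X s0 (h + t.+1).+1 @^-1` E =
    window X s0 t.+2 @^-1` D `&` window X (s0 + h%:Z) t.+2 @^-1` D'.
  by apply/seteqP; split => w; rewrite /E /= !subrow_window ?addr0 ?leq_addl.
by rewrite -EE (Pr_window_shift stat _ 0 bE) EE add0r.
Qed.

Lemma gam_score x c h :
  gam X (score x c) h = \sum_j \sum_l c 0 j * c 0 l * hit_cov X x (A j) (A l) h.
Proof.
pose I j k (w : T) : R := \1_(scaled_set x (A j)) (window X k%:Z t.+2 w).
pose q j := Pr P (hit X x (A j) 0).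
have bS j := borel_scaled_set x (A_borel j).
have mI j k : measurable (window X k%:Z t.+2 @^-1` scaled_set x (A j)).
  by apply: measurable_rV_preimage => //; exact: measurable_window.
have bI j k : bounded_mfun (I j k) by exact: (@bounded_mfun_indic _ T R _ (mI j k)).
have bJ j k : bounded_mfun (fun w => I j k w - q j).
  by apply: bounded_mfunB => //; exact: bounded_mfun_cst.
have EI j k : Ex P (I j k) = q j.
  rewrite [LHS](Ex_indic P (mI j k)) /q /hit.
  exact: Pr_window_shift.
rewrite /gam /xi /score.
have -> : (fun w => (\sum_j c 0 j * (I j 0%N w - q j)) * (\sum_j c 0 j * (I j h w - q j))) =
    (fun w => \sum_j \sum_l (c 0 j * c 0 l) * ((I j 0%N w - q j) * (I l h w - q l))).
  apply/funext => w; rewrite mulr_suml; apply: eq_bigr => j _.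
  by rewrite mulr_sumr; apply: eq_bigr => l _; ring.
have bJJ j l : bounded_mfun (fun w => (I j 0%N w - q j) * (I l h w - q l)) by exact: bounded_mfunM.
rewrite Ex_sum; last by move=> j _; apply: bounded_mfun_sum => l _; exact: bounded_mfunZ.
apply: eq_bigr => j _; rewrite Ex_sum; last by move=> l _; exact: bounded_mfunZ.
apply: eq_bigr => l _; rewrite ExZ//; congr (_ * _).
have -> : (fun w => (I j 0%N w - q j) * (I l h w - q l)) =
    (fun w => I j 0%N w * I l h w - (q l * I j 0%N w + (q j * I l h w - q j * q l))).
  by apply/funext => w; ring.
have b1 := bounded_mfunM (bI j 0%N) (bI l h).
have b2 := bounded_mfunZ (q l) (bI j 0%N); have b3 := bounded_mfunZ (q j) (bI l h).
have b4 := @bounded_mfun_cst _ T R (q j * q l).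
have b5 := bounded_mfunB b3 b4.
rewrite (ExB _ b1 (bounded_mfunD b2 b5)) (ExD _ b2 b5) (ExB _ b3 b4) (Ex_cst P (q j * q l)) !ExZ// !EI.
have -> : Ex P (fun w => I j 0%N w * I l h w) = Pr P (hit X x (A j) 0 `&` hit X x (A l) h).
  have -> : (fun w => I j 0%N w * I l h w) = \1_(window X 0%:Z t.+2 @^-1` scaled_set x (A j) `&`
     window X h%:Z t.+2 @^-1` scaled_set x (A l)).
    by rewrite indicI.
  rewrite Ex_indic; last exact: measurableI.
  rewrite -(Pr_pair_shift (0%:Z - 1) h (bS j) (bS l)) /hit.
  by rewrite (_ : 0%:Z - 1 + h%:Z = h%:Z - 1)//; lia.
by rewrite /hit_cov -/(q j) -/(q l); ring.
Qed.

Lemma Ex_xi0_score x c : Ex P (xi X (score x c) 0) = 0.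
Proof.
have mI j : measurable (window X 0%:Z t.+2 @^-1` scaled_set x (A j)).
  apply: measurable_rV_preimage; first exact: measurable_window.
  exact: borel_scaled_set.
have bI j := @bounded_mfun_indic _ T R _ (mI j).
have bc j := @bounded_mfun_cst _ T R (Pr P (hit X x (A j) 0)).
rewrite /xi /score Ex_sum; last by move=> j _; apply: bounded_mfunZ; exact: (bounded_mfunB (bI j) (bc j)).
apply: big1 => j _; rewrite ExZ; last exact: (bounded_mfunB (bI j) (bc j)).
have := ExB P (bI j) (bc j); rewrite Ex_cst Ex_indic// => E.
apply/eqP; rewrite mulf_eq0; apply/orP; right; apply/eqP.
apply: etrans E _; apply/eqP; rewrite subr_eq0; apply/eqP.
by apply: Pr_window_shift => //; exact: borel_scaled_set.
Qed.

End score.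

Section limit_covariance_matrix.
Context (R : realType) (d : measure_display) (T : measurableType d) (P : probability T R).
Context (d' : measure_display) (T' : measurableType d') (Q : probability T' R).
Variables (X : int -> {RV P >-> R}) (Y : int -> {RV Q >-> R}) (alpha : R).
Hypotheses (stat : strictly_stationary X) (tailY : is_tail_process X Y alpha).
Variables (u : nat -> R) (r : nat -> nat).
Let p n := tailp X (u n).
Hypotheses (p_gt0 : forall x, 0 < tailp X x) (uoo : u n @[n --> \oo] --> +oo).
Hypothesis roo : (r n)%:R @[n --> \oo] --> (+oo : set_system R).
Hypothesis rp : (r n)%:R * p n @[n --> \oo] --> (0 : R).
Hypothesis mixsum :
  ((p n)^-1%:E * \sum_(r n <= h <oo) (mixing X h)%:E)%E @[n --> \oo] --> 0%E.
Hypothesis anticluster :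
  limn_esup (fun n => (\sum_(k <= h < (r n).+1)
      cond_Pr P [set w | u n < X h%:Z w] (exceeds X (u n)))%:E) @[k --> \oo] --> 0%E.
Variables (t N : nat) (A : 'I_N.+1 -> set 'rV[R]_t.+2).
Hypotheses (A_borel : forall j, borel_set (A j)) (A_domain : forall j, A j `<=` @evt_domain R t).
Hypothesis A_null : forall j, window_law Y (-1) (boundary (A j)) = 0%E.
Implicit Types (j l : 'I_N.+1) (c : 'rV[R]_N.+1).

Local Notation WY h := (window Y (h%:Z - 1) t.+2).

Let q j l h := Pr Q (WY 0 @^-1` A j `&` WY h @^-1` A l).

Let u_gt0 : \forall n \near \oo, 0 < u n.
Proof. by move/cvgryPgt : uoo; exact. Qed.

Lemma hit_cov_cvg j l h : hit_cov X (u n) (A j) (A l) h / p n @[n --> \oo] --> q j l h.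
Proof.
have J := joint_limit (h := h) stat tailY p_gt0 (A_borel j) (A_borel l) (A_domain (j:=j))
  (A_domain (j:=l)) (A_null j) (A_null l).
have {}J := cvg_comp _ _ uoo J.
rewrite -[X in _ --> X]subr0.
have E n : hit_cov X (u n) (A j) (A l) h / p n =
    Pr P (hit X (u n) (A j) 0 `&` hit X (u n) (A l) h) / p n -
    Pr P (hit X (u n) (A j) 0) * Pr P (hit X (u n) (A l) 0) / p n by rewrite -mulrBl.
under eq_fun do rewrite E.
apply: cvgB; first exact: J.
apply: (squeeze_cvgr _ (cvg_cst 0) (tailp_cvg0 roo rp)); near=> n.
have u0 : 0 < u n by near: n.
have pn : 0 < p n := p_gt0 (u n).
have hj := Pr_hit_le stat 0 u0 (A_borel j) (A_domain (j:=j)).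
have hl := Pr_hit_le stat 0 u0 (A_borel l) (A_domain (j:=l)).
rewrite !mulr_ge0 ?Pr_ge0 ?invr_ge0 ?(ltW pn)//= ler_pdivrMr// ler_pM ?Pr_ge0//.
Unshelve. all: end_near. Qed.

Let tail j l e : 0 < e -> exists k0, forall k, (k0 <= k)%N ->
    \forall n \near \oo, forall M, \sum_(k <= h < M) `|hit_cov X (u n) (A j) (A l) h / p n| <= e.
Proof.
move=> e0; have [k0 H] := hit_cov_tail stat p_gt0 uoo roo rp mixsum anticluster
  (A_borel j) (A_borel l) (A_domain (j:=j)) (A_domain (j:=l)) e0.
exists k0 => k /H; apply: filterS => n Hn M.
rewrite (eq_bigr (fun h => `|hit_cov X (u n) (A j) (A l) h| / p n)).
  by rewrite -mulr_suml ler_pdivrMr//; exact: p_gt0.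
by move=> h _; rewrite normrM normfV (gtr0_norm (p_gt0 (u n))).
Qed.

Let s j l : R := limn (fun M => \sum_(1 <= h < M) q j l h).

Let sP j l : (\sum_(1 <= h < M) q j l h @[M --> \oo] --> s j l) /\
    forall b : nat -> nat, (forall m, \forall n \near \oo, (m <= b n)%N) ->
    \sum_(1 <= h < b n) ((b n - h)%:R / (b n)%:R) * (hit_cov X (u n) (A j) (A l) h / p n)
      @[n --> \oo] --> s j l.
Proof.
have [s' [c H]] := tannery (fun h => Pr_ge0 Q (WY 0 @^-1` A j `&` WY h @^-1` A l))
  (@hit_cov_cvg j l) (@tail j l).
by rewrite /s (cvg_lim _ c).
Qed.

Let limit_covE j l : limit_cov Y (A j) (A l) = (q j l 0 + s j l + s l j)%:E.
Proof.
have mW h D : borel_set D -> measurable (WY h @^-1` D).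
  by apply: measurable_rV_preimage; exact: measurable_window.
have series D D' a (bD : borel_set D) (bD' : borel_set D') :
    (\sum_(1 <= h < M) Pr Q (WY 0 @^-1` D `&` WY h @^-1` D') @[M --> \oo] --> a) ->
    (\sum_(1 <= h <oo) Q (WY 0 @^-1` D `&` WY h @^-1` D'))%E = a%:E.
  move=> ca; apply: cvg_lim => //.
  have E M : (\sum_(1 <= h < M) Q (WY 0 @^-1` D `&` WY h @^-1` D'))%E =
      (\sum_(1 <= h < M) Pr Q (WY 0 @^-1` D `&` WY h @^-1` D'))%:E.
    rewrite -sumEFin; apply: eq_bigr => h _; apply: Pr_fin.
    by apply: measurableI; exact: mW.
  by under eq_fun do rewrite E; apply: cvg_EFin => //; exact: nearW.
rewrite /limit_cov (series _ _ _ (A_borel j) (A_borel l) (sP j l).1).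
rewrite (series _ _ _ (A_borel l) (A_borel j) (sP l j).1) !EFinD; congr (_ + _ + _)%E.
rewrite /window_law /pushforward preimage_setI Pr_fin//.
by apply: measurableI; exact: (mW 0%N).
Qed.

Lemma limit_cov_fin_num j l : limit_cov Y (A j) (A l) \is a fin_num.
Proof. by rewrite limit_covE. Qed.

Definition limit_mx : 'M[R]_N.+1 := \matrix_(j, l) fine (limit_cov Y (A j) (A l)).

Let limit_mxE j l : limit_mx j l = q j l 0 + s j l + s l j.
Proof. by rewrite mxE limit_covE. Qed.

(** Collected by lags, the normalised variance is a combination of Cesaro sums of
   covariances, to which [tannery] applies. *)
Lemma block_variance_cvg c (b : nat -> nat) : (forall m, \forall n \near \oo, (m <= b n)%N) ->
  Ex P (fun w => (\sum_(k < b n) xi X (score X A (u n) c) k w) ^+ 2) / ((b n)%:R * p n)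
    @[n --> \oo] --> bform limit_mx c c.
Proof.
move=> boo.
have -> : bform limit_mx c c = \sum_j \sum_l c 0 j * c 0 l * (q j l 0 + 2 * s j l).
  have -> : bform limit_mx c c = \sum_j \sum_l c 0 j * c 0 l * (q j l 0 + s j l + s l j).
    rewrite /bform mxE exchange_big; apply: eq_bigr => l _.
    rewrite !mxE mulr_suml; apply: eq_bigr => j _.
    by rewrite limit_mxE; ring.
  have E (f : 'I_N.+1 -> 'I_N.+1 -> R) : \sum_j \sum_l c 0 j * c 0 l * (q j l 0 + s j l + f j l) =
      \sum_j \sum_l c 0 j * c 0 l * (q j l 0 + s j l) + \sum_j \sum_l c 0 j * c 0 l * f j l.
    rewrite -big_split; apply: eq_bigr => j _; rewrite -big_split; apply: eq_bigr => l _.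
    exact: mulrDr.
  rewrite E [X in _ + X]exchange_big.
  have -> : \sum_j \sum_i c 0 i * c 0 j * s j i = \sum_j \sum_l c 0 j * c 0 l * s j l.
    by apply: eq_bigr => j _; apply: eq_bigr => l _; rewrite [c 0 l * _]mulrC.
  rewrite -(E s); apply: eq_bigr => j _; apply: eq_bigr => l _; ring.
pose V n := \sum_j \sum_l c 0 j * c 0 l * (hit_cov X (u n) (A j) (A l) 0 / p n +
  2 * \sum_(1 <= h < b n) ((b n - h)%:R / (b n)%:R) * (hit_cov X (u n) (A j) (A l) h / p n)).
have cV : V n @[n --> \oo] --> \sum_j \sum_l c 0 j * c 0 l * (q j l 0 + 2 * s j l).
  apply: cvg_big => [|j _]; first exact: add_continuous.
  apply: cvg_big => [|l _]; first exact: add_continuous.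
  apply: cvgMl_tmp; apply: cvgD; first exact: hit_cov_cvg.
  by apply: cvgMl_tmp; have [_] := sP j l; apply.
apply: (cvg_trans _ cV); apply: near_eq_cvg; near=> n.
have u0 : 0 < u n by near: n.
have b0 : (0 < b n)%N by near: n; exact: boo.
have pn : p n != 0 by rewrite gt_eqF//; exact: p_gt0.
have bn : (b n)%:R != 0 :> R by rewrite pnatr_eq0 -lt0n.
have mz := measurable_score X A_borel (u n) c; have zC := bounded_score X A_borel (u n) c.
rewrite (Ex_block_sqr stat mz zC) mulrDl.
have E0 : (b n)%:R * gam X (score X A (u n) c) 0 / ((b n)%:R * p n) =
    \sum_j \sum_l c 0 j * c 0 l * (hit_cov X (u n) (A j) (A l) 0 / p n).
  rewrite gam_score// -mulf_div divff// mul1r mulr_suml; apply: eq_bigr => j _.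
  by rewrite mulr_suml; apply: eq_bigr => l _; rewrite mulrA.
have E1 : 2 * (\sum_(1 <= h < b n) (b n - h)%:R * gam X (score X A (u n) c) h) / ((b n)%:R * p n) =
    \sum_j \sum_l c 0 j * c 0 l * (2 * \sum_(1 <= h < b n) ((b n - h)%:R / (b n)%:R) *
      (hit_cov X (u n) (A j) (A l) h / p n)).
  rewrite -mulrA mulr_suml mulr_sumr.
  have -> : \sum_j \sum_l c 0 j * c 0 l * (2 * \sum_(1 <= h < b n) ((b n - h)%:R / (b n)%:R) *
      (hit_cov X (u n) (A j) (A l) h / p n)) =
     \sum_(1 <= h < b n) \sum_j \sum_l c 0 j * c 0 l * (2 * (((b n - h)%:R / (b n)%:R) *
      (hit_cov X (u n) (A j) (A l) h / p n))).
    rewrite [RHS]exchange_big; apply: eq_bigr => j _; rewrite [RHS]exchange_big; apply: eq_bigr => l _.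
    by rewrite !mulr_sumr.
  apply: eq_bigr => h _; rewrite gam_score// mulr_sumr mulr_suml mulr_sumr; apply: eq_bigr => j _.
  rewrite mulr_sumr mulr_suml mulr_sumr; apply: eq_bigr => l _.
  by field; rewrite pn.
rewrite E0 E1 /V -big_split; apply: eq_bigr => j _.
by rewrite -big_split; apply: eq_bigr => l _; rewrite mulrDr.
Unshelve. all: end_near. Qed.

(** The quadratic form of the matrix is a limit of variances. *)
Lemma psd_limit_mx : psd limit_mx.
Proof.
split=> [|c].
  apply/matrixP => j l; rewrite mxE !limit_mxE /q setIC.
  have -> : WY 0 @^-1` A j `&` WY 0 @^-1` A l = WY 0 @^-1` A l `&` WY 0 @^-1` A j by rewrite setIC.
  by rewrite -!addrA [s l j + _]addrC.
have boo m : \forall n \near \oo, (m <= n)%N by exists m.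
apply: (cvgr_to_ge (@block_variance_cvg c (fun n => n) boo)); apply: nearW => n.
rewrite divr_ge0//; first by apply: Ex_ge0 => w; exact: sqr_ge0.
by rewrite mulr_ge0// ltW// p_gt0.
Qed.

Lemma gam_sum_le c : exists2 K, 0 <= K & \forall n \near \oo, forall M,
  \sum_(h < M) `|gam X (score X A (u n) c) h| <= K * p n.
Proof.
have H j l := hit_cov_sum stat p_gt0 uoo roo rp mixsum anticluster
  (A_borel j) (A_borel l) (A_domain (j:=j)) (A_domain (j:=l)).
have [K0 HK0] := choice (fun jl : 'I_N.+1 * 'I_N.+1 => H jl.1 jl.2).
exists (\sum_j \sum_l `|c 0 j * c 0 l| * `|K0 (j, l)|).
  by apply: sumr_ge0 => j _; apply: sumr_ge0 => l _; rewrite mulr_ge0.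
have HA : \forall n \near \oo, forall jl M,
    \sum_(0 <= h < M) `|hit_cov X (u n) (A jl.1) (A jl.2) h| <= K0 jl * p n.
  exact: filter_forall.
near=> n => M.
have u0 : 0 < u n by near: n.
have Hn : forall jl M, \sum_(0 <= h < M) `|hit_cov X (u n) (A jl.1) (A jl.2) h| <= K0 jl * p n.
  by near: n.
apply: (@le_trans _ _ (\sum_(h < M) \sum_j \sum_l `|c 0 j * c 0 l| * `|hit_cov X (u n) (A j) (A l) h|)).
  apply: ler_sum => h _; rewrite gam_score//.
  apply: le_trans (ler_norm_sum _ _ _) _; apply: ler_sum => j _.
  apply: le_trans (ler_norm_sum _ _ _) _; apply: ler_sum => l _.
  by rewrite normrM.
rewrite exchange_big mulr_suml; apply: ler_sum => j _.
rewrite exchange_big mulr_suml; apply: ler_sum => l _.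
rewrite -mulr_sumr -mulrA ler_wpM2l//.
rewrite -(big_mkord xpredT (fun h => `|hit_cov X (u n) (A j) (A l) h|)).
apply: le_trans (Hn (j, l) M) _; rewrite ler_wpM2r ?ler_norm//; exact: ltW (p_gt0 (u n)).
Unshelve. all: end_near. Qed.

End limit_covariance_matrix.

(** * Growth rates *)

Lemma powR_nat_cvg0 (R : realType) (g : R) : 0 < g ->
  (n%:R : R) `^ (- g) @[n --> \oo] --> (0 : R).
Proof.
move=> g0; apply/cvgrPdist_le => e e0.
near=> n.
have n0 : 0 < n%:R :> R by rewrite ltr0n; near: n; exact: nbhs_infty_gt.
rewrite sub0r normrN ger0_norm ?powR_ge0// powRN.
rewrite -[leRHS]invrK lef_pV2 ?posrE ?invr_gt0 ?powR_gt0//.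
have E : e^-1 = (e^-1 `^ g^-1) `^ g.
  by rewrite -powRrM mulVf ?gt_eqF// powRr1// invr_ge0 ltW.
rewrite E ge0_ler_powR ?nnegrE ?powR_ge0 ?(ltW g0) ?(ltW n0)//.
near: n; have := @cvgr_idn R; move/cvgryPge; exact.
Unshelve. all: end_near. Qed.

Section rates.
Context (R : realType) (p al : nat -> R) (delta : R).
Hypotheses (p_gt0 : forall n, 0 < p n) (p0 : p n @[n --> \oo] --> (0 : R)).
Hypothesis npoo : n%:R * p n @[n --> \oo] --> (+oo : set_system R).
Hypotheses (delta_ge2 : 2 <= delta) (al_ge0 : forall h, 0 <= al h).
Hypothesis al_O : al =O_\oo (fun n : nat => n%:R `^ (- delta)).
Hypothesis rate_gt2 : 2 < delta ->
  n%:R `^ (delta / (4 + delta)) * p n @[n --> \oo] --> (+oo : set_system R).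
Hypothesis rate_eq2 : delta = 2 ->
  n%:R `^ (1 / 2) * (p n `^ (3 / 2) / `|ln (p n)|) @[n --> \oo] --> (+oo : set_system R).

Local Notation x n := (Num.sqrt (n%:R * p n)).

Lemma sqrt_npoo : x n @[n --> \oo] --> (+oo : set_system R).
Proof.
apply/cvgryPge => M; have := npoo; move/cvgryPge => /(_ (M ^+ 2)); apply: filterS => n h.
apply: le_trans (ler_norm M) _.
by rewrite -sqrtr_sqr ler_wsqrtr.
Qed.

(** This is what the two rate conditions are for: the expected number [x n ^+ 2] of
   exceedances grows so fast that [n = o(x n ^ (1 + delta))]. *)
Lemma rate_core : n%:R * x n `^ (- (1 + delta)) @[n --> \oo] --> (0 : R).
Proof.
move: delta_ge2; rewrite le_eqVlt => /predU1P[d2|d2].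
- move: (rate_eq2 (esym d2)) => H; apply/cvgrPdist_le => e e0.
  have e1 : 0 < expR (-1) :> R by exact: expR_gt0.
  near=> n.
  have n0 : 0 < n%:R :> R by rewrite ltr0n; near: n; exact: nbhs_infty_gt.
  have pn := p_gt0 n.
  have x0 : 0 < x n by rewrite sqrtr_gt0 mulr_gt0.
  have lnp : 1 <= `|ln (p n)|.
    have : p n < expR (-1) by near: n; exact: (cvgr_lt _ p0).
    rewrite -ltr_ln ?posrE// expRK => h; rewrite ler_normr; apply/orP; right; lra.
  have big : e^-1 <= n%:R `^ (1 / 2) * (p n `^ (3 / 2) / `|ln (p n)|).
    by near: n; move/cvgryPge : H; exact.
  have xE : x n ^+ 3 = n%:R * (n%:R `^ (1 / 2) * p n `^ (3 / 2)).
    rewrite exprS sqr_sqrtr; last by rewrite mulr_ge0// ltW.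
    have -> : x n = n%:R `^ (1/2) * p n `^ (1/2).
      by rewrite sqrtrM ?(ltW n0)// !mul1r !powR12_sqrt// ?ltW.
    have -> : (3 / 2 : R) = 1 + 1 / 2 by field.
    rewrite powRD; last by apply/implyP => _; rewrite gt_eqF.
    by rewrite (powRr1 (ltW pn)); ring.
  rewrite sub0r normrN ger0_norm ?mulr_ge0 ?powR_ge0 ?(ltW n0)//.
  rewrite powRN -d2 (_ : 1 + 2 = 3%:R)//.
  rewrite powR_mulrn ?(ltW x0)// xE invfM mulrA divff ?gt_eqF// mul1r.
  rewrite div1r -[leRHS]invrK lef_pV2 ?posrE ?invr_gt0 ?mulr_gt0 ?powR_gt0//.
  apply: le_trans big _; rewrite !div1r ler_wpM2l ?powR_ge0// ler_piMr ?powR_ge0//.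
  by rewrite invf_le1// (lt_le_trans ltr01).
- move: (rate_gt2 d2) => H.
  have d4 : 0 < 4 + delta by lra.
  have g0 : 0 < (delta - 2) / (4 + delta) by rewrite divr_gt0//; lra.
  apply: (squeeze_cvgr _ (cvg_cst 0) (powR_nat_cvg0 g0)); near=> n.
  have n0 : 0 < n%:R :> R by rewrite ltr0n; near: n; exact: nbhs_infty_gt.
  have pn := p_gt0 n.
  have x0 : 0 < x n by rewrite sqrtr_gt0 mulr_gt0.
  have big : 1 <= n%:R `^ (delta / (4 + delta)) * p n.
    by near: n; move/cvgryPge : H; exact.
  rewrite mulr_ge0 ?powR_ge0 ?(ltW n0)//=.
  have xn : n%:R `^ (2 / (4 + delta)) <= x n.
    have -> : 2 / (4 + delta) = (4 / (4 + delta)) * 2^-1 :> R by field; rewrite gt_eqF.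
    rewrite powRrM powR12_sqrt ?powR_ge0// ler_wsqrtr//.
    have -> : 4 / (4 + delta) = 1 - delta / (4 + delta) :> R by field; rewrite gt_eqF.
    rewrite powRB; last by apply/implyP => _; rewrite gt_eqF.
    rewrite powRr1 ?(ltW n0)// ler_wpM2l ?(ltW n0)// -div1r ler_pdivrMr ?powR_gt0//.
    by rewrite mulrC.
  have le1 : x n `^ (- (1 + delta)) <= (n%:R `^ (2 / (4 + delta))) `^ (- (1 + delta)).
    rewrite !powRN lef_pV2 ?posrE ?powR_gt0//.
    by rewrite ge0_ler_powR ?nnegrE ?powR_ge0 ?(ltW x0)//; lra.
  apply: le_trans (ler_wpM2l (ltW n0) le1) _.
  rewrite -powRrM -{1}[n%:R : R]powRr1 ?(ltW n0)// -powRD; last by apply/implyP => _; rewrite gt_eqF.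
  rewrite le_eqVlt; apply/orP; left; apply/eqP; congr (_ `^ _).
  by field; rewrite gt_eqF.
Unshelve. all: end_near. Qed.

(** Blocks of length of order [x n] number about [n / x n]; this is their total mixing
   error across gaps of length [e * x n]. *)
Lemma block_mixing_cvg0 e : 0 < e ->
  n%:R / x n * al (Num.truncn (e * x n)) @[n --> \oo] --> (0 : R).
Proof.
move=> e0; move/eqO_exP : al_O => [K K0 [h0 _ HK]].
pose D := K * (e / 2) `^ (- delta).
have cD : D * (n%:R * x n `^ (- (1 + delta))) @[n --> \oo] --> D * 0.
  by apply: cvgMl_tmp; exact: rate_core.
rewrite mulr0 in cD; apply: (squeeze_cvgr _ (cvg_cst 0) cD); near=> n.
have n0 : 0 < n%:R :> R by rewrite ltr0n; near: n; exact: nbhs_infty_gt.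
have xb : Num.max (2 / e) (h0.+1%:R / e) <= x n.
  by near: n; have := sqrt_npoo; move/cvgryPge; exact.
move: xb; rewrite ge_max !ler_pdivrMr// ![x n * e]mulrC => /andP[x2 xh].
have ex0 : 0 < e * x n by lra.
have x0 : 0 < x n by rewrite -(pmulr_rgt0 _ e0).
rewrite mulr_ge0 ?divr_ge0 ?(ltW n0) ?(ltW x0)//=.
set l := Num.truncn (e * x n).
have hl : (h0 <= l)%N by rewrite ltnW// truncn_gt_nat.
have half : e / 2 * x n <= l%:R.
  have := truncnS_gt (e * x n); rewrite -/l -natr1; lra.
have l0 : 0 < e / 2 * x n by lra.
have alK : al l <= K * l%:R `^ (- delta).
  by have := HK l hl; rewrite /= (ger0_norm (al_ge0 l)) (ger0_norm (powR_ge0 _ _)).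
have pl : l%:R `^ (- delta) <= (e / 2 * x n) `^ (- delta).
  rewrite !powRN lef_pV2 ?posrE ?powR_gt0 ?(lt_le_trans l0)//.
  by rewrite ge0_ler_powR ?nnegrE ?(ltW l0)// (le_trans _ delta_ge2).
have nx : 0 <= n%:R / x n by rewrite divr_ge0// ?ltW.
apply: le_trans (ler_wpM2l nx (le_trans alK (ler_wpM2l (ltW K0) pl))) _.
rewrite powRM ?(ltW x0)//; last by rewrite divr_ge0// ltW.
rewrite opprD powRD; last by apply/implyP => _; rewrite gt_eqF.
rewrite powR_inv1 ?(ltW x0)// /D le_eqVlt; apply/orP; left; apply/eqP.
by move: (_ `^ _) (_ `^ _) => a b; ring.
Unshelve. all: end_near. Qed.

End rates.

(** * The central limit theorem for one linear combination *)

Section trigonometric_lipschitz.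
Context (R : realType).
Implicit Types a x : R.

Lemma norm_cosD_le a x : `|cos (a + x) - cos a| <= `|x|.
Proof.
have fd (y : R) : is_derive y (1 : R) (fun x => cos (a + x) - cos a) (- sin (a + y)).
  by apply: is_derive_eq; rewrite /GRing.scale /= add0r mulr1 subr0.
have f0 : cos (a + 0) - cos a = 0 by rewrite addr0 subrr.
rewrite -[leRHS]mul1r; apply: (@norm_le_derive _ _ _ _ x fd f0) => y _.
by rewrite normrN; exact: sin_max.
Qed.

Lemma norm_sinD_le a x : `|sin (a + x) - sin a| <= `|x|.
Proof.
have fd (y : R) : is_derive y (1 : R) (fun x => sin (a + x) - sin a) (cos (a + y)).
  by apply: is_derive_eq; rewrite /GRing.scale /= add0r mulr1 subr0.
have f0 : sin (a + 0) - sin a = 0 by rewrite addr0 subrr.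
rewrite -[leRHS]mul1r; apply: (@norm_le_derive _ _ _ _ x fd f0) => y _.
exact: cos_max.
Qed.

End trigonometric_lipschitz.

Lemma sum_in_blocks (V : nmodType) (f : nat -> V) (m b s : nat) : (b <= s)%N -> (0 < s)%N ->
  \sum_(k < m * s) (if (k %% s < b)%N then f k else 0) = \sum_(i < m) \sum_(r < b) f (i * s + r)%N.
Proof.
move=> bs s0; elim: m => [|m ih]; first by rewrite !big_ord0.
rewrite [RHS]big_ord_recr /= -ih.
rewrite -(big_mkord xpredT (fun k => if (k %% s < b)%N then f k else 0)).
rewrite -(big_mkord xpredT (fun k => if (k %% s < b)%N then f k else 0)).
rewrite (@big_cat_nat _ _ _ (m * s))//= ?leq_mul2r ?leqnSn ?orbT//; congr (_ + _).
rewrite -{1}[(m * s)%N]add0n big_addn mulSn addnK.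
rewrite -(big_mkord xpredT (fun r => f (m * s + r)%N)).
rewrite (@big_cat_nat _ _ _ b)//= [X in _ + X]big1_seq ?addr0.
  rewrite !big_nat; apply: eq_bigr => r /andP[_ rb].
  by rewrite addnC modnMDl modn_small ?rb ?(leq_trans rb).
move=> r; rewrite /= mem_index_iota => /andP[br rs].
by rewrite addnC modnMDl modn_small// ltnNge br.
Qed.

Section full_sum.
Context {d : measure_display} {T : measurableType d} {R : realType}.
Variables (P : probability T R) (X : int -> {RV P >-> R}).
Hypothesis stat : strictly_stationary X.
Variables (t : nat) (z : 'rV[R]_t.+2 -> R) (C : R).
Hypotheses (mz : measurable_fun setT (z : borelRn R t.+2 -> R)) (zC : bounded_by C z).
Local Notation xi := (xi X z).
Hypothesis xi0 : Ex P (xi 0) = 0.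
Variables (b h m L : nat) (lam G : R).
Hypotheses (b_gt0 : (0 < b)%N) (lam0 : 0 <= lam) (eta1 : lam * (b%:R * C) <= 1).
Hypothesis fit : (m * (b + h + t) <= L)%N.
Hypothesis GL : \sum_(k < L) `|gam X z k| <= G.

Let s := (b + h + t)%N.
Let v := lam ^+ 2 * Ex P (fun w => (\sum_(r < b) xi r w) ^+ 2).
Let inb (k : nat) := (k < m * s)%N && (k %% s < b)%N.

Let sum_inb (f : nat -> R) : \sum_(k < L) (if inb k then f k else 0) =
  \sum_(i < m) \sum_(r < b) f (i * s + r)%N.
Proof.
rewrite -sum_in_blocks//; [|by rewrite /s; lia|by rewrite /s; lia].
rewrite -(big_mkord xpredT (fun k => if inb k then f k else 0)).
rewrite -(big_mkord xpredT (fun k => if (k %% s < b)%N then f k else 0)).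
rewrite (@big_cat_nat _ _ _ (m * s))//= [X in _ + X]big1_seq ?addr0.
  by rewrite !big_nat; apply: eq_bigr => k /andP[_ km]; rewrite /inb km.
by move=> k; rewrite /= mem_index_iota /inb => /andP[mk _]; rewrite ltnNge mk.
Qed.

(** The observations outside the blocks are few, hence their sum has small variance and
   moves sine and cosine little. *)
Lemma full_sum_char :
  let err := m%:R * (3 * (lam * (b%:R * C)) * v + 8 * mixing X h)
             + lam * Num.sqrt (2 * (L%:R - m%:R * b%:R) * G) in
  `|Ex P (fun w => cos (lam * \sum_(k < L) xi k w)) - expR (- (m%:R * v / 2))| <= err /\
  `|Ex P (fun w => sin (lam * \sum_(k < L) xi k w))| <= err.
Proof.
move=> err; have bxi := bounded_xi X mz zC.
have [hc hs] := block_sum_char stat mz zC xi0 h m lam0 eta1.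
pose c (k : nat) : R := if inb k then 0 else 1.
pose rest w := \sum_(k < L) c k * xi k w.
pose blocks w := \sum_(i < m) block X z b h lam i w.
have brest : bounded_mfun rest by apply: bounded_mfun_sum => k _; exact: bounded_mfunZ.
have E w : lam * \sum_(k < L) xi k w = blocks w + lam * rest w.
  rewrite /blocks /block -mulr_sumr -(sum_inb (fun k => xi k w)) -mulrDr /rest -big_split/=.
  congr (_ * _); apply: eq_bigr => k _; rewrite /c.
  by case: (inb k); rewrite ?mul0r ?addr0 ?mul1r ?add0r.
have Erest : Ex P (fun w => `|rest w|) <= Num.sqrt (2 * (L%:R - m%:R * b%:R) * G).
  have e0 : 0 <= Ex P (fun w => `|rest w|) by exact: Ex_ge0.
  rewrite -[leLHS](ger0_norm e0) -sqrtr_sqr ler_wsqrtr//.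
  apply: le_trans (Ex_sqr_bound P brest) _.
  have c01 k : 0 <= c k <= 1 by rewrite /c; case: (inb k); rewrite lexx ler01.
  apply: le_trans (Ex_weighted_sum_sqr stat mz zC L c01) _.
  have -> : \sum_(k < L) c k = L%:R - m%:R * b%:R.
    have : \sum_(k < L) c k + \sum_(k < L) (if inb k then 1 else 0) = L%:R.
      rewrite -big_split/= (eq_bigr (fun=> 1)); first by rewrite sumr_const card_ord.
      by move=> k _; rewrite /c; case: (inb k); rewrite ?addr0 ?add0r.
    have -> : \sum_(k < L) (if inb k then 1 else 0) = m%:R * b%:R :> R.
      rewrite (sum_inb (fun=> 1)) (eq_bigr (fun=> b%:R)).
        by rewrite sumr_const card_ord -[LHS]mulr_natl.
      by move=> i _; rewrite sumr_const card_ord.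
    by move=> <-; rewrite addrK.
  rewrite ler_wpM2l// mulr_ge0//.
  rewrite subr_ge0 -natrM ler_nat.
  by apply: leq_trans fit; rewrite leq_mul2l; apply/orP; right; lia.
have mblocks : measurable_fun setT blocks by apply: measurable_sum => i; exact: measurable_block.
have mrest : measurable_fun setT rest by have [] := brest.
have mS : measurable_fun setT (fun w => blocks w + lam * rest w).
  by apply: measurable_funD => //; exact: measurable_funM.
have blr : bounded_mfun (fun w => lam * rest w) by exact: bounded_mfunZ.
have close (F : R -> R) : bounded_mfun (fun w => F (blocks w + lam * rest w)) ->
    bounded_mfun (fun w => F (blocks w)) -> (forall a x, `|F (a + x) - F a| <= `|x|) ->
    `|Ex P (fun w => F (lam * \sum_(k < L) xi k w)) - Ex P (fun w => F (blocks w))|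
      <= lam * Num.sqrt (2 * (L%:R - m%:R * b%:R) * G).
  move=> b1 b2 lip; under eq_fun do rewrite E.
  rewrite -ExB//; apply: le_trans (le_norm_Ex _ (bounded_mfunB b1 b2)) _.
  apply: (@le_trans _ _ (Ex P (fun w => lam * `|rest w|))).
    apply: le_Ex; [exact/bounded_mfun_norm/bounded_mfunB|exact/bounded_mfunZ/bounded_mfun_norm|].
    by move=> w; rewrite -[lam in leRHS]ger0_norm// -normrM; exact: lip.
  by rewrite ExZ ?ler_wpM2l//; exact: bounded_mfun_norm.
have cc := close cos (bounded_mfun_cos mS) (bounded_mfun_cos mblocks) (@norm_cosD_le R).
have cs := close sin (bounded_mfun_sin mS) (bounded_mfun_sin mblocks) (@norm_sinD_le R).
split.
  apply: le_trans (ler_distD (Ex P (fun w => cos (blocks w))) _ _) _.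
  by rewrite /err [leRHS]addrC lerD.
rewrite -[X in `|X|](subrK (Ex P (fun w => sin (blocks w)))).
by apply: le_trans (ler_normD _ _) _; rewrite /err [leRHS]addrC lerD.
Qed.

End full_sum.

Section scalar_clt.
Context {d : measure_display} {T : measurableType d} {R : realType}.
Variables (P : probability T R) (X : int -> {RV P >-> R}).
Hypothesis stat : strictly_stationary X.
Variables (t : nat) (z : nat -> 'rV[R]_t.+2 -> R) (C K sigma2 : R) (p : nat -> R).
Local Notation xi n := (xi X (z n)).
Local Notation x n := (Num.sqrt (n%:R * p n)).
Hypothesis mz : \forall n \near \oo, measurable_fun setT (z n : borelRn R t.+2 -> R).
Hypothesis zC : \forall n \near \oo, bounded_by C (z n).
Hypothesis xi0 : \forall n \near \oo, Ex P (xi n 0) = 0.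
Hypotheses (p_gt0 : forall n, 0 < p n) (p0 : p n @[n --> \oo] --> (0 : R)).
Hypothesis npoo : n%:R * p n @[n --> \oo] --> (+oo : set_system R).
Hypothesis var : forall b : nat -> nat, (forall m, \forall n \near \oo, (m <= b n)%N) ->
  Ex P (fun w => (\sum_(k < b n) xi n k w) ^+ 2) / ((b n)%:R * p n) @[n --> \oo] --> sigma2.
Hypotheses (K0 : 0 <= K)
  (GK : \forall n \near \oo, forall M, \sum_(h < M) `|gam X (z n) h| <= K * p n).
Hypothesis mix : forall e, 0 < e ->
  n%:R / x n * mixing X (Num.truncn (e * x n)) @[n --> \oo] --> (0 : R).

Let xoo := sqrt_npoo npoo.

Let x_gt0 : \forall n \near \oo, 0 < x n.
Proof. by move/cvgryPgt : xoo; exact. Qed.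

Let xV : (x n)^-1 @[n --> \oo] --> (0 : R).
Proof. exact/gtr0_cvgV0. Qed.

Let trunc_cvg e : 0 < e -> (Num.truncn (e * x n))%:R / x n @[n --> \oo] --> e.
Proof.
move=> e0.
have c1 : e - (x n)^-1 @[n --> \oo] --> e.
  by rewrite -[X in _ --> X]subr0; apply: cvgB; [exact: cvg_cst|exact: xV].
apply: (squeeze_cvgr _ c1 (cvg_cst e)); near=> n.
have x0 : 0 < x n by near: n.
have /andP[h1 h2] := truncn_itv (ltW (mulr_gt0 e0 x0)).
rewrite ler_pdivlMr// ler_pdivrMr// h1 andbT mulrBl mulVf ?gt_eqF//.
by rewrite lerBlDr natr1 ltW.
Unshelve. all: end_near. Qed.

Let trunc_oo e m : 0 < e -> \forall n \near \oo, (m <= Num.truncn (e * x n))%N.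
Proof.
move=> e0; near=> n.
have x0 : 0 < x n by near: n.
rewrite truncn_ge_nat ?(ltW (mulr_gt0 e0 x0))// mulrC -ler_pdivrMr//.
by near: n; move/cvgryPge : xoo; exact.
Unshelve. all: end_near. Qed.

Section fixed_ratio.
Variable e : R.
Hypotheses (e0 : 0 < e) (eC : e * C < 1).

Let b n := Num.truncn (e * x n).
Let h n := Num.truncn (e ^+ 2 * x n).
Let s n := (b n + h n + t)%N.
Let m n := ((n - t) %/ s n)%N.
Let V n := Ex P (fun w => (\sum_(k < b n) xi n k w) ^+ 2).

Let e20 : 0 < e ^+ 2. Proof. exact: exprn_gt0. Qed.

Let b_gt0 : \forall n \near \oo, (0 < b n)%N.
Proof. exact: trunc_oo. Qed.

Let s_cvg : (s n)%:R / x n @[n --> \oo] --> e + e ^+ 2.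
Proof.
have E n : (s n)%:R / x n = (b n)%:R / x n + (h n)%:R / x n + t%:R * (x n)^-1.
  by rewrite /s !natrD; ring.
under eq_fun do rewrite E.
have -> : e + e ^+ 2 = e + e ^+ 2 + t%:R * 0 by rewrite mulr0 addr0.
by apply: cvgD; [apply: cvgD; exact: trunc_cvg|exact: cvgMl_tmp].
Qed.

Let xn_cvg : x n / n%:R @[n --> \oo] --> (0 : R).
Proof.
have c : p n * (x n)^-1 @[n --> \oo] --> (0 * 0 : R) by apply: cvgM.
rewrite mulr0 in c; apply: (cvg_trans _ c); apply: near_eq_cvg; near=> n.
have x0 : 0 < x n by near: n.
have n0 : 0 < n%:R :> R by rewrite ltr0n; near: n; exact: nbhs_infty_gt.
apply: (mulIf (lt0r_neq0 x0)); apply: (mulIf (lt0r_neq0 n0)).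
rewrite divfK ?gt_eqF// mulrAC divfK ?gt_eqF//.
by rewrite -expr2 sqr_sqrtr ?mulr_ge0 ?(ltW n0) ?(ltW (p_gt0 n))// mulrC.
Unshelve. all: end_near. Qed.

Let ms_cvg : (m n)%:R * (s n)%:R / n%:R @[n --> \oo] --> (1 : R).
Proof.
have c : 1 - t%:R * n%:R^-1 - (s n)%:R / x n * (x n / n%:R) @[n --> \oo] --> (1 : R).
  rewrite -[X in _ --> X]subr0 -(mulr0 (e + e ^+ 2)); apply: cvgB; last exact: cvgM.
  rewrite -[X in _ --> X]subr0 -(mulr0 t%:R); apply: cvgB; first exact: cvg_cst.
  by apply: cvgMl_tmp; apply/gtr0_cvgV0; [exists 1%N => // n /= ?; rewrite ltr0n|exact: cvgr_idn].
apply: (squeeze_cvgr _ c (cvg_cst (1 : R))); near=> n.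
have x0 : 0 < x n by near: n.
have n0 : 0 < n%:R :> R by rewrite ltr0n; near: n; exact: nbhs_infty_gt.
have tn : (t <= n)%N by near: n; exact: nbhs_infty_ge.
have s0 : (0 < s n)%N by rewrite /s -addnA ltn_addr//; near: n.
rewrite ler_pdivlMr// ler_pdivrMr// mul1r -natrM ler_nat.
have hm : (m n * s n <= n - t)%N by exact: leq_trunc_div.
rewrite (leq_trans hm (leq_subr _ _)) andbT.
have : (n - t)%:R <= (m n * s n)%:R + (s n)%:R :> R.
  by rewrite -natrD ler_nat -mulSnr ltnW// ltn_ceil.
rewrite natrB// => h1.
have -> : (1 - t%:R / n%:R - (s n)%:R / x n * (x n / n%:R)) * n%:R = n%:R - t%:R - (s n)%:R.
  by field; rewrite !gt_eqF.
lra.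
Unshelve. all: end_near. Qed.

Let mb_cvg : (m n)%:R * (b n)%:R / n%:R @[n --> \oo] --> (1 + e)^-1.
Proof.
have ee0 : e + e ^+ 2 != 0 by rewrite gt_eqF// addr_gt0.
have c : (m n)%:R * (s n)%:R / n%:R * ((b n)%:R / x n / ((s n)%:R / x n)) @[n --> \oo] -->
    1 * (e / (e + e ^+ 2)).
  apply: cvgM; first exact: ms_cvg.
  by apply: cvgM; [exact: trunc_cvg|apply: cvgV].
have <- : 1 * (e / (e + e ^+ 2)) = (1 + e)^-1.
  by field; rewrite ee0 gt_eqF// addr_gt0.
apply: (cvg_trans _ c); apply: near_eq_cvg; near=> n.
have x0 : 0 < x n by near: n.
have n0 : 0 < n%:R :> R by rewrite ltr0n; near: n; exact: nbhs_infty_gt.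
have s0 : 0 < (s n)%:R :> R by rewrite ltr0n /s -addnA ltn_addr//; near: n.
by field; rewrite !gt_eqF.
Unshelve. all: end_near. Qed.

Let v n := (x n)^-1 ^+ 2 * V n.

Let mv_cvg : (m n)%:R * v n @[n --> \oo] --> (1 + e)^-1 * sigma2.
Proof.
have c : (m n)%:R * (b n)%:R / n%:R * (V n / ((b n)%:R * p n)) @[n --> \oo] --> (1 + e)^-1 * sigma2.
  by apply: cvgM; [exact: mb_cvg|apply: var => k; exact: trunc_oo].
apply: (cvg_trans _ c); apply: near_eq_cvg; near=> n.
have n0 : 0 < n%:R :> R by rewrite ltr0n; near: n; exact: nbhs_infty_gt.
have b0 : 0 < (b n)%:R :> R by rewrite ltr0n; near: n.
rewrite /v exprVn sqr_sqrtr ?mulr_ge0 ?(ltW n0) ?(ltW (p_gt0 n))//.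
by field; rewrite !gt_eqF.
Unshelve. all: end_near. Qed.

Let mmix_cvg : (m n)%:R * mixing X (h n) @[n --> \oo] --> (0 : R).
Proof.
have c : ((b n)%:R / x n)^-1 * (n%:R / x n * mixing X (h n)) @[n --> \oo] --> e^-1 * 0.
  by apply: cvgM; [apply: cvgV; [exact: lt0r_neq0|exact: trunc_cvg]|exact: mix].
rewrite mulr0 in c; apply: (squeeze_cvgr _ (cvg_cst 0) c); near=> n.
have x0 : 0 < x n by near: n.
have b0 : 0 < (b n)%:R :> R by rewrite ltr0n; near: n.
rewrite mulr_ge0 ?mixing_ge0//= mulrA ler_wpM2r ?mixing_ge0//.
have -> : ((b n)%:R / x n)^-1 * (n%:R / x n) = n%:R / (b n)%:R by field; rewrite !gt_eqF.
rewrite ler_pdivlMr// -natrM ler_nat; apply: leq_trans (leq_subr t n).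
by apply: leq_trans (leq_trunc_div _ (s n)); rewrite leq_mul2l; apply/orP; right; rewrite /s; lia.
Unshelve. all: end_near. Qed.

Let f n := 3 * ((x n)^-1 * ((b n)%:R * C)) * ((m n)%:R * v n) + 8 * ((m n)%:R * mixing X (h n)) +
  Num.sqrt (2 * K * ((n - t)%:R / n%:R - (m n)%:R * (b n)%:R / n%:R)).

Let lim_err := 3 * (e * C) * ((1 + e)^-1 * sigma2) + Num.sqrt (2 * K * (1 - (1 + e)^-1)).

Let f_cvg : f n @[n --> \oo] --> lim_err.
Proof.
rewrite /lim_err -[X in _ --> X + _]addr0 -(mulr0 8).
apply: cvgD.
  apply: cvgD; last by apply: cvgMl_tmp; exact: mmix_cvg.
  apply: cvgM; last exact: mv_cvg.
  apply: cvgMl_tmp.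
  have E n : (x n)^-1 * ((b n)%:R * C) = (b n)%:R / x n * C by ring.
  by under eq_fun do rewrite E; apply: cvgMr_tmp; exact: trunc_cvg.
apply: (cvg_comp (fun n => 2 * K * ((n - t)%:R / n%:R - (m n)%:R * (b n)%:R / n%:R)) Num.sqrt);
  last exact: sqrt_continuous.
apply: cvgMl_tmp; apply: cvgB; last exact: mb_cvg.
have c : 1 - t%:R * n%:R^-1 @[n --> \oo] --> (1 : R).
  rewrite -[X in _ --> X]subr0 -(mulr0 t%:R); apply: cvgB; first exact: cvg_cst.
  by apply: cvgMl_tmp; apply/gtr0_cvgV0; [exists 1%N => // n /= ?; rewrite ltr0n|exact: cvgr_idn].
apply: (cvg_trans _ c); apply: near_eq_cvg; near=> n.
have n0 : 0 < n%:R :> R by rewrite ltr0n; near: n; exact: nbhs_infty_gt.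
have tn : (t <= n)%N by near: n; exact: nbhs_infty_ge.
by rewrite natrB// mulrBl divff// gt_eqF.
Unshelve. all: end_near. Qed.

(** The error of the Gaussian approximation when the blocks have length about
   [e x] and the gaps about [e ^ 2 x], in the limit of large samples. *)
Lemma char_limit_error a : lim_err + `|expR (- ((1 + e)^-1 * sigma2 / 2)) - expR (- (sigma2 / 2))| < a ->
  \forall n \near \oo,
  `|Ex P (fun w => cos ((x n)^-1 * \sum_(k < n - t) xi n k w)) - expR (- (sigma2 / 2))| <= a /\
  `|Ex P (fun w => sin ((x n)^-1 * \sum_(k < n - t) xi n k w))| <= a.
Proof.
move=> ha.
have ec : f n + `|expR (- ((m n)%:R * v n / 2)) - expR (- (sigma2 / 2))| @[n --> \oo] -->
   lim_err + `|expR (- ((1 + e)^-1 * sigma2 / 2)) - expR (- (sigma2 / 2))|.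
  apply: cvgD; first exact: f_cvg.
  apply: cvg_norm; apply: cvgB; last exact: cvg_cst.
  apply: (cvg_comp (fun n => - ((m n)%:R * v n / 2)) expR); last exact: continuous_expR.
  by apply: cvgN; apply: cvgMr_tmp; exact: mv_cvg.
have bc : (b n)%:R / x n * C @[n --> \oo] --> e * C by apply: cvgMr_tmp; exact: trunc_cvg.
near=> n.
have x0 : 0 < x n by near: n.
have n0 : 0 < n%:R :> R by rewrite ltr0n; near: n; exact: nbhs_infty_gt.
have fa : f n + `|expR (- ((m n)%:R * v n / 2)) - expR (- (sigma2 / 2))| <= a.
  by near: n; exact: (cvgr_le _ ec).
have lam0 : 0 <= (x n)^-1 by rewrite invr_ge0 ltW.
have eta1 : (x n)^-1 * ((b n)%:R * C) <= 1.
  have -> : (x n)^-1 * ((b n)%:R * C) = (b n)%:R / x n * C by ring.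
  by near: n; exact: (cvgr_le _ bc).
have bn0 : (0 < b n)%N by near: n.
have mzn : measurable_fun setT (z n : borelRn R t.+2 -> R) by near: n.
have zCn : bounded_by C (z n) by near: n.
have xi0n : Ex P (xi n 0) = 0 by near: n.
have GKn : forall M, \sum_(h < M) `|gam X (z n) h| <= K * p n by near: n.
have fit : (m n * (b n + h n + t) <= n - t)%N by exact: leq_trunc_div.
have [hc hs] := full_sum_char stat mzn zCn xi0n bn0 lam0 eta1 fit (GKn (n - t)%N).
have sE : (x n)^-1 * Num.sqrt (2 * ((n - t)%:R - (m n)%:R * (b n)%:R) * (K * p n)) =
    Num.sqrt (2 * K * ((n - t)%:R / n%:R - (m n)%:R * (b n)%:R / n%:R)).
  rewrite -[in LHS](ger0_norm lam0) -sqrtr_sqr -sqrtrM ?sqr_ge0//; congr Num.sqrt.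
  rewrite exprVn sqr_sqrtr ?mulr_ge0 ?(ltW n0) ?(ltW (p_gt0 n))//.
  by field; rewrite !gt_eqF.
have errE : (m n)%:R * (3 * ((x n)^-1 * ((b n)%:R * C)) * v n + 8 * mixing X (h n)) +
    (x n)^-1 * Num.sqrt (2 * ((n - t)%:R - (m n)%:R * (b n)%:R) * (K * p n)) = f n.
  by rewrite sE /f; congr (_ + _); ring.
rewrite errE in hc hs.
split.
  apply: le_trans (ler_distD (expR (- ((m n)%:R * v n / 2))) _ _) _.
  by apply: le_trans fa; rewrite lerD2r.
by apply: le_trans hs (le_trans _ fa); rewrite lerDl.
Unshelve. all: end_near. Qed.

End fixed_ratio.

(** The ratio [e] of block length to [x n] is sent to zero after [n] has gone to
   infinity, which spares a diagonal choice of the block lengths. *)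
Lemma scalar_clt :
  Ex P (fun w => cos ((x n)^-1 * \sum_(k < n - t) xi n k w)) @[n --> \oo] --> expR (- (sigma2 / 2)) /\
  Ex P (fun w => sin ((x n)^-1 * \sum_(k < n - t) xi n k w)) @[n --> \oo] --> (0 : R).
Proof.
have near_a a : 0 < a -> \forall n \near \oo,
    `|Ex P (fun w => cos ((x n)^-1 * \sum_(k < n - t) xi n k w)) - expR (- (sigma2 / 2))| <= a /\
    `|Ex P (fun w => sin ((x n)^-1 * \sum_(k < n - t) xi n k w))| <= a.
  move=> a0; pose e (k : nat) : R := k.+1%:R^-1.
  have e0 k : 0 < e k by rewrite invr_gt0.
  have ce : e k @[k --> \oo] --> (0 : R) by exact: cvg_harmonic.
  have ce1 : (1 + e k)^-1 @[k --> \oo] --> (1 : R).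
    have c : (1 + e k)^-1 @[k --> \oo] --> ((1 + 0)^-1 : R).
      by apply: cvgV; [rewrite addr0 oner_neq0|apply: cvgD => //; exact: cvg_cst].
    by rewrite addr0 invr1 in c.
  have lim : 3 * (e k * C) * ((1 + e k)^-1 * sigma2) + Num.sqrt (2 * K * (1 - (1 + e k)^-1)) +
      `|expR (- ((1 + e k)^-1 * sigma2 / 2)) - expR (- (sigma2 / 2))| @[k --> \oo] --> (0 : R).
    suff : 3 * (e k * C) * ((1 + e k)^-1 * sigma2) + Num.sqrt (2 * K * (1 - (1 + e k)^-1)) +
        `|expR (- ((1 + e k)^-1 * sigma2 / 2)) - expR (- (sigma2 / 2))| @[k --> \oo] -->
      3 * (0 * C) * (1 * sigma2) + Num.sqrt (2 * K * (1 - 1)) +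
        `|expR (- (1 * sigma2 / 2)) - expR (- (sigma2 / 2))|.
      by rewrite mul0r mulr0 mul0r subrr mulr0 sqrtr0 mul1r subrr normr0 !addr0.
    apply: cvgD; first apply: cvgD.
    - by apply: cvgM; [apply: cvgMl_tmp; exact: cvgMr_tmp|exact: cvgMr_tmp].
    - apply: (cvg_comp (fun k => 2 * K * (1 - (1 + e k)^-1)) Num.sqrt); last exact: sqrt_continuous.
      by apply: cvgMl_tmp; apply: cvgB => //; exact: cvg_cst.
    - apply: cvg_norm; apply: cvgB; last exact: cvg_cst.
      apply: (cvg_comp (fun k => - ((1 + e k)^-1 * sigma2 / 2)) expR); last exact: continuous_expR.
      by apply: cvgN; apply: cvgMr_tmp; exact: cvgMr_tmp.
  have : \forall k \near \oo, 3 * (e k * C) * ((1 + e k)^-1 * sigma2) + Num.sqrt (2 * K * (1 - (1 + e k)^-1)) +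
      `|expR (- ((1 + e k)^-1 * sigma2 / 2)) - expR (- (sigma2 / 2))| < a.
    exact: (cvgr_lt _ lim).
  have ceC : e k * C @[k --> \oo] --> 0 * C by exact: cvgMr_tmp.
  have : \forall k \near \oo, e k * C < 1.
    by apply: (cvgr_lt _ ceC); rewrite mul0r.
  move=> [k1 _ H1] [k2 _ H2].
  apply: (char_limit_error (e0 (maxn k1 k2))).
    by apply: H1; exact: leq_maxl.
  by apply: H2; exact: leq_maxr.
split; apply/cvgrPdist_le => a a0; apply: filterS (near_a a a0) => n [hc hs].
  by rewrite distrC.
by rewrite sub0r normrN.
Qed.

End scalar_clt.

(** * The empirical process *)

Lemma tailp_gt0 d (T : measurableType d) (R : realType) (P : probability T R)
    (X : int -> {RV P >-> R}) (u : nat -> R) :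
  u n @[n --> \oo] --> (+oo : set_system R) ->
  n%:R * tailp X (u n) @[n --> \oo] --> (+oo : set_system R) ->
  forall x, 0 < tailp X x.
Proof.
move=> uoo npoo x; near \oo => n.
have xu : x <= u n by near: n; move/cvgryPge : uoo; exact.
have np : 0 < n%:R * tailp X (u n) by near: n; move/cvgryPgt : npoo; exact.
apply: lt_le_trans (le_tailp X xu); rewrite lt_neqAle tailp_ge0 andbT eq_sym.
by apply/eqP => p0; rewrite p0 mulr0 ltxx in np.
Unshelve. all: end_near. Qed.

Section empirical_process.
Context {R : realType} {d : measure_display} {T : measurableType d}.
Variables (P : probability T R) (X : int -> {RV P >-> R}).
Hypothesis stat : strictly_stationary X.
Variables (t N : nat) (A : 'I_N.+1 -> set 'rV[R]_t.+2).
Hypotheses (A_borel : forall j, borel_set (A j)) (A_domain : forall j, A j `<=` @evt_domain R t).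
Variable u : nat -> R.
Let p n := tailp X (u n).
Hypotheses (p_gt0 : forall x, 0 < tailp X x) (uoo : u n @[n --> \oo] --> +oo).
Hypothesis npoo : n%:R * p n @[n --> \oo] --> (+oo : set_system R).
Implicit Types (c : 'rV[R]_N.+1).

Local Notation x n := (Num.sqrt (n%:R * p n)).
Local Notation xs c n := (xi X (score X A (u n) c)).

(** The empirical measure averages [n - t] windows over [n]; its centring is
    therefore off by a deterministic term of order [1 / x n]. *)
Definition emp_bias c n : R :=
  - ((x n)^-1 * (t%:R * \sum_j c 0 j * (Pr P (hit X (u n) (A j) 0) / p n) * p n)).

Lemma dot_emp_process c n w : 0 < u n -> (t <= n)%N -> (0 < n)%N ->
  dot c (emp_process X A u n w) = (x n)^-1 * \sum_(k < n - t) xs c n k w + emp_bias c n.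
Proof.
move=> u0 tn n0; have pn : 0 < p n := p_gt0 (u n).
have n0' : 0 < n%:R :> R by rewrite ltr0n.
have np : 0 < n%:R * p n by exact: mulr_gt0.
have x0 : 0 < x n by rewrite sqrtr_gt0.
pose q j := Pr P (hit X (u n) (A j) 0).
pose I j (k : nat) : R := \1_(scaled_set (u n) (A j)) (window X k%:Z t.+2 w).
have coord j : emp_process X A u n w ord0 j =
    (x n)^-1 * (\sum_(k < n - t) (I j k - q j) - t%:R * q j).
  rewrite mxE /emp_measure /cond_Pr -/(p n).
  have -> : window X (-1) t.+2 @^-1` scaled_set (u n) (A j) `&` exceeds X (u n) =
      hit X (u n) (A j) 0.
    apply/setIidPl; exact: (hit_exceeds (X := X) (h := 0) u0 (A_domain (j:=j))).
  have -> : \sum_(1 <= k < (n - t).+1) \1_(scaled_set (u n) (A j)) (window X (k%:Z - 1) t.+2 w) =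
      \sum_(k < n - t) I j k.
    rewrite big_add1 big_mkord; apply: eq_bigr => k _; rewrite /I.
    by rewrite (_ : (k.+1)%:Z - 1 = k%:Z)//; lia.
  have -> : \sum_(k < n - t) (I j k - q j) = \sum_(k < n - t) I j k - (n%:R - t%:R) * q j.
    by rewrite sumrB sumr_const card_ord -[q j *+ _]mulr_natl natrB.
  rewrite -/(q j).
  have xE : Num.sqrt (n%:R * p n) = (x n)^-1 * (n%:R * p n).
    by rewrite -{3}(sqr_sqrtr (ltW np)) expr2 mulrA mulVf ?mul1r// gt_eqF.
  rewrite [in LHS]xE; move: (\sum_(k < n - t) _) => S.
  rewrite -mulrA; congr (_ * _); rewrite -[Pr P (exceeds _ _)]/(p n).
  by field; rewrite !gt_eqF.
rewrite dotE; under eq_bigr do rewrite coord.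
have -> : emp_bias c n = - ((x n)^-1 * (t%:R * \sum_j c 0 j * q j)).
  congr (- (_ * (_ * _))); apply: eq_bigr => j _.
  by rewrite -mulrA divfK// gt_eqF.
rewrite -mulrBr; transitivity ((x n)^-1 * \sum_j c 0 j * (\sum_(k < n - t) (I j k - q j) - t%:R * q j)).
  by rewrite mulr_sumr; apply: eq_bigr => j _; rewrite mulrCA.
congr (_ * _); rewrite /xi /score exchange_big /= mulr_sumr -sumrB.
apply: eq_bigr => j _; rewrite -mulr_sumr mulrBr; congr (_ - _).
by rewrite mulrCA.
Qed.

Lemma emp_bias_cvg0 c : emp_bias c n @[n --> \oo] --> (0 : R).
Proof.
have xV : (x n)^-1 @[n --> \oo] --> (0 : R).
  apply/gtr0_cvgV0; last exact: sqrt_npoo.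
  by have := sqrt_npoo npoo; move/cvgryPgt; exact.
pose D := t%:R * \sum_j `|c 0 j|.
have c0 : D * (x n)^-1 @[n --> \oo] --> D * 0 by exact: cvgMl_tmp.
rewrite mulr0 in c0; apply/cvgrPdist_le => e e0.
near=> n.
have u0 : 0 < u n by near: n; move/cvgryPgt : uoo; exact.
have pn : 0 < p n := p_gt0 (u n).
have xn0 : 0 <= (x n)^-1 by rewrite invr_ge0.
apply: (@le_trans _ _ (D * (x n)^-1)); last by near: n; exact: (cvgr_le _ c0).
rewrite sub0r normrN normrN normrM (ger0_norm xn0) mulrC ler_wpM2r// normrM ger0_norm// /D ler_wpM2l//.
apply: le_trans (ler_norm_sum _ _ _) _; apply: ler_sum => j _.
rewrite -mulrA divfK ?gt_eqF// normrM ler_piMr// ger0_norm ?Pr_ge0//.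
by rewrite Pr_le1//; exact: measurable_hit.
Unshelve. all: end_near. Qed.

Lemma measurable_emp_process n : measurable_coords (emp_process X A u n).
Proof.
move=> j; under eq_fun do rewrite mxE.
rewrite /emp_measure.
apply: measurable_funM => //; apply: measurable_funB => //; apply: measurable_funM => //.
apply: measurable_funM => //; apply: measurable_sum => k.
apply: (@measurableT_comp _ _ _ _ _ _ (\1_(scaled_set (u n) (A j)) : borelRn R t.+2 -> R)).
  by apply: (@measurable_indic _ (borelRn R t.+2)); exact: borel_scaled_set.
by apply: measurable_fun_rV; exact: measurable_window.
Qed.

(** Bounded second moments of the linear combinations give tightness. *)
Lemma emp_second_moment c K : 0 <= K ->
  (\forall n \near \oo, forall M, \sum_(h < M) `|gam X (score X A (u n) c) h| <= K * p n) ->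
  \forall n \near \oo, Ex P (fun w => dot c (emp_process X A u n w) ^+ 2) <= 4 * K + 2.
Proof.
move=> K0 GK; near=> n.
have u0 : 0 < u n by near: n; move/cvgryPgt : uoo; exact.
have tn : (t <= n)%N by near: n; exact: nbhs_infty_ge.
have n0 : (0 < n)%N by near: n; exact: nbhs_infty_gt.
have pn : 0 < p n := p_gt0 (u n).
have x2 : 0 < n%:R * p n by rewrite mulr_gt0// ltr0n.
have B1 : `|emp_bias c n| <= 1.
  by near: n; have /cvgrPdist_le/(_ 1 ltr01) := emp_bias_cvg0 c; apply: filterS => n; rewrite sub0r normrN.
have GKn : forall M, \sum_(h < M) `|gam X (score X A (u n) c) h| <= K * p n by near: n.
have mz := measurable_score X A_borel (u n) c; have zC := bounded_score X A_borel (u n) c.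
have bS : bounded_mfun (fun w => \sum_(k < n - t) 1 * xs c n k w).
  by apply: bounded_mfun_sum => k _; apply: bounded_mfunZ; exact: bounded_xi.
have ES : Ex P (fun w => (\sum_(k < n - t) 1 * xs c n k w) ^+ 2) <= 2 * n%:R * (K * p n).
  have c01 (k : nat) : 0 <= (1 : R) <= 1 by rewrite lexx ler01.
  apply: le_trans (Ex_weighted_sum_sqr stat mz zC (n - t) c01) _.
  rewrite sumr_const card_ord; apply: ler_pM; [by []|by apply: sumr_ge0| |exact: GKn].
  by rewrite ler_wpM2l// ler_nat leq_subr.
have bS2 := bounded_mfunX 2 bS.
have bZ := bounded_mfunZ (2 * (n%:R * p n)^-1) bS2.
have b2 := @bounded_mfun_cst _ T R 2.
apply: (@le_trans _ _ (Ex P (fun w => 2 * (n%:R * p n)^-1 * (\sum_(k < n - t) 1 * xs c n k w) ^+ 2 + 2))).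
  apply: le_Ex; [|exact: bounded_mfunD|].
    apply: (@bounded_mfunX _ _ _ 2 (fun w => dot c (emp_process X A u n w))).
    have -> : (fun w => dot c (emp_process X A u n w)) =
        (fun w => (x n)^-1 * \sum_(k < n - t) 1 * xs c n k w + emp_bias c n).
      by apply/funext => w; rewrite dot_emp_process//; under [in RHS]eq_bigr do rewrite mul1r.
    by apply: bounded_mfunD; [exact: bounded_mfunZ|exact: bounded_mfun_cst].
  move=> w; rewrite dot_emp_process//; under [in leRHS]eq_bigr do rewrite mul1r.
  move: (\sum_(k < n - t) _) => S.
  rewrite -[in leRHS](sqr_sqrtr (ltW x2)) -exprVn -mulrA -exprMn.
  move: ((x n)^-1 * S) => a; move: B1; rewrite ler_norml => /andP[h1 h2].
  move: (emp_bias c n) h1 h2 => B h1 h2.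
  have := sqr_ge0 (a - B); nra.
rewrite (ExD _ bZ b2) Ex_cst ExZ// lerD2r.
apply: (@le_trans _ _ (2 * (n%:R * p n)^-1 * (2 * n%:R * (K * p n)))).
  by rewrite ler_wpM2l// mulr_ge0// invr_ge0 ltW.
by rewrite le_eqVlt; apply/orP; left; apply/eqP; field; rewrite !gt_eqF// ltr0n.
Unshelve. all: end_near. Qed.

End empirical_process.

Theorem theorem4p4 (R : realType)
  (d : measure_display) (T : measurableType d) (P : probability T R)
  (d' : measure_display) (T' : measurableType d') (Q : probability T' R)
  (X : int -> {RV P >-> R}) (Y : int -> {RV Q >-> R}) (alpha : R)
  (alpha_gt0 : 0 < alpha)
  (X_stationary : strictly_stationary X)
  (X_endpoint : finite_lower_endpoint X)
  (X_domain : in_frechet_domain X alpha)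
  (X_regvar : regularly_varying X alpha)
  (Y_tail : is_tail_process X Y alpha)
  (t N : nat) (A : 'I_N.+1 -> set 'rV[R]_(t.+2))
  (A_domain : forall j, A j `<=` @evt_domain R t)
  (A_borel : forall j, borel_set (A j))
  (A_continuity : forall j, window_law Y (-1) (boundary (A j)) = 0%E)
  (u : nat -> R) (X_M : condition_M X u)
  (delta : R) (delta_ge2 : 2 <= delta)
  (X_mixing : mixing X =O_\oo (fun n : nat => n%:R `^ (- delta)))
  (rate_gt2 : 2 < delta ->
    n%:R `^ (delta / (4 + delta)) * tailp X (u n) @[n --> \oo] --> +oo)
  (rate_eq2 : delta = 2 ->
    n%:R `^ (1 / 2) * (tailp X (u n) `^ (3 / 2) / `|ln (tailp X (u n))|)
      @[n --> \oo] --> +oo) :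
  (forall j l, limit_cov Y (A j) (A l) \is a fin_num) /\
  exists nu : probability (borelRn R N.+1) R,
    multinormal nu 0 (\matrix_(j, l) fine (limit_cov Y (A j) (A l))) /\
    weak_cvg \oo
      (fun n g => \int[P]_w g (emp_process X A u n w))
      (fun g => \int[nu]_x g x).
Proof.
have [r [[uoo roo npoo rp] [mixsum anti]]] := X_M.
have p_gt0 := tailp_gt0 uoo npoo.
have p0 := tailp_cvg0 roo rp.
split.
  exact (limit_cov_fin_num X_stationary Y_tail p_gt0 uoo roo rp mixsum anti
    A_borel A_domain A_continuity).
have pS := psd_limit_mx X_stationary Y_tail p_gt0 uoo roo rp mixsum anti
  A_borel A_domain A_continuity.
have [nu [nuN nu_char]] := multinormal_exists pS.
exists nu; split=> // g cg [M0 [_ gM0]].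
have gM : bounded_by (M0 + 1) g by move=> y; apply: gM0; rewrite ?ltrDl.
pose V := emp_process X A u.
pose x n := Num.sqrt (n%:R * tailp X (u n)).
pose S c n w := (x n)^-1 * \sum_(k < n - t) xi X (score X A (u n) c) k w.
have u_gt0 : \forall n \near \oo, 0 < u n by move/cvgryPgt : uoo; exact.
have clt c : Ex P (fun w => cos (S c n w)) @[n --> \oo] -->
      expR (- (bform (limit_mx Y A) c c / 2)) /\
    Ex P (fun w => sin (S c n w)) @[n --> \oo] --> (0 : R).
  have [K K0 GK] := gam_sum_le X_stationary p_gt0 uoo roo rp mixsum anti A_borel A_domain c.
  apply: (scalar_clt (C := \sum_j `|c 0 j|) X_stationary _ _ _ (fun n => p_gt0 (u n)) p0 npoo _ K0 GK).
  - by apply: nearW => n; exact: measurable_score.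
  - by apply: nearW => n; exact: bounded_score.
  - by apply: nearW => n; exact: Ex_xi0_score.
  - move=> b boo; exact: (block_variance_cvg X_stationary Y_tail p_gt0 uoo roo rp mixsum anti
      A_borel A_domain A_continuity boo).
  - move=> e e0; exact: (block_mixing_cvg0 (fun n => p_gt0 (u n)) p0 npoo delta_ge2
      (mixing_ge0 X) X_mixing rate_gt2 rate_eq2 e0).
have bias c := emp_bias_cvg0 A_borel p_gt0 uoo npoo c.
(* The deterministic bias is absorbed because sine and cosine are 1-Lipschitz. *)
have debias (F : R -> R) c (l : R) : (forall f : T -> R, measurable_fun setT f -> bounded_mfun (fun w => F (f w))) ->
    (forall a y, `|F (a + y) - F a| <= `|y|) ->
    Ex P (fun w => F (S c n w)) @[n --> \oo] --> l ->
    Ex P (fun w => F (dot c (V n w))) @[n --> \oo] --> l.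
  move=> bF lip cF; apply/cvgrPdist_le => e e0; have e20 : 0 < e / 2 by rewrite divr_gt0.
  move/cvgrPdist_le : (cF) => /(_ _ e20) H1.
  move/cvgrPdist_le : (bias c) => /(_ _ e20) H2.
  near=> n.
  have u0 : 0 < u n by near: n.
  have tn : (t <= n)%N by near: n; exact: nbhs_infty_ge.
  have n0 : (0 < n)%N by near: n; exact: nbhs_infty_gt.
  have h1 : `|l - Ex P (fun w => F (S c n w))| <= e / 2 by near: n.
  have h2 : `|0 - emp_bias X A u c n| <= e / 2 by near: n.
  rewrite sub0r normrN in h2.
  have mS : measurable_fun setT (S c n).
    apply: measurable_funM => //; apply: measurable_sum => k.
    by apply: measurable_xi; exact: measurable_score.
  have mD : measurable_fun setT (fun w => S c n w + emp_bias X A u c n).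
    by apply: measurable_funD.
  have h3 : `|Ex P (fun w => F (S c n w)) - Ex P (fun w => F (dot c (V n w)))| <= e / 2.
    have -> : (fun w => F (dot c (V n w))) = (fun w => F (S c n w + emp_bias X A u c n)).
      by apply/funext => w; rewrite /V dot_emp_process.
    rewrite -(ExB P (bF _ mS) (bF _ mD)); apply: Ex_bound; first exact: bounded_mfunB (bF _ mS) (bF _ mD).
    by move=> w; rewrite distrC; apply: le_trans h2; exact: lip.
  by rewrite (splitr e) (le_trans (ler_distD (Ex P (fun w => F (S c n w))) _ _))// lerD.
have mV n : measurable_coords (V n) by exact: measurable_emp_process.
apply: (levy_continuity (Q := nu) (V := V) (Z := id) mV _ _ _ _ cg gM).
- by move=> i; exact: measurable_coord.
- move=> c; have [-> _] := nu_char c; rewrite mulNr.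
  apply: debias; [exact: bounded_mfun_cos|exact: norm_cosD_le|exact: (clt c).1].
- move=> c; have [_ ->] := nu_char c.
  apply: debias; [exact: bounded_mfun_sin|exact: norm_sinD_le|exact: (clt c).2].
move=> e e0.
pose cj (j : 'I_N.+1) : 'rV[R]_N.+1 := delta_mx 0 j.
have HK j : exists K, 0 <= K /\ \forall n \near \oo, Ex P (fun w => dot (cj j) (V n w) ^+ 2) <= 4 * K + 2.
  have [K K0 GK] := gam_sum_le X_stationary p_gt0 uoo roo rp mixsum anti A_borel A_domain (cj j).
  by exists K; split=> //; exact: emp_second_moment.
have [K KP] := choice HK.
pose B := \sum_j (4 * K j + 2).
have B0 : 0 <= B.
  by apply: sumr_ge0 => j _; rewrite addr_ge0// mulr_ge0//; have [] := KP j.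
have r0 : 0 <= B / e by rewrite divr_ge0// ltW.
(* Chebyshev: the radius satisfies B / L ^+ 2 <= e. *)
pose L := 1 + B / e.
have L0 : 0 < L by rewrite /L; lra.
exists L => //.
have HB : \forall n \near \oo, forall j, Ex P (fun w => dot (cj j) (V n w) ^+ 2) <= 4 * K j + 2.
  by apply: filter_forall => j; have [] := KP j.
near=> n.
have u0 : 0 < u n by near: n.
have tn : (t <= n)%N by near: n; exact: nbhs_infty_ge.
have n0 : (0 < n)%N by near: n; exact: nbhs_infty_gt.
have HBn : forall j, Ex P (fun w => dot (cj j) (V n w) ^+ 2) <= 4 * K j + 2 by near: n.
have bd c : bounded_mfun (fun w => dot c (V n w)).
  have -> : (fun w => dot c (V n w)) = (fun w => S c n w + emp_bias X A u c n).
    by apply/funext => w; rewrite /V dot_emp_process.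
  apply: bounded_mfunD; last exact: bounded_mfun_cst.
  apply: bounded_mfunZ; apply: bounded_mfun_sum => k _.
  exact: (bounded_xi X (measurable_score X A_borel (u n) c) (bounded_score X A_borel (u n) c)).
have bs : bounded_mfun (fun w => \sum_j dot (cj j) (V n w) ^+ 2).
  by apply: bounded_mfun_sum => j _; exact: bounded_mfunX.
have mO := measurable_outside_cube L (mV n).
rewrite -Ex_indic//.
apply: (@le_trans _ _ (Ex P (fun w => (L ^+ 2)^-1 * \sum_j dot (cj j) (V n w) ^+ 2))).
  apply: le_Ex; [exact: bounded_mfun_indic|exact: bounded_mfunZ|move=> w].
  have s0 : 0 <= \sum_j dot (cj j) (V n w) ^+ 2 by apply: sumr_ge0 => j _; exact: sqr_ge0.
  rewrite indicE; case: (boolP (w \in _)) => [|_].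
    rewrite inE => -[j Lj]; rewrite mulrC ler_pdivlMr ?exprn_gt0// mul1r.
    rewrite (bigD1 j)//= dot_delta -[leLHS]addr0 lerD//.
      by rewrite -[leRHS]real_normK ?num_real// lerXn2r ?nnegrE ?(ltW L0) ?(ltW Lj).
    by apply: sumr_ge0 => i _; exact: sqr_ge0.
  by rewrite mulr_ge0// invr_ge0 exprn_ge0// ltW.
rewrite ExZ// Ex_sum; last by move=> j _; exact: bounded_mfunX.
rewrite mulrC ler_pdivrMr ?exprn_gt0//.
apply: (@le_trans _ _ B); first by apply: ler_sum => j _; exact: HBn.
have -> : B = e * (B / e) by field; rewrite gt_eqF.
by rewrite ler_pM2l// /L expr2; nra.
Unshelve. all: end_near. Qed.
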